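(* A Turing degree is high for isomorphism for Harrison orders if and only if it is high for isomorphism; and a Turing degree is uniformly high for isomorphism for Harrison orders if and only if it is uniformly high for isomorphism.
   Context: A Harrison order is a computable linear order of order type $\omega_1^{ck}(1+\mathbb Q)$. Let $(\mathcal M_i)_{i\in\omega}$ be an effective listing of all computable structures. A degree $\mathbf d$ is high for isomorphism if for any two computable structures $\mathcal M\cong\mathcal N$ there is a $\mathbf d$-computable isomorphism from $\mathcal M$ to $\mathcal N$; it is uniformly high for isomorphism if there are $D\in\mathbf d$ and a total computable $f$ such that whenever $\mathcal M_i\cong\mathcal M_j$, $\{f(i,j)\}^D$ is an isomorphism from $\mathcal M_i$ to $\mathcal M_j$. A degree $\mathbf d$ is high for isomorphism for Harrison orders if for any two computable linear orders $\mathcal M,\mathcal N$ both of order type $\omega_1^{ck}(1+\mathbb Q)$ there is a $\mathbf d$-computable isomorphism between them; it is uniformly high for isomorphism for Harrison orders if there are $D\in\mathbf d$ and a total computable $f$ such that whenever $\mathcal M_i,\mathcal M_j$ are both linear orders of order type $\omega_1^{ck}(1+\mathbb Q)$, $\{f(i,j)\}^D$ is an isomorphism from $\mathcal M_i$ to $\mathcal M_j$. *)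

(* Defs.v *)
From mathcomp Require Import all_boot all_order all_algebra.

Set Implicit Arguments.
Unset Strict Implicit.
Unset Printing Implicit Defensive.

(** * Oracle computability on [nat] *)

(** Cantor's pairing bijection and the induced bijective coding of lists. *)
Definition npair (x y : nat) : nat := ((x + y) * (x + y).+1)./2 + y.

Fixpoint seqcode (s : seq nat) : nat :=
  if s is x :: s' then (npair x (seqcode s')).+1 else 0.

(** Programs for the functions partial recursive in an oracle. All programs
    are unary; several arguments are passed through [npair]. *)
Inductive code : Type :=
| Zero
| Succ
| Left
| Right
| Oracle
| Pair of code & code
| Comp of code & code
| Prec of code & code
| Mu of code.

Fixpoint prec_graph (F G : nat -> nat -> Prop) (a k m : nat) : Prop :=
  if k is k'.+1 then
    exists r, prec_graph F G a k' r /\ G (npair a (npair k' r)) m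
  else F a m.

(** [eval D c n m]: the program [c] with oracle [D] halts on input [n] with
    output [m]. *)
Fixpoint eval (D : pred nat) (c : code) (n m : nat) : Prop :=
  match c with
  | Zero => m = 0
  | Succ => m = n.+1
  | Left => exists b, n = npair m b
  | Right => exists a, n = npair a m
  | Oracle => m = D n
  | Pair f g => exists a b, [/\ eval D f n a, eval D g n b & m = npair a b]
  | Comp f g => exists k, eval D g n k /\ eval D f k m
  | Prec f g =>
      exists a k, n = npair a k /\ prec_graph (eval D f) (eval D g) a k m
  | Mu f =>
      eval D f (npair n m) 0 /\
      forall i, i < m -> exists r, eval D f (npair n i) r.+1
  end.

(** An injective Goedel numbering; numbers outside its range index the nowhere
    defined function. *)
Fixpoint gnum (c : code) : nat :=
  match c with
  | Zero => npair 0 0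
  | Succ => npair 1 0
  | Left => npair 2 0
  | Right => npair 3 0
  | Oracle => npair 4 0
  | Pair f g => npair 5 (npair (gnum f) (gnum g))
  | Comp f g => npair 6 (npair (gnum f) (gnum g))
  | Prec f g => npair 7 (npair (gnum f) (gnum g))
  | Mu f => npair 8 (gnum f)
  end.

(** [phi D e x y] is [{e}^D(x) = y]. *)
Definition phi (D : pred nat) (e x y : nat) : Prop :=
  exists c, gnum c = e /\ eval D c x y.

Definition phi0 : nat -> nat -> nat -> Prop := phi xpred0.

Definition computable_set (A : pred nat) : Prop :=
  exists e, forall x, phi0 e x (A x).

Definition computable_rel (R : rel nat) : Prop :=
  exists e, forall x y, phi0 e (npair x y) (R x y).

Definition computable_fun2 (f : nat -> nat -> nat) : Prop :=
  exists e, forall x y, phi0 e (npair x y) (f x y).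

(** ** Turing degrees *)

Definition turing_le (A B : pred nat) : Prop :=
  exists e, forall x, phi B e x (A x).

Definition turing_equiv (A B : pred nat) : Prop :=
  turing_le A B /\ turing_le B A.

Record degree : Type := Degree {
  in_degree :> pred nat -> Prop;
  degreeP : exists A, forall B, in_degree B <-> turing_equiv A B
}.

(** * Computable structures *)

(** A nonempty structure with universe a subset of [nat], together with its
    language, which has at most countably many relation and function symbols,
    all named by natural numbers: [rel_ar s = Some n] means that [s] names a
    relation symbol of arity [n], and [None] that there is no such symbol.
    Constants are function symbols of arity 0. The values of [rel_int] and
    [fun_int] at absent symbols, at lists of the wrong length or at lists not
    included in the universe are irrelevant. *)
Record structure : Type := Structure {
  rel_ar : nat -> option nat;
  fun_ar : nat -> option nat;
  dom : pred nat;
  rel_int : nat -> seq nat -> bool;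
  fun_int : nat -> seq nat -> nat;
  dom_nonempty : exists x, dom x;
  fun_closed : forall s xs, fun_ar s = Some (size xs) -> all dom xs ->
    dom (fun_int s xs)
}.

Definition optcode (o : option nat) : nat := if o is Some n then n.+1 else 0.

(** [lists i M]: the [i]-th computable structure is (defined and equal to) [M],
    that is, the [i]-th partial computable function decides the language, the
    universe and the atomic diagram of [M]. The values of [M] which are
    irrelevant are not constrained. *)
Definition lists (i : nat) (M : structure) : Prop :=
  [/\ forall s, phi0 i (npair 0 s) (optcode (rel_ar M s)),
      forall s, phi0 i (npair 1 s) (optcode (fun_ar M s)),
      forall x, phi0 i (npair 2 x) (dom M x),
      forall s xs, rel_ar M s = Some (size xs) -> all (dom M) xs ->
        phi0 i (npair 3 (npair s (seqcode xs))) (rel_int M s xs) &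
      forall s xs, fun_ar M s = Some (size xs) -> all (dom M) xs ->
        phi0 i (npair 4 (npair s (seqcode xs))) (fun_int M s xs)].

Definition computable_structure (M : structure) : Prop := exists i, lists i M.

Definition same_language (M N : structure) : Prop :=
  rel_ar M =1 rel_ar N /\ fun_ar M =1 fun_ar N.

(** Only the restriction of [F] to [dom M] matters. *)
Definition is_iso (M N : structure) (F : nat -> nat) : Prop :=
  same_language M N /\
  [/\ {in dom M, forall x, dom N (F x)},
      {in dom M &, injective F},
      forall y, dom N y -> exists x, dom M x /\ F x = y,
      forall s xs, rel_ar M s = Some (size xs) -> all (dom M) xs ->
        rel_int N s (map F xs) = rel_int M s xs &
      forall s xs, fun_ar M s = Some (size xs) -> all (dom M) xs ->
        fun_int N s (map F xs) = F (fun_int M s xs)].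

Definition isomorphic (M N : structure) : Prop := exists F, is_iso M N F.

(** [{e}^D] is an isomorphism from [M] to [N]. *)
Definition iso_by (D : pred nat) (e : nat) (M N : structure) : Prop :=
  exists F, is_iso M N F /\ forall x, dom M x -> phi D e x (F x).

(** * Order types *)

Definition linear_on (T : Type) (A : T -> Prop) (le : T -> T -> Prop) : Prop :=
  [/\ forall x, A x -> le x x,
      forall x y, A x -> A y -> le x y -> le y x -> x = y,
      forall x y z, A x -> A y -> A z -> le x y -> le y z -> le x z &
      forall x y, A x -> A y -> le x y \/ le y x].

Definition order_iso (T U : Type) (A : T -> Prop) (leT : T -> T -> Prop)
    (B : U -> Prop) (leU : U -> U -> Prop) : Prop :=
  exists f : T -> U,
    [/\ forall x, A x -> B (f x),
        forall x y, A x -> A y -> f x = f y -> x = y,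
        forall y, B y -> exists x, A x /\ f x = y &
        forall x y, A x -> A y -> (leT x y <-> leU (f x) (f y))].

Definition well_order (T : Type) (le : T -> T -> Prop) : Prop :=
  linear_on (fun=> True) le /\
  forall B : T -> Prop, (exists x, B x) ->
    exists x, B x /\ forall y, B y -> le x y.

Definition has_computable_copy (T : Type) (A : T -> Prop)
    (le : T -> T -> Prop) : Prop :=
  exists (C : pred nat) (R : rel nat),
    [/\ computable_set C, computable_rel R &
        order_iso A le (fun x => C x) (fun x y => R x y)].

(** [(W, le)] is a copy of the least noncomputable ordinal: a well-order with no
    computable copy, all of whose proper initial segments have one. *)
Definition is_omega1ck (W : Type) (le : W -> W -> Prop) : Prop :=
  [/\ well_order le,
      ~ has_computable_copy (fun=> True) le &
      forall w, has_computable_copy (fun v => le v w /\ v <> w) le].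

(** The order [1 + Q], with [None] as its least element. *)
Definition onepQ_lt (p q : option rat) : Prop :=
  match p, q with
  | _, None => False
  | None, Some _ => True
  | Some a, Some b => (a < b)%R
  end.

(** The product [W * (1 + Q)] of order types, that is, [1 + Q] many copies of
    [W]: the component in [1 + Q] is the most significant. *)
Definition times_onepQ (W : Type) (le : W -> W -> Prop)
    (u v : W * option rat) : Prop :=
  onepQ_lt u.2 v.2 \/ (u.2 = v.2 /\ le u.1 v.1).

(** The language of orders has the single binary relation symbol 0, read as the
    non-strict order. *)
Definition structure_le (M : structure) (x y : nat) : Prop :=
  rel_int M 0 [:: x; y].

Definition linear_order (M : structure) : Prop :=
  [/\ forall s, rel_ar M s = if s is 0 then Some 2 else None,
      forall s, fun_ar M s = None &
      linear_on (fun x => dom M x) (structure_le M)].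

Definition harrison_type (M : structure) : Prop :=
  linear_order M /\
  exists (W : Type) (le : W -> W -> Prop),
    is_omega1ck le /\
    order_iso (fun x => dom M x) (structure_le M)
      (fun=> True) (times_onepQ le).

(** * Highness notions *)

Definition high_for_iso (d : degree) : Prop :=
  forall M N : structure,
    computable_structure M -> computable_structure N -> isomorphic M N ->
    exists D e, d D /\ iso_by D e M N.

Definition uniformly_high_for_iso (d : degree) : Prop :=
  exists (D : pred nat) (f : nat -> nat -> nat),
    [/\ d D, computable_fun2 f &
        forall i j M N, lists i M -> lists j N -> isomorphic M N ->
          iso_by D (f i j) M N].

Definition high_for_iso_harrison (d : degree) : Prop :=
  forall M N : structure,
    computable_structure M -> computable_structure N ->
    harrison_type M -> harrison_type N ->
    exists D e, d D /\ iso_by D e M N.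

Definition uniformly_high_for_iso_harrison (d : degree) : Prop :=
  exists (D : pred nat) (f : nat -> nat -> nat),
    [/\ d D, computable_fun2 f &
        forall i j M N, lists i M -> lists j N ->
          harrison_type M -> harrison_type N ->
          iso_by D (f i j) M N].

(* Main.v *)
Require Import Defs.
From mathcomp Require Import all_boot all_order all_algebra.
From mathcomp Require Import zify boolp.

(** The easy directions hold because omega_1^ck, and hence the Harrison order, is
    unique up to isomorphism. For the hard ones, the isomorphisms between two
    computable structures are the paths through a computable tree T, so it is
    enough to find Harrison orders N and M, uniformly in T, such that any
    isomorphism from N to M computes a path through T when there is one.

    M is the Kleene-Brouwer order, with its root moved to the bottom, of the tree
    T * S with every subtree repeated infinitely often. The ill-founded tree S is
    chosen by diagonalization such that every final segment of M is comparable,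
    for the relation of being isomorphic to an initial segment, with the
    Kleene-Brouwer orders of all computable well-founded trees. This is a
    Sigma^1_1 property that holds for all well-founded S, hence for some
    ill-founded S. It makes the well-ordered part of every final segment of M a
    copy of omega_1^ck. Thanks to the repetitions every such part extends to a maximal
    one with a least element, so M has order type omega_1^ck (1 + Q).

    N is the lexicographic product of a computable copy of 1 + Q with M, which is
    again a Harrison order. The first elements of the copies of M in N form a
    known dense suborder, so an isomorphism from N to M computes a dense family in
    M. Between two of its elements that extend a common node of T * S there are
    infinitely many more, bounded in their next letter, and so two with a longer
    common prefix; iterating the search computes a path. *)

Set Implicit Arguments.
Unset Strict Implicit.
Unset Printing Implicit Defensive.

(** * Computable functionals *)

(** Comparing M with itself would give nothing, the identity being an isomorphism. N has the same
    order type but displays a computable dense family, which M hides. The Kleene-Brouwer order of T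
    alone need not be a Harrison order: if T is a single branch, its type is the reverse of omega.
    The factor S repairs this, and since the property required of S quantifies over all T, one fixed
    S serves every T. This is what makes the reduction uniform. The ordinal omega_1^ck is only known
    through computable copies. Its proper initial segments get theirs for free, as intervals of M
    are decidable; the work lies in excluding a copy of the whole. A copy would produce a
    well-founded tree that is too long to compare with the final segment. The same absence of a copy
    makes the blocks of M densely ordered without a last one: no interval or final segment is
    exhausted by a block. The given structures come as indices of possibly partial programs, and a
    tree must be attached to every pair of indices. Hence membership in a tree refers to bounded
    searches for certificates of computations. *)

Definition triangle (s : nat) : nat := (s * s.+1)./2.

Lemma triangleS s : triangle s.+1 = triangle s + s.+1.
Proof.
by rewrite /triangle -[s.+1 * s.+2](_ : s * s.+1 + s.+1.*2 = _) ?halfD ?doubleK;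
   [rewrite odd_double andbF add0n | lia].
Qed.

Lemma npairE x y : npair x y = triangle (x + y) + y. Proof. by []. Qed.

Lemma leq_triangle s s' : s <= s' -> triangle s <= triangle s'.
Proof. by move/subnK<-; elim: (s' - s) => // k; rewrite addSn triangleS; lia. Qed.

Lemma npair_inj x y x' y' : npair x y = npair x' y' -> x = x' /\ y = y'.
Proof.
rewrite !npairE => E.
have H: x + y = x' + y'.
  case: (ltngtP (x + y) (x' + y')) => // /leq_triangle; rewrite triangleS; lia.
by move: E; rewrite H; lia.
Qed.

(** Walks along the antidiagonals in the order of [npair]: a step leads from (x+1, y) to (x, y+1),
    and from (0, y) to (y+1, 0), where the next antidiagonal starts. *)
Definition unpair (n : nat) : nat * nat :=
  iter n (fun p => if p.1 is x.+1 then (x, p.2.+1) else (p.2.+1, 0)) (0, 0).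

Definition lft z := (unpair z).1.
Definition rgt z := (unpair z).2.

Lemma lrK z : npair (lft z) (rgt z) = z.
Proof.
rewrite /lft /rgt; elim: z => [|z]; first by rewrite npairE.
rewrite /= -/(unpair z); case: (unpair z) => [[|x] y] /=; rewrite !npairE.
  by rewrite !addn0 add0n triangleS => <-; rewrite addnS.
by move=> <-; rewrite addSnnS addnS.
Qed.

Lemma lftK x y : lft (npair x y) = x.
Proof. by have [] := npair_inj (lrK (npair x y)). Qed.
Lemma rgtK x y : rgt (npair x y) = y.
Proof. by have [] := npair_inj (lrK (npair x y)). Qed.
Definition lrE := (lftK, rgtK).
Arguments npair : simpl never.
Arguments lft : simpl never.
Arguments rgt : simpl never.

Lemma leq_npair x y x' y' : x <= x' -> y <= y' -> npair x y <= npair x' y'.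
Proof. by move=> Hx Hy; rewrite !npairE leq_add // leq_triangle // leq_add. Qed.

Lemma triangle_ge s : s <= triangle s.
Proof. by elim: s => // s; rewrite triangleS; lia. Qed.

Lemma leq_npairl x y : x <= npair x y.
Proof. by rewrite npairE; have := triangle_ge (x + y); lia. Qed.
Lemma leq_npairr x y : y <= npair x y.
Proof. by rewrite npairE; lia. Qed.
Lemma leq_rgt z : rgt z <= z. Proof. by rewrite -{2}(lrK z) leq_npairr. Qed.
Lemma rgt0 : rgt 0 = 0. Proof. by []. Qed.
Global Opaque npair unpair lft rgt.

Definition hdc z := lft z.-1.
Definition tlc z := rgt z.-1.

Fixpoint sdecn (n z : nat) : seq nat :=
  if n is n'.+1 then if z is 0 then [::] else hdc z :: sdecn n' (tlc z)
  else [::].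
Definition sdec z := sdecn z z.

Lemma seqcodeKn n s : seqcode s <= n -> sdecn n (seqcode s) = s.
Proof.
elim: s n => [|x s IH] [|n] //=; rewrite ltnS => H.
rewrite /hdc /tlc /= !lrE IH //.
exact: leq_trans (leq_npairr _ _) H.
Qed.

Lemma seqcodeK : cancel seqcode sdec.
Proof. by move=> s; apply: seqcodeKn. Qed.

Lemma sdecnK n z : z <= n -> seqcode (sdecn n z) = z.
Proof.
elim: n z => [|n IH] [|z] //= H.
by rewrite IH /hdc /tlc /= ?lrK // (leq_trans (leq_rgt _)).
Qed.

Lemma sdecK : cancel sdec seqcode.
Proof. by move=> z; apply: sdecnK. Qed.

Lemma sdec0 : sdec 0 = [::]. Proof. by []. Qed.

Lemma sdec_inj : injective sdec. Proof. exact: can_inj sdecK. Qed.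

Lemma iter_tlc i z : iter i tlc z = seqcode (drop i (sdec z)).
Proof.
elim: i => [|i IH]; first by rewrite drop0 sdecK.
rewrite iterS IH -add1n -drop_drop drop1.
by case: (drop i _) => //= x s; rewrite /tlc /= rgtK.
Qed.

Lemma nth_sdec i z : nth 0 (sdec z) i = hdc (iter i tlc z).
Proof.
rewrite iter_tlc -[i in LHS]addn0 -nth_drop.
by case: (drop i _) => //= x s; rewrite /hdc /= lftK.
Qed.

(** Counts the nonempty tails among the first [z]; these are all of them, since a list is no longer
    than its code. This form is primitive recursive. *)
Lemma size_sdec z :
  size (sdec z) = nat_rect (fun _ => nat) 0 (fun i r => r + (iter i tlc z != 0)) z.
Proof.
have E n : nat_rect (fun _ => nat) 0 (fun i r => r + (iter i tlc z != 0)) n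
           = minn n (size (sdec z)).
  elim: n => [|n] /=; first by rewrite min0n.
  move=> ->; rewrite iter_tlc.
  have -> : (seqcode (drop n (sdec z)) != 0) = (n < size (sdec z)).
    rewrite -subn_gt0 -size_drop; by case: (drop n _).
  by case: ltnP; lia.
rewrite E; apply/esym/minn_idPr.
rewrite -{2}(sdecK z); elim: (sdec z) => //= x s IH.
by rewrite ltnS (leq_trans IH) // leq_npairr.
Qed.

Lemma mem_sdec_leq v z : v \in sdec z -> v <= z.
Proof.
rewrite -{2}(sdecK z); elim: (sdec z) => //= x s IH.
rewrite inE => /predU1P[->|/IH H]; apply: leqW.
  exact: leq_npairl.
exact: leq_trans H (leq_npairr _ _).
Qed.

(** * Programs, substitution and closure properties *)

Lemma eval_det D c n m m' : eval D c n m -> eval D c n m' -> m = m'.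
Proof.
elim: c n m m' => /=.
- by move=> n m m' -> ->.
- by move=> n m m' -> ->.
- by move=> n m m' [b ->] [b' /npair_inj[]].
- by move=> n m m' [b ->] [b' /npair_inj[]].
- by move=> n m m' -> ->.
- move=> f IHf g IHg n m m' [a [b [Ha Hb ->]]] [a' [b' [Ha' Hb' ->]]].
  by rewrite (IHf _ _ _ Ha Ha') (IHg _ _ _ Hb Hb').
- move=> f IHf g IHg n m m' [k [Hk Hm]] [k' [Hk' Hm']].
  move: Hm'; rewrite -(IHg _ _ _ Hk Hk'); exact: IHf.
- move=> f IHf g IHg n m m' [a [k [-> H]]] [a' [k' [/npair_inj[<- <-] H']]].
  elim: k m m' H H' => [|k IH] m m' /=; first exact: IHf.
  move=> [r [Hr Hm]] [r' [Hr' Hm']].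
  move: Hm'; rewrite -(IH _ _ Hr Hr'); exact: IHg.
- move=> f IHf n m m' [H0 H] [H0' H'].
  case: (ltngtP m m') => //.
    by move/H' => [r Hr]; have := IHf _ _ _ H0 Hr.
  by move/H => [r Hr]; have := IHf _ _ _ H0' Hr.
Qed.

(* [Oracle] marks the hole of the program context [k]. *)
Fixpoint plug (k c : code) : code :=
  match k with
  | Oracle => c
  | Pair f g => Pair (plug f c) (plug g c)
  | Comp f g => Comp (plug f c) (plug g c)
  | Prec f g => Prec (plug f c) (plug g c)
  | Mu f => Mu (plug f c)
  | _ => k
  end.

Lemma plug_plug k c c' : plug (plug k c) c' = plug k (plug c c').
Proof. by elim: k => //= [f -> g ->|f -> g ->|f -> g ->|f ->]. Qed.

Lemma eval_idc D x : eval D (Pair Left Right) x x.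
Proof.
exists (lft x), (rgt x); split; rewrite ?lrK //=; last by exists (lft x); rewrite lrK.
by exists (rgt x); rewrite lrK.
Qed.

Lemma prec_graph_ext F F' G G' a k m :
  (forall x y, F x y <-> F' x y) -> (forall x y, G x y <-> G' x y) ->
  prec_graph F G a k m <-> prec_graph F' G' a k m.
Proof.
move=> HF HG; elim: k m => //= k IH m.
by split=> -[r [H1 H2]]; exists r; rewrite ?IH ?HG // -?IH -?HG.
Qed.

(** The empty oracle always answers 0, and so does [Zero]. A computation without oracle can thus be
    run under any oracle. *)
Lemma eval_plug0 D k n m : eval D (plug k Zero) n m <-> eval xpred0 k n m.
Proof.
elim: k n m => //=.
- move=> f IHf g IHg n m.
  by split=> -[a [b [H1 H2 ->]]]; exists a, b; split; rewrite ?IHf ?IHg // -?IHf -?IHg.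
- move=> f IHf g IHg n m.
  by split=> -[a [H1 H2]]; exists a; split; rewrite ?IHf ?IHg // -?IHf -?IHg.
- move=> f IHf g IHg n m.
  have E a k := prec_graph_ext a k m IHf IHg.
  by split=> -[a [k [-> H]]]; exists a, k; split=> //; apply/E.
- move=> f IHf n m; rewrite IHf.
  by split=> -[H H']; split=> // i /H' [r Hr]; exists r; apply/IHf.
Qed.

(* The same closure lemmas serve for plain computability, when [Phi] ignores [m],
   and for reductions: the number of [plug k c] is computable from that of [c].
   The precondition [A m] only matters for unbounded search. *)
Definition fcomp (A : (nat -> nat) -> Prop) (Phi : (nat -> nat) -> nat -> nat) : Prop :=
  exists k, forall D c m, A m -> (forall x, eval D c x (m x)) ->
    forall x, eval D (plug k c) x (Phi m x).

Section Closure.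
Variable A : (nat -> nat) -> Prop.
Local Notation fcomp := (fcomp A).
Implicit Types f g h : (nat -> nat) -> nat -> nat.

Lemma fc_ext f g : (forall m x, A m -> f m x = g m x) -> fcomp f -> fcomp g.
Proof. by move=> E [k H]; exists k => D c m Am Hc x; rewrite -E //; apply: H. Qed.

Lemma fc_id : fcomp (fun m x => x).
Proof. by exists (Pair Left Right) => D c m _ _ x; apply: eval_idc. Qed.

Lemma fc_comp f g : fcomp g -> fcomp f -> fcomp (fun m x => g m (f m x)).
Proof.
move=> [kg Hg] [kf Hf]; exists (Comp kg kf) => D c m Am Hc x.
by exists (f m x); split; [apply: Hf | apply: Hg].
Qed.

Lemma fc_orc f : fcomp f -> fcomp (fun m x => m (f m x)).
Proof. by apply: (@fc_comp _ (fun m => m)); exists Oracle => D c m _ H x; apply: H. Qed.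

Lemma fc_S f : fcomp f -> fcomp (fun m x => (f m x).+1).
Proof. by apply: (@fc_comp _ (fun m x => x.+1)); exists Succ. Qed.

Lemma fc_const n : fcomp (fun m x => n).
Proof. by elim: n => [|n]; [exists Zero | apply: fc_S]. Qed.

Lemma fc_pair f g : fcomp f -> fcomp g -> fcomp (fun m x => npair (f m x) (g m x)).
Proof.
move=> [kf Hf] [kg Hg]; exists (Pair kf kg) => D c m Am Hc x.
by exists (f m x), (g m x); split; [apply: Hf | apply: Hg | ].
Qed.

Lemma fc_lft f : fcomp f -> fcomp (fun m x => lft (f m x)).
Proof.
apply: (@fc_comp _ (fun m x => lft x)); exists Left => D c m _ _ x.
by exists (rgt x); rewrite lrK.
Qed.

Lemma fc_rgt f : fcomp f -> fcomp (fun m x => rgt (f m x)).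
Proof.
apply: (@fc_comp _ (fun m x => rgt x)); exists Right => D c m _ _ x.
by exists (lft x); rewrite lrK.
Qed.

Lemma fc_rec f (g : (nat -> nat) -> nat -> nat -> nat -> nat) n :
  fcomp f -> fcomp (fun m z => g m (lft z) (lft (rgt z)) (rgt (rgt z))) -> fcomp n ->
  fcomp (fun m x => nat_rect (fun _ => nat) (f m x) (g m x) (n m x)).
Proof.
move=> [kf Hf] [kg Hg] [kn Hn].
exists (Comp (Prec kf kg) (Pair (Pair Left Right) kn)) => D c m Am Hc x.
exists (npair x (n m x)); split.
  by exists x, (n m x); split; [apply: eval_idc | apply: Hn |].
exists x, (n m x); split=> //; elim: (n m x) => [|k IH]; first exact: Hf.
eexists; split; first exact: IH.
have := Hg D c m Am Hc (npair x (npair k (nat_rect (fun=> nat) (f m x) (g m x) k))).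
by rewrite !lrE.
Qed.

(** [Mu] searches for the value 0, so the program has to decide the negation of [b]. *)
Lemma fc_mu (b : (nat -> nat) -> nat -> nat -> bool) (mu : (nat -> nat) -> nat -> nat) :
  fcomp (fun m z => ~~ b m (lft z) (rgt z)) ->
  (forall m x, A m -> b m x (mu m x) /\ forall i, b m x i -> mu m x <= i) ->
  fcomp mu.
Proof.
move=> [k Hk] Hmu; exists (Mu k) => D c m Am Hc x.
have [Hb Hmin] := Hmu m x Am; split.
  by have := Hk D c m Am Hc (npair x (mu m x)); rewrite !lrE Hb.
move=> i lti; exists 0.
have := Hk D c m Am Hc (npair x i); rewrite !lrE.
by case E: (b m x i) => //; have := Hmin _ E; rewrite leqNgt lti.
Qed.

Lemma fc_pred f : fcomp f -> fcomp (fun m x => (f m x).-1).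
Proof.
move=> Hf; apply: (@fc_ext (fun m x => nat_rect (fun _ => nat) 0 (fun i r => i) (f m x))).
  by move=> m x _; case: (f m x).
apply: (@fc_rec _ (fun m x i r => i)) => //; first exact: fc_const.
exact/fc_lft/fc_rgt/fc_id.
Qed.

Lemma fc_sub f g : fcomp f -> fcomp g -> fcomp (fun m x => f m x - g m x).
Proof.
move=> Hf Hg; apply: (@fc_ext (fun m x => nat_rect (fun _ => nat) (f m x) (fun i r => r.-1) (g m x))).
  by move=> m x _; elim: (g m x) => [|k]; rewrite ?subn0 // subnS => <-.
apply: (@fc_rec _ (fun m x i r => r.-1)) => //.
exact/fc_pred/fc_rgt/fc_rgt/fc_id.
Qed.

Lemma fc_add f g : fcomp f -> fcomp g -> fcomp (fun m x => f m x + g m x).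
Proof.
move=> Hf Hg; apply: (@fc_ext (fun m x => nat_rect (fun _ => nat) (f m x) (fun i r => r.+1) (g m x))).
  by move=> m x _; elim: (g m x) => [|k]; rewrite ?addn0 // addnS => <-.
apply: (@fc_rec _ (fun m x i r => r.+1)) => //.
exact/fc_S/fc_rgt/fc_rgt/fc_id.
Qed.

Lemma fc_if (b : (nat -> nat) -> nat -> bool) f g :
  fcomp (fun m x => b m x) -> fcomp f -> fcomp g ->
  fcomp (fun m x => if b m x then f m x else g m x).
Proof.
move=> Hb Hf Hg.
apply: (@fc_ext (fun m x => nat_rect (fun _ => nat) (g m x) (fun i r => f m x) (b m x))).
  by move=> m x _; case: (b m x).
apply: (@fc_rec _ (fun m x i r => f m x)) => //.
exact/fc_comp/fc_lft/fc_id.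
Qed.

Lemma fc_eq0 f : fcomp f -> fcomp (fun m x => f m x == 0).
Proof.
move=> Hf; apply: (@fc_ext (fun m x => 1 - f m x)).
  by move=> m x _; case: (f m x).
exact: fc_sub (fc_const 1) Hf.
Qed.

Lemma fc_neg (b : (nat -> nat) -> nat -> bool) :
  fcomp (fun m x => b m x) -> fcomp (fun m x => ~~ b m x).
Proof.
move=> Hb; apply: (@fc_ext (fun m x => (b m x : nat) == 0)); last exact: fc_eq0.
by move=> m x _; case: (b m x).
Qed.

Lemma fc_and (b b' : (nat -> nat) -> nat -> bool) :
  fcomp (fun m x => b m x) -> fcomp (fun m x => b' m x) ->
  fcomp (fun m x => b m x && b' m x).
Proof.
move=> Hb Hb'; apply: (@fc_ext (fun m x => if b m x then (b' m x : nat) else 0)).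
  by move=> m x _; case: (b m x).
by apply: fc_if => //; apply: fc_const.
Qed.

Lemma fc_or (b b' : (nat -> nat) -> nat -> bool) :
  fcomp (fun m x => b m x) -> fcomp (fun m x => b' m x) ->
  fcomp (fun m x => b m x || b' m x).
Proof.
move=> Hb Hb'; apply: (@fc_ext (fun m x => if b m x then 1 else (b' m x : nat))).
  by move=> m x _; case: (b m x).
by apply: fc_if => //; apply: fc_const.
Qed.

Lemma fc_imp (b b' : (nat -> nat) -> nat -> bool) :
  fcomp (fun m x => b m x) -> fcomp (fun m x => b' m x) ->
  fcomp (fun m x => b m x ==> b' m x).
Proof.
move=> Hb Hb'; apply: (@fc_ext (fun m x => ~~ b m x || b' m x)).
  by move=> m x _; case: (b m x).
by apply: fc_or => //; apply: fc_neg.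
Qed.

Lemma fc_bif (b b1 b2 : (nat -> nat) -> nat -> bool) :
  fcomp (fun m x => b m x) -> fcomp (fun m x => b1 m x) -> fcomp (fun m x => b2 m x) ->
  fcomp (fun m x => if b m x then b1 m x else b2 m x).
Proof.
move=> Hb H1 H2; apply: (@fc_ext (fun m x => if b m x then (b1 m x : nat) else b2 m x)).
  by move=> m x _; case: (b m x).
exact: fc_if.
Qed.

Lemma fc_leq f g : fcomp f -> fcomp g -> fcomp (fun m x => f m x <= g m x).
Proof. by move=> Hf Hg; apply: fc_eq0; apply: fc_sub. Qed.

Lemma fc_eq f g : fcomp f -> fcomp g -> fcomp (fun m x => f m x == g m x).
Proof.
move=> Hf Hg; apply: (@fc_ext (fun m x => (f m x <= g m x) && (g m x <= f m x))).
  by move=> m x _; rewrite eqn_leq.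
by apply: fc_and; apply: fc_leq.
Qed.

Lemma fc_all (b : (nat -> nat) -> nat -> nat -> bool) n :
  fcomp (fun m z => b m (lft z) (rgt z)) -> fcomp n ->
  fcomp (fun m x => all (b m x) (iota 0 (n m x))).
Proof.
move=> Hb Hn.
apply: (@fc_ext (fun m x => nat_rect (fun _ => nat) 1 (fun i r => (r != 0) && b m x i) (n m x))).
  move=> m x _; elim: (n m x) => [|k] //; move=> IH; rewrite -[in RHS]addn1 iotaD all_cat /= add0n andbT IH.
  by case: (all _ _).
apply: (@fc_rec _ (fun m x i r => (r != 0) && b m x i)) => //; first exact: fc_const.
apply: fc_and; first exact/fc_neg/fc_eq0/fc_rgt/fc_rgt/fc_id.
apply: (@fc_ext (fun m z => b m (lft (npair (lft z) (lft (rgt z)))) (rgt (npair (lft z) (lft (rgt z)))))).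
  by move=> m x _; rewrite !lrE.
apply: (@fc_comp (fun m z => npair (lft z) (lft (rgt z))) (fun m z => b m (lft z) (rgt z))) => //.
by apply: fc_pair; [|apply: fc_lft]; [exact/fc_lft/fc_id|exact/fc_rgt/fc_id].
Qed.

Lemma fc_has (b : (nat -> nat) -> nat -> nat -> bool) n :
  fcomp (fun m z => b m (lft z) (rgt z)) -> fcomp n ->
  fcomp (fun m x => has (b m x) (iota 0 (n m x))).
Proof.
move=> Hb Hn; apply: (@fc_ext (fun m x => ~~ all (fun i => ~~ b m x i) (iota 0 (n m x)))).
  by move=> m x _; rewrite -has_predC; congr (nat_of_bool _); apply: eq_has => i /=; rewrite negbK.
by apply/fc_neg/fc_all => //; apply: fc_neg.
Qed.

Lemma fc_iter (h : nat -> nat) f n :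
  fcomp (fun m x => h x) -> fcomp f -> fcomp n -> fcomp (fun m x => iter (n m x) h (f m x)).
Proof.
move=> Hh Hf Hn.
apply: (@fc_ext (fun m x => nat_rect (fun _ => nat) (f m x) (fun i r => h r) (n m x))).
  by move=> m x _; elim: (n m x) => //= k ->.
apply: (@fc_rec _ (fun m x i r => h r)) => //.
apply: (@fc_comp _ (fun m => h)) => //; exact/fc_rgt/fc_rgt/fc_id.
Qed.

Lemma fc_comp2 (op : nat -> nat -> nat) f g :
  fcomp (fun m z => op (lft z) (rgt z)) -> fcomp f -> fcomp g ->
  fcomp (fun m x => op (f m x) (g m x)).
Proof.
move=> H Hf Hg.
apply: (@fc_ext (fun m x => op (lft (npair (f m x) (g m x))) (rgt (npair (f m x) (g m x))))).
  by move=> m x _; rewrite !lrE.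
by apply: (@fc_comp _ (fun m z => op (lft z) (rgt z))) => //; apply: fc_pair.
Qed.

Lemma fc_comp3 (op : nat -> nat -> nat -> nat) f g h :
  fcomp (fun m z => op (lft z) (lft (rgt z)) (rgt (rgt z))) -> fcomp f -> fcomp g -> fcomp h ->
  fcomp (fun m x => op (f m x) (g m x) (h m x)).
Proof.
move=> H Hf Hg Hh.
apply: (@fc_ext (fun m x => op (f m x) (lft (npair (g m x) (h m x))) (rgt (npair (g m x) (h m x))))).
  by move=> m x _; rewrite !lrE.
by apply: (@fc_comp2 (fun a b => op a (lft b) (rgt b))) => //; apply: fc_pair.
Qed.

Lemma fc_comp4 (op : nat -> nat -> nat -> nat -> nat) f g h k :
  fcomp (fun m z => op (lft z) (lft (rgt z)) (lft (rgt (rgt z))) (rgt (rgt (rgt z)))) ->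
  fcomp f -> fcomp g -> fcomp h -> fcomp k ->
  fcomp (fun m x => op (f m x) (g m x) (h m x) (k m x)).
Proof.
move=> H Hf Hg Hh Hk.
apply: (@fc_ext (fun m x => op (f m x) (g m x) (lft (npair (h m x) (k m x))) (rgt (npair (h m x) (k m x))))).
  by move=> m x _; rewrite !lrE.
by apply: (@fc_comp3 (fun a b c => op a b (lft c) (rgt c))) => //; apply: fc_pair.
Qed.

Lemma fc_drop f n : fcomp f -> fcomp n ->
  fcomp (fun m x => iter (n m x) tlc (f m x)).
Proof. by apply: fc_iter; apply/fc_rgt/fc_pred/fc_id. Qed.

Lemma fc_nth f n : fcomp f -> fcomp n -> fcomp (fun m x => nth 0 (sdec (f m x)) (n m x)).
Proof.
move=> Hf Hn; apply: (@fc_ext (fun m x => hdc (iter (n m x) tlc (f m x)))).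
  by move=> m x _; rewrite nth_sdec.
exact/fc_lft/fc_pred/fc_drop.
Qed.

Lemma fc_size f : fcomp f -> fcomp (fun m x => size (sdec (f m x))).
Proof.
move=> Hf; apply: (@fc_comp f (fun m x => size (sdec x))) => //.
apply: (@fc_ext (fun m z => nat_rect (fun _ => nat) 0 (fun i r => r + (iter i tlc z != 0)) z)).
  by move=> m x _; rewrite size_sdec.
apply: (@fc_rec _ (fun m z i r => r + (iter i tlc z != 0))); [exact: fc_const| |exact: fc_id].
apply: fc_add; first exact/fc_rgt/fc_rgt/fc_id.
apply/fc_neg/fc_eq0/fc_drop; [exact/fc_lft/fc_id|exact/fc_lft/fc_rgt/fc_id].
Qed.

Lemma fc_mkseq (g : (nat -> nat) -> nat -> nat -> nat) n :
  fcomp (fun m z => g m (lft z) (rgt z)) -> fcomp n ->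
  fcomp (fun m x => seqcode (mkseq (g m x) (n m x))).
Proof.
move=> Hg Hn.
(* The code of a list has the head outermost, so the recursion starts from the last entry. *)
apply: (@fc_ext (fun m x => nat_rect (fun _ => nat) 0
   (fun i r => (npair (g m x (n m x - i.+1)) r).+1) (n m x))).
  move=> m x _.
  have E k : k <= n m x -> nat_rect (fun _ => nat) 0
     (fun i r => (npair (g m x (n m x - i.+1)) r).+1) k
     = seqcode (map (g m x) (iota (n m x - k) k)).
    elim: k => //= k IH lek; rewrite IH 1?ltnW //.
    by congr (npair _ (seqcode (map _ (iota _ _)))).+1; lia.
  by rewrite E // subnn.
apply: (@fc_rec _ (fun m x i r => (npair (g m x (n m x - i.+1)) r).+1)) => //; first exact: fc_const.
have H1 : fcomp (fun m z => lft z) by exact/fc_lft/fc_id.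
have H2 : fcomp (fun m z => lft (rgt z)) by exact/fc_lft/fc_rgt/fc_id.
have H3 : fcomp (fun m z => rgt (rgt z)) by exact/fc_rgt/fc_rgt/fc_id.
have H4 : fcomp (fun m z => npair (lft z) (n m (lft z) - (lft (rgt z)).+1)).
  by apply: fc_pair => //; apply: fc_sub; [apply: fc_comp|apply: fc_S].
apply/fc_S/fc_pair => //.
apply: fc_ext (fc_comp Hg H4) => m x _; by rewrite !lrE.
Qed.

Lemma fc_mem f g : fcomp f -> fcomp g -> fcomp (fun m x => f m x \in sdec (g m x)).
Proof.
move=> Hf Hg.
apply: (@fc_ext (fun m x => has (fun i => nth 0 (sdec (g m x)) i == f m x) (iota 0 (size (sdec (g m x)))))).
  move=> m x _; congr (nat_of_bool _).
  apply/hasP/(nthP 0) => -[i]; rewrite ?mem_iota ?add0n /= => Hi.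
    by move/eqP; exists i.
  by move/eqP; exists i; rewrite ?mem_iota.
apply: (@fc_has (fun m x i => nth 0 (sdec (g m x)) i == f m x)); last exact: fc_size.
apply: fc_eq; last by apply: fc_comp => //; exact/fc_lft/fc_id.
apply: fc_nth; last exact/fc_rgt/fc_id.
by apply: fc_comp => //; exact/fc_lft/fc_id.
Qed.

End Closure.

Create HintDb fc.
Ltac fcs1 :=
  cbv beta;
  lazymatch goal with
  | H : fcomp ?A ?f |- fcomp ?A ?f => exact H
  | |- fcomp _ (fun m x => x) => exact: fc_id
  | |- fcomp _ (fun m x => npair (@?f m x) (@?g m x)) => apply: (@fc_pair _ f g)
  | |- fcomp _ (fun m x => lft (@?f m x)) => apply: (@fc_lft _ f)
  | |- fcomp _ (fun m x => rgt (@?f m x)) => apply: (@fc_rgt _ f)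
  | |- fcomp _ (fun m x => S (@?f m x)) => apply: (@fc_S _ f)
  | |- fcomp _ (fun m x => predn (@?f m x)) => apply: (@fc_pred _ f)
  | |- fcomp _ (fun m x => (@?f m x) + (@?g m x)) => apply: (@fc_add _ f g)
  | |- fcomp _ (fun m x => (@?f m x) - (@?g m x)) => apply: (@fc_sub _ f g)
  | |- fcomp _ (fun m x => nth 0 (sdec (@?f m x)) (@?g m x)) => apply: (@fc_nth _ f g)
  | |- fcomp _ (fun m x => size (sdec (@?f m x))) => apply: (@fc_size _ f)
  | |- fcomp _ (fun m x => seqcode (mkseq (@?f m x) (@?g m x))) => apply: (@fc_mkseq _ f g)
  | |- fcomp _ (fun m x => nat_of_bool (@?f m x == 0)) => apply: (@fc_eq0 _ f)
  | |- fcomp _ (fun m x => nat_of_bool (@?f m x == @?g m x :> nat)) => apply: (@fc_eq _ f g)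
  | |- fcomp _ (fun m x => nat_of_bool (@?f m x <= @?g m x)) => apply: (@fc_leq _ f g)
  | |- fcomp _ (fun m x => nat_of_bool (~~ @?f m x)) => apply: (@fc_neg _ f)
  | |- fcomp _ (fun m x => nat_of_bool (@?f m x && @?g m x)) => apply: (@fc_and _ f g)
  | |- fcomp _ (fun m x => nat_of_bool (@?f m x || @?g m x)) => apply: (@fc_or _ f g)
  | |- fcomp _ (fun m x => nat_of_bool (@?f m x ==> @?g m x)) => apply: (@fc_imp _ f g)
  | |- fcomp _ (fun m x => nat_of_bool (@?f m x \in sdec (@?g m x))) => apply: (@fc_mem _ f g)
  | |- fcomp _ (fun m x => nat_of_bool (all (@?f m x) (iota 0 (@?g m x)))) => apply: (@fc_all _ f g)
  | |- fcomp _ (fun m x => nat_of_bool (has (@?f m x) (iota 0 (@?g m x)))) => apply: (@fc_has _ f g)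
  | |- fcomp _ (fun m x => m (@?f m x)) => apply: (@fc_orc _ f)
  | |- _ => first [simple apply fc_const | simple apply fc_bif | simple apply fc_if | solve [auto 2 with fc]]
  end.
Ltac fcs := repeat fcs1.

(** * Computing with Goedel numbers *)

Lemma gnum_inj : injective gnum.
Proof.
elim=> [| | | | |f IHf g IHg|f IHf g IHg|f IHf g IHg|f IHf]
       [| | | | |f' g'|f' g'|f' g'|f'] //= /npair_inj[] // _.
- by move=> /npair_inj[/IHf-> /IHg->].
- by move=> /npair_inj[/IHf-> /IHg->].
- by move=> /npair_inj[/IHf-> /IHg->].
- by move=> /IHf->.
Qed.

(** [phi] yields a program for each input separately; they coincide because [gnum] is injective. An
    input in [P] is required to have a program at all. *)
Lemma phi_code D e F (P : nat -> Prop) : (exists x, P x) ->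
  (forall x, P x -> phi D e x (F x)) ->
  exists c, gnum c = e /\ forall x, P x -> eval D c x (F x).
Proof.
move=> [x0 /[dup] Px0 P0] H; have [c [Ec _]] := H _ P0; exists c; split=> // x /H.
by case=> c' [Ec' He]; rewrite (gnum_inj (etrans Ec (esym Ec'))).
Qed.

Fixpoint constc n := if n is n'.+1 then Comp Succ (constc n') else Zero.

Lemma eval_constc D n x : eval D (constc n) x n.
Proof. by elim: n => //= n IH; exists n. Qed.

Lemma fc_gnum_constc A f : fcomp A f -> fcomp A (fun m x => gnum (constc (f m x))).
Proof.
move=> Hf; apply: (@fc_ext _ (fun m x => nat_rect (fun _ => nat) (gnum Zero)
   (fun i r => npair 6 (npair (gnum Succ) r)) (f m x))).
  by move=> m x _; elim: (f m x) => //= n ->.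
apply: (@fc_rec _ _ (fun m x i r => npair 6 (npair (gnum Succ) r))) => //; fcs.
Qed.

(** Turns a reduction between functions, given by a program context, into a computable map between
    their indices. *)
Lemma gnum_plug k : exists g : nat -> nat, (forall A, fcomp A (fun m x => g x)) /\
  forall c, gnum (plug k c) = g (gnum c).
Proof.
elim: k => [| | | | |f [gf [Hf Ef]] g [gg [Hg Eg]]|f [gf [Hf Ef]] g [gg [Hg Eg]]
            |f [gf [Hf Ef]] g [gg [Hg Eg]]|f [gf [Hf Ef]]].
- by exists (fun=> gnum Zero); split=> // A; apply: fc_const.
- by exists (fun=> gnum Succ); split=> // A; apply: fc_const.
- by exists (fun=> gnum Left); split=> // A; apply: fc_const.
- by exists (fun=> gnum Right); split=> // A; apply: fc_const.
- by exists id; split=> // A; apply: fc_id.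
- exists (fun x => npair 5 (npair (gf x) (gg x))); split; last by move=> c; rewrite /= Ef Eg.
  by move=> A; fcs.
- exists (fun x => npair 6 (npair (gf x) (gg x))); split; last by move=> c; rewrite /= Ef Eg.
  by move=> A; fcs.
- exists (fun x => npair 7 (npair (gf x) (gg x))); split; last by move=> c; rewrite /= Ef Eg.
  by move=> A; fcs.
- exists (fun x => npair 8 (gf x)); split; last by move=> c; rewrite /= Ef.
  by move=> A; fcs.
Qed.

Definition any_input : (nat -> nat) -> Prop := fun=> True.

Lemma fcomp_code (F : nat -> nat) : fcomp any_input (fun m x => F x) ->
  exists c, forall D x, eval D c x (F x).
Proof.
move=> [k H]; exists (plug k Zero) => D x.
by apply: (H D Zero (fun _ => 0)) => //= y.
Qed.

Lemma code_fcomp A (F : nat -> nat) c : (forall x, eval xpred0 c x (F x)) ->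
  fcomp A (fun m x => F x).
Proof.
move=> H; exists (plug c Zero) => D c' m _ _ x.
by rewrite plug_plug; apply/eval_plug0.
Qed.

(** * A universal family of trees *)

(* Certificates of computations without oracle: finite sets of facts
   [{c}(x) = y] which justify each other. *)
Definition fact c x y := npair c (npair x y).

(** The alternatives follow the clauses of [eval], tag 4 answering for the empty oracle. Searching
    below [w] loses nothing: the value in a fact is smaller than the code of any list containing the
    fact. *)
Definition justified (w v : nat) : bool :=
  let c := lft v in let x := lft (rgt v) in let y := rgt (rgt v) in
  let tag := lft c in let a := rgt c in let f := lft a in let g := rgt a in
  (tag == 0) && (y == 0) || (tag == 1) && (y == x.+1) || (tag == 2) && (y == lft x)
  || (tag == 3) && (y == rgt x) || (tag == 4) && (y == 0)
  || (tag == 5) && ((fact f x (lft y) \in sdec w) && (fact g x (rgt y) \in sdec w))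
  || (tag == 6) && has (fun k => (fact g x k \in sdec w) && (fact f k y \in sdec w)) (iota 0 w)
  || (tag == 7) && (if rgt x == 0 then fact f (lft x) y \in sdec w else
       has (fun r => (fact c (npair (lft x) (rgt x).-1) r \in sdec w) &&
                     (fact g (npair (lft x) (npair (rgt x).-1 r)) y \in sdec w)) (iota 0 w))
  || (tag == 8) && ((fact a (npair x y) 0 \in sdec w) &&
       all (fun i => has (fun r => fact a (npair x i) r.+1 \in sdec w) (iota 0 w)) (iota 0 y)).

Definition closed_cert (w : nat) : bool := all (fun i => justified w (nth 0 (sdec w) i)) (iota 0 (size (sdec w))).

Definition cert c x y w := closed_cert w && (fact c x y \in sdec w).

Lemma fc_justified A f g : fcomp A f -> fcomp A g -> fcomp A (fun m x => justified (f m x) (g m x)).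
Proof. apply: (@fc_comp2 _ (fun w v => justified w v)); rewrite /justified /fact; fcs. Qed.
#[export] Hint Resolve fc_justified : fc.

Lemma fc_cert A f g h k : fcomp A f -> fcomp A g -> fcomp A h -> fcomp A k ->
  fcomp A (fun m x => cert (f m x) (g m x) (h m x) (k m x)).
Proof.
apply: (@fc_comp4 _ (fun f g h k => cert f g h k)); rewrite /cert /closed_cert /fact; fcs.
apply: fc_justified; fcs.
Qed.

Lemma closed_certP w : reflect (forall v, v \in sdec w -> justified w v) (closed_cert w).
Proof.
apply: (iffP allP) => H.
  move=> v /(nthP 0)[i lti <-]; apply: H; by rewrite mem_iota.
move=> i; rewrite mem_iota add0n /= => lti; exact/H/mem_nth.
Qed.

Lemma cert_sound c x y w : closed_cert w -> fact (gnum c) x y \in sdec w -> eval xpred0 c x y.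
Proof.
move=> /closed_certP H; elim: c x y => [| | | | |f IHf g IHg|f IHf g IHg|f IHf g IHg|f IHf] x y.
all: move=> /H; rewrite /justified /= !lrE /= ?orbF.
- by move/eqP.
- by move/eqP.
- by move/eqP->; exists (rgt x); rewrite lrK.
- by move/eqP->; exists (lft x); rewrite lrK.
- by move/eqP.
- by case/andP=> /IHf Hf /IHg Hg; exists (lft y), (rgt y); split; rewrite ?lrK.
- by case/hasP=> k _ /andP[/IHg Hg /IHf Hf]; exists k.
(* A fact about [Prec] rests on a fact about the same program at the preceding recursion argument,
   which calls for an induction of its own. *)
- move=> H'; exists (lft x), (rgt x); split; first by rewrite lrK.
  move: H'; move: (lft x) (rgt x) y => {x} a; elim=> [|k IH] y /=; first exact: IHf.
  case/hasP=> r _ /andP[/H H1 /IHg Hg]; exists r; split=> //; apply: IH.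
  by move: H1; rewrite /justified !lrE /= ?orbF.
- case/andP=> /IHf H0 /allP Hi; split=> // i lti.
  have := Hi i; rewrite mem_iota /= add0n lti => /(_ isT)/hasP[r _ /IHf Hr].
  by exists r.
Qed.

(** [justified] without the search bounds, hence monotone in the set of facts, so that certificates
    can be concatenated. *)
Definition justified_in (s : seq nat) (v : nat) : Prop :=
  let c := lft v in let x := lft (rgt v) in let y := rgt (rgt v) in
  let tag := lft c in let a := rgt c in let f := lft a in let g := rgt a in
  (tag = 0 /\ y = 0) \/ (tag = 1 /\ y = x.+1) \/ (tag = 2 /\ y = lft x)
  \/ (tag = 3 /\ y = rgt x) \/ (tag = 4 /\ y = 0)
  \/ (tag = 5 /\ fact f x (lft y) \in s /\ fact g x (rgt y) \in s)
  \/ (tag = 6 /\ exists k, fact g x k \in s /\ fact f k y \in s)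
  \/ (tag = 7 /\ if rgt x == 0 then (fact f (lft x) y \in s : Prop) else
       exists r, fact c (npair (lft x) (rgt x).-1) r \in s /\
                     fact g (npair (lft x) (npair (rgt x).-1 r)) y \in s)
  \/ (tag = 8 /\ fact a (npair x y) 0 \in s /\
       forall i, i < y -> exists r, fact a (npair x i) r.+1 \in s).

Lemma justified_in_mono s s' v : {subset s <= s'} -> justified_in s v -> justified_in s' v.
Proof.
move=> S; rewrite /justified_in /=.
case=> [|[|[|[|[|[|[|[|]]]]]]]] H.
- by left.
- by right; left.
- by do 2 right; left.
- by do 3 right; left.
- by do 4 right; left.
- by do 5 right; left; case: H => ? [? ?]; auto.
- by do 6 right; left; case: H => ? [k [? ?]]; split=> //; exists k; auto.
- do 7 right; left; case: H => E H; split=> //; move: H; case: eqP => _; first exact: S.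
  by case=> r []; exists r; auto.
- do 8 right; case: H => ? [? H]; split=> //; split; auto=> i /H[r ?]; exists r; auto.
Qed.

Lemma in_lt w c x y : fact c x y \in sdec w -> y < w.
Proof.
rewrite -{2}(sdecK w); elim: (sdec w) => //= v s IH; rewrite inE => /predU1P[<-|/IH H].
  rewrite ltnS /fact (leq_trans _ (leq_npairl _ _)) //.
  by rewrite (leq_trans _ (leq_npairr _ _)) // leq_npairr.
rewrite ltnS (leq_trans (ltnW H)) //; exact: leq_npairr.
Qed.

Lemma justified_inP w v : justified_in (sdec w) v -> justified w v.
Proof.
rewrite /justified_in /justified /=; case=> [[-> ->]|] //.
case=> [[-> ->]|]; first by rewrite !eqxx /= ?orbT.
case=> [[-> ->]|]; first by rewrite !eqxx /= ?orbT.
case=> [[-> ->]|]; first by rewrite !eqxx /= ?orbT.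
case=> [[-> ->]|]; first by rewrite !eqxx /= ?orbT.
case=> [[-> [-> ->]]|]; first by [].
case=> [[-> [k [H1 H2]]]|] /=.
  rewrite !orbF; apply/hasP; exists k; last by rewrite H1.
  by rewrite mem_iota /= add0n (in_lt H1).
case=> [[-> H]|[-> [-> H]]] /=.
  rewrite orbF; case: eqP H => _ // [r [H1 H2]]; apply/hasP; exists r; last by rewrite H1.
  by rewrite mem_iota /= add0n (in_lt H1).
apply/allP => i; rewrite mem_iota add0n /= => /H[r Hr]; apply/hasP; exists r => //.
rewrite mem_iota /= add0n; exact: ltnW (in_lt Hr).
Qed.

Definition closed_facts s := forall v, v \in s -> justified_in s v.

Lemma closed_facts_cat s s' : closed_facts s -> closed_facts s' -> closed_facts (s ++ s').
Proof.
move=> H H' v; rewrite mem_cat => /orP[/H|/H']; apply: justified_in_mono => u Hu;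
by rewrite mem_cat Hu ?orbT.
Qed.

Lemma closed_facts_cons s v : closed_facts s -> justified_in s v -> closed_facts (v :: s).
Proof.
move=> H Hv u; rewrite inE => /predU1P[->|/H H'].
  by apply: justified_in_mono Hv => z Hz; rewrite inE Hz orbT.
by apply: justified_in_mono H' => z Hz; rewrite inE Hz orbT.
Qed.

Lemma cert_complete_seq c x y : eval xpred0 c x y ->
  exists s, closed_facts s /\ fact (gnum c) x y \in s.
Proof.
have nilC : closed_facts [::] by move=> v.
have fin s v : closed_facts s -> justified_in s v -> exists s', closed_facts s' /\ v \in s'.
  by move=> H Hv; exists (v :: s); rewrite mem_head; split=> //; apply: closed_facts_cons.
have inl (s s' : seq nat) v : v \in s -> v \in s ++ s' by rewrite mem_cat => ->.
have inr (s s' : seq nat) v : v \in s' -> v \in s ++ s' by rewrite mem_cat => ->; rewrite orbT.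
elim: c x y => [| | | | |f IHf g IHg|f IHf g IHg|f IHf g IHg|f IHf] x y /=.
- by move=> ->; apply: (fin _ _ nilC); rewrite /justified_in /= !lrE; left.
- by move=> ->; apply: (fin _ _ nilC); rewrite /justified_in /= !lrE; right; left.
- by move=> [b ->]; apply: (fin _ _ nilC); rewrite /justified_in /= !lrE; do 2 right; left.
- by move=> [b ->]; apply: (fin _ _ nilC); rewrite /justified_in /= !lrE; do 3 right; left.
- by move=> ->; apply: (fin _ _ nilC); rewrite /justified_in /= !lrE; do 4 right; left.
- move=> [a [b [/IHf[s [Hs Is]] /IHg[s' [Hs' Is']] ->]]].
  apply: (fin _ _ (closed_facts_cat Hs Hs')); rewrite /justified_in /= !lrE; do 5 right; left.
  by split=> //; split; [apply: inl|apply: inr].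
- move=> [k [/IHg[s [Hs Is]] /IHf[s' [Hs' Is']]]].
  apply: (fin _ _ (closed_facts_cat Hs Hs')); rewrite /justified_in /= !lrE; do 6 right; left.
  by split=> //; exists k; split; [apply: inl|apply: inr].
- move=> [a [k [-> {x}]]]; elim: k y => [|k IH] y /=.
    move=> /IHf[s [Hs Is]]; apply: (fin _ _ Hs); rewrite /justified_in /= !lrE; do 7 right; left.
    by [].
  move=> [r [/IH[s [Hs Is]] /IHg[s' [Hs' Is']]]].
  apply: (fin _ _ (closed_facts_cat Hs Hs')); rewrite /justified_in /= !lrE; do 7 right; left.
  by split=> //=; exists r; split; [apply: inl|apply: inr].
- move=> [/IHf[s [Hs Is]] Hi].
  have [s' [Hs' Is']] : exists s', closed_facts s' /\
      forall i, i < y -> exists r, fact (gnum f) (npair x i) r.+1 \in s'.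
    elim: {1 3}y (leqnn y) => [_|k IH lek]; first by exists [::].
    have [s1 [H1 I1]] := IH (ltnW lek); have [r /IHf [s2 [H2 I2]]] := Hi k lek.
    exists (s1 ++ s2); split; first exact: closed_facts_cat.
    move=> i; rewrite ltnS leq_eqVlt => /predU1P[->|/I1[r' Hr']].
      by exists r; apply: inr.
    by exists r'; apply: inl.
  apply: (fin _ _ (closed_facts_cat Hs Hs')); rewrite /justified_in /= !lrE; do 8 right.
  split=> //; split; first exact: inl.
  by move=> i /Is' [r Hr]; exists r; apply: inr.
Qed.

Lemma certP c x y : eval xpred0 c x y <-> exists w, cert (gnum c) x y w.
Proof.
split=> [/cert_complete_seq[s [Hs Is]]|[w /andP[]]]; last exact: cert_sound.
exists (seqcode s); rewrite /cert seqcodeK Is andbT.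
apply/closed_certP => v; rewrite seqcodeK => Hv; apply: justified_inP; rewrite seqcodeK; exact: Hs.
Qed.

(* The tree of index [npair e p] consists of the lists none of whose prefixes is
   rejected by program [e] with parameter [p]. Bounding the certificates by the
   length of the list makes it decidable even when [e] is not total. *)
Definition ptree (k : nat) (s : seq nat) : bool :=
  all (fun n => all (fun w => ~~ cert (lft k) (npair (rgt k)
     (seqcode (mkseq (nth 0 s) (minn n (size s))))) 1 w) (iota 0 (size s).+1)) (iota 0 (size s).+1).

Definition ispath (k : nat) (f : nat -> nat) : Prop := forall n, ptree k (mkseq f n).

Lemma mkseq_take (s : seq nat) n : mkseq (nth 0 s) (minn n (size s)) = take n s.
Proof.
apply: (@eq_from_nth _ 0); first by rewrite size_mkseq size_take_min.
move=> i; rewrite size_mkseq => lti; rewrite nth_mkseq // nth_take //; lia.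
Qed.

Lemma ptreeE k s : ptree k s = all (fun n => all (fun w => ~~ cert (lft k) (npair (rgt k)
     (seqcode (take n s))) 1 w) (iota 0 (size s).+1)) (iota 0 (size s).+1).
Proof. by rewrite /ptree; apply: eq_all => n; rewrite mkseq_take. Qed.

Lemma ptree_prefix k s s' : ptree k (s ++ s') -> ptree k s.
Proof.
rewrite !ptreeE => /allP H; apply/allP => n; rewrite mem_iota => Hn.
apply/allP => w; rewrite mem_iota => Hw.
have Hn' : n \in iota 0 (size (s ++ s')).+1 by rewrite mem_iota size_cat; lia.
have /allP/(_ w) := H n Hn'; rewrite mem_iota size_cat takel_cat; last by lia.
by apply; lia.
Qed.

Lemma fc_minn A f g : fcomp A f -> fcomp A g -> fcomp A (fun m x => minn (f m x) (g m x)).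
Proof.
move=> Hf Hg; apply: (@fc_ext _ (fun m x => f m x - (f m x - g m x))); last by fcs.
by move=> m x _; lia.
Qed.
#[export] Hint Resolve fc_minn : fc.

Lemma fc_ptree A f g : fcomp A f -> fcomp A g -> fcomp A (fun m x => ptree (f m x) (sdec (g m x))).
Proof.
apply: (@fc_comp2 _ (fun k z => ptree k (sdec z))); rewrite /ptree; fcs; apply: fc_cert; fcs.
apply: fc_minn; fcs.
Qed.
#[export] Hint Resolve fc_ptree : fc.

(** Delayed rejection keeps more nodes but creates no path: a certificate [w] against the prefix of
    length [n] is seen at level [maxn n w]. *)
Lemma ispath_code c p f : (forall x, exists y, eval xpred0 c x y) ->
  ispath (npair (gnum c) p) f <->
  forall n, ~ eval xpred0 c (npair p (seqcode (mkseq f n))) 1.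
Proof.
move=> tot; have tk n m : n <= m -> take n (mkseq f m) = mkseq f n.
  by move=> le; rewrite /mkseq -map_take take_iota (minn_idPl le).
split=> H n.
  move/certP => [w Hw].
  have := H (maxn n w); rewrite ptreeE !lrE => /allP/(_ n).
  rewrite mem_iota size_mkseq tk; last by lia.
  move=> /(_ _)/allP/(_ w); rewrite mem_iota Hw => H'.
  have: false by apply: H'; lia. by [].
rewrite ptreeE !lrE; apply/allP => m; rewrite mem_iota size_mkseq => ltm; rewrite tk; last by lia.
apply/allP => w _; apply/negP => Hw; apply: (H m); apply/certP; by exists w.
Qed.

Lemma ptree_code c p s : (forall n, ~ eval xpred0 c (npair p (seqcode (take n s))) 1) ->
  ptree (npair (gnum c) p) s.
Proof.
move=> H; rewrite ptreeE !lrE; apply/allP => n _; apply/allP => w _.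
by apply/negP => Hw; apply: (H n); apply/certP; exists w.
Qed.

(** Normal form of a Pi^0_1 condition on [f] with parameter [p], the check [m] consulting [f] only
    below [B m]. The second conclusion admits a finite list whether or not it extends to a path,
    once it passes the checks that it is long enough to decide. *)
Lemma sigma_index (Q : nat -> nat -> (nat -> nat) -> bool) (B : nat -> nat) :
  fcomp any_input (fun _ x => B x) ->
  fcomp any_input (fun _ x => Q (lft x) (lft (rgt x)) (nth 0 (sdec (rgt (rgt x))))) ->
  (forall p m f g, (forall i, i < B m -> f i = g i) -> Q p m f = Q p m g) ->
  exists e, (forall p f, ispath (npair e p) f <-> forall m, Q p m f) /\
    forall p s, (forall m, B m <= size s -> Q p m (nth 0 s)) -> ptree (npair e p) s.
Proof.
move=> HB HQ loc.
pose bad x := has (fun m => (B m <= size (sdec (rgt x))) &&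
  ~~ Q (lft x) m (nth 0 (sdec (rgt x)))) (iota 0 (size (sdec (rgt x)))).
have /fcomp_code[c Hc] : fcomp any_input (fun _ x => bad x).
  rewrite /bad; fcs; first by apply: (@fc_comp _ (fun m x => rgt x) (fun m x => B x)) => //; fcs.
  apply: (@fc_ext _ (fun m x => Q (lft (npair (lft (lft x)) (npair (rgt x) (rgt (lft x)))))
     (lft (rgt (npair (lft (lft x)) (npair (rgt x) (rgt (lft x))))))
     (nth 0 (sdec (rgt (rgt (npair (lft (lft x)) (npair (rgt x) (rgt (lft x)))))))))).
    by move=> m x _; rewrite !lrE.
  apply: (@fc_comp _ (fun m x => npair (lft (lft x)) (npair (rgt x) (rgt (lft x)))) _ HQ).
  fcs.
exists (gnum c); split; last first.
  move=> p s Hs; apply: ptree_code => n /(eval_det (Hc _ _)); rewrite /bad !lrE seqcodeK.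
  case: hasP => // -[m _ /andP[leB]]; rewrite (@loc _ _ _ (nth 0 s)) ?Hs //.
    by rewrite (leq_trans leB) // size_take_min geq_minr.
  move=> i lti; rewrite nth_take //.
  by have := leq_trans lti leB; rewrite size_take_min; lia.
move=> p f; rewrite ispath_code; last by move=> x; eexists; apply: Hc.
split=> H m.
  apply/negPn/negP => nQ.
  (* This length puts [m] among the checks that are tried and covers its use. *)
  apply: (H (maxn m.+1 (B m))).
  suff: bad (npair p (seqcode (mkseq f (maxn m.+1 (B m))))) = true.
    by move=> E; have := Hc xpred0 (npair p (seqcode (mkseq f (maxn m.+1 (B m))))); rewrite E.
  rewrite /bad !lrE seqcodeK size_mkseq; apply/hasP; exists m; first by rewrite mem_iota; lia.
  rewrite leq_maxr /= (@loc _ _ _ f) // => i lti.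
  by rewrite nth_mkseq //; lia.
move=> /(eval_det (Hc _ _)); rewrite /bad !lrE seqcodeK size_mkseq.
case: hasP => // -[n _ /andP[leB]].
rewrite (@loc _ _ _ f) ?H // => i lti.
by rewrite nth_mkseq //; lia.
Qed.

(** * Well-orders and Kleene-Brouwer orders *)

Record strict_linear (T : Type) (lt : T -> T -> Prop) : Prop := StrictLinear {
  sl_irr : forall x, ~ lt x x;
  sl_trans : forall x y z, lt x y -> lt y z -> lt x z;
  sl_tot : forall x y, x = y \/ lt x y \/ lt y x }.

Definition wo_on (T : Type) (X : T -> Prop) (lt : T -> T -> Prop) : Prop :=
  forall B : T -> Prop, (exists x, X x /\ B x) ->
    exists x, [/\ X x, B x & forall y, X y -> B y -> x = y \/ lt x y].

Lemma wo_on_sub T (X Y : T -> Prop) lt : (forall x, Y x -> X x) -> wo_on X lt -> wo_on Y lt.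
Proof.
move=> S H B [x [Yx Bx]]; have [|y [Xy [Yy By] Hy]] := H (fun y => Y y /\ B y).
  by exists x; split; [apply: S|].
by exists y; split=> // z Yz Bz; apply: Hy => //; apply: S.
Qed.

(* [F l = None] means that [X] is exhausted before [l] is reached. *)
Definition comparison (T U : Type) (L : T -> Prop) (ltL : T -> T -> Prop)
    (X : U -> Prop) (ltX : U -> U -> Prop) (F : T -> option U) : Prop :=
  [/\ forall l y, L l -> F l = Some y -> X y,
      forall l l' y', L l -> L l' -> ltL l l' -> F l' = Some y' ->
        exists y, F l = Some y /\ ltX y y' &
      forall l z, L l -> X z -> (exists y, F l = Some y /\ (y = z \/ ltX y z)) \/
        exists l', [/\ L l', ltL l' l & F l' = Some z]].

Section Compare.
Variables (T U : Type) (L : T -> Prop) (ltL : T -> T -> Prop).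
Variables (X : U -> Prop) (ltX : U -> U -> Prop).
Hypothesis (linL : strict_linear ltL).

Lemma wo_on_compare : wo_on L ltL -> wo_on X ltX -> exists F, comparison L ltL X ltX F.
Proof.
move=> woL woX.
pose R l' l := [/\ L l', L l & ltL l' l].
have wfR : well_founded R.
  suff H l : L l -> Acc R l by move=> l; constructor => l' [/H].
  move=> Ll; apply: contrapT => nA.
  have [|m [Lm nAm Hm]] := woL (fun l => ~ Acc R l); first by exists l.
  apply: nAm; constructor => l' [Ll' _ lt]; apply: contrapT => nA'.
  case: (Hm _ Ll' nA') => [E|lt'].
    by move: lt; rewrite E; apply: sl_irr.
  exact: sl_irr linL _ (sl_trans linL lt lt').
pose isleast (P : U -> Prop) z := P z /\ forall y, P y -> z = y \/ ltX z y.
pose least P := if pselect (exists z, isleast P z) is left e then Some (projT1 (cid e)) else None.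
have leastS P z : least P = Some z -> isleast P z.
  by rewrite /least; case: pselect => // e [<-]; exact: projT2 (cid e).
have leastN P z : least P = None -> (forall u, P u -> X u) -> ~ P z.
  rewrite /least; case: pselect => // ne _ PX Pz; apply: ne.
  have [|u [Xu Pu Hu]] := woX P; first by exists z; split=> //; apply: PX.
  by exists u; split=> // y Py; apply: Hu => //; apply: PX.
(* Transfinite recursion: take the least element of [X] that is not a value below [l]. *)
pose step l (rec : forall l', R l' l -> option U) :=
  least (fun z => X z /\ forall l' h, rec l' h <> Some z).
pose F := Fix wfR (fun _ => option U) step.
pose P l z := X z /\ forall l', R l' l -> F l' <> Some z.
have FE l : F l = least (P l).
  rewrite /F Fix_eq // => x f g E; congr (step x _).
  by apply: functional_extensionality_dep => y; apply: functional_extensionality_dep => p.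
have PX l u : P l u -> X u by case.
exists F; split.
- by move=> l y _; rewrite FE => /leastS[[]].
- move=> l l' y' Ll Ll' lt /[dup] E'; rewrite FE => /leastS[[Xy' Hy'] _].
  have Ply : P l y'.
    split=> // l'' [Ll'' _ lt'']; apply: Hy'; split=> //; exact: (sl_trans linL) lt'' lt.
  case E: (F l) => [y|].
    exists y; split=> //; have [_ /(_ _ Ply) [Ey|//]] : isleast (P l) y.
      by apply: leastS; rewrite -FE.
    by have := Hy' l; rewrite E Ey; case.
  by have := @leastN (P l) y'; rewrite -FE => /(_ E (@PX l)).
- move=> l z Ll Xz.
  case: (EM (P l z)) => [Pz|nP].
    left; case E: (F l) => [y|]; last by have := @leastN (P l) z; rewrite -FE => /(_ E (@PX l)).
    by exists y; split=> //; move: E; rewrite FE => /leastS[_]; apply.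
  right; apply: contrapT => nE; apply: nP; split=> // l' [Ll' _ lt] E'; apply: nE.
  by exists l'.
Qed.

Variable F : T -> option U.
Hypothesis cF : comparison L ltL X ltX F.

(** If [F l] is undefined, every element of [X] has a preimage below [l], and minimizing over
    preimages gives least elements. *)
Lemma comparison_exhaust l : wo_on L ltL -> L l -> F l = None -> wo_on X ltX.
Proof.
case: cF => c1 c2 c3 woL Ll El.
have inv z : X z -> exists l', L l' /\ F l' = Some z.
  by move=> Xz; have [[y []]|[l' [H1 _ H2]]] := c3 l z Ll Xz; [rewrite El|exists l'].
move=> B [x [Xx Bx]].
have [|l0 [Ll0 [z0 [Bz0 E0]] H0]] := woL (fun l => exists z, B z /\ F l = Some z).
  by have [l' [Ll' E']] := inv _ Xx; exists l'; split=> //; exists x.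
exists z0; split=> //; first exact: c1 E0.
move=> y Xy By; have [l' [Ll' E']] := inv _ Xy.
have [|E|lt] := H0 l' Ll'; first by exists y.
  by left; move: E'; rewrite -E E0 => -[].
have [y0 [Ey0 lty]] := c2 _ _ _ Ll0 Ll' lt E'.
by right; move: Ey0; rewrite E0 => -[->].
Qed.

End Compare.

(** * The Kleene-Brouwer order *)

Fixpoint kb (u v : seq nat) : bool :=
  match u, v with
  | [::], _ => false
  | _ :: _, [::] => true
  | x :: u', y :: v' => (x < y) || (x == y) && kb u' v'
  end.

Lemma kb_irr u : kb u u = false.
Proof. by elim: u => //= x u ->; rewrite ltnn andbF. Qed.

Lemma kb_trans u v w : kb u v -> kb v w -> kb u w.
Proof.
elim: u v w => [|x u IH] [|y v] [|z w] //=.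
case/orP=> [lxy|/andP[/eqP<- Huv]]; case/orP=> [lyz|/andP[/eqP<- Hvw]].
- by rewrite (ltn_trans lxy lyz).
- by rewrite lxy.
- by rewrite lyz.
- by rewrite eqxx (IH _ _ Huv Hvw) orbT.
Qed.

Lemma kb_tot u v : u = v \/ kb u v \/ kb v u.
Proof.
elim: u v => [|x u IH] [|y v] /=; auto.
case: (ltngtP x y) => //= [||<-]; auto.
by case: (IH v) => [->|]; auto.
Qed.

Lemma kb_cat s u v : kb (s ++ u) (s ++ v) = kb u v.
Proof. by elim: s => //= x s ->; rewrite ltnn eqxx. Qed.

Lemma kb_cons s x u : kb (s ++ x :: u) s.
Proof. by elim: s => //= y s ->; rewrite eqxx orbT. Qed.

Lemma kb_convex s u v w : prefix s u -> prefix s w -> kb u v -> kb v w -> prefix s v.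
Proof.
elim: s u v w => [|x s IH] [|y u] [|z v] [|t w] //=.
move=> /andP[/eqP<- pu] /andP[/eqP<- pw].
case: (ltngtP x z) => //= _ Hu Hw; exact: IH Hu Hw.
Qed.

(** The leftmost branch: the current prefix is extended by the least letter that an element of [B]
    allows. Since [B] has no least element the construction never stops, and [B] lies along the
    branch or to its right. *)
Lemma kb_min (B : seq nat -> Prop) : (exists u, B u) ->
  (forall u, B u -> exists v, B v /\ kb v u) ->
  exists f, forall n, (exists v, B v /\ prefix (mkseq f n) v) /\
    forall v, B v -> prefix (mkseq f n) v \/ kb (mkseq f n) v.
Proof.
move=> [u0 B0] noMin.
pose good_pair s := (exists v, B v /\ prefix s v) /\ forall v, B v -> prefix s v \/ kb s v.
have /choice[step Hstep] : forall s, exists c, good_pair s -> good_pair (rcons s c).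
  move=> s; case: (EM (good_pair s)) => [[[v [Bv pv]] Hs]|]; last by exists 0.
  (* If [v] is [s] itself, an element of [B] below it must properly extend [s], since otherwise it
     would lie above [s]. *)
  have [w [c [u [Bw Ew]]]] : exists w c u, B w /\ w = s ++ c :: u.
    have /prefixP[[|c u] Ev] := pv; last by exists v, c, u.
    rewrite cats0 in Ev; have [w [Bw ltw]] := noMin _ Bv.
    have [/prefixP[[|c u] Ew]|lt] := Hs _ Bw; last 1 first.
    - by have := kb_trans lt ltw; rewrite Ev kb_irr.
    - by move: ltw; rewrite Ew cats0 Ev kb_irr.
    - by exists w, c, u.
  have ex : exists c, `[< exists u, B (s ++ c :: u) >].
    by exists c; apply/asboolP; exists u; rewrite -Ew.
  case: (ex_minnP ex) => m /asboolP[um Bm] Hm; exists m => _; split.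
    by exists (s ++ m :: um); rewrite -cat_rcons prefix_prefix cat_rcons.
  move=> v' Bv'; case: (Hs _ Bv') => [/prefixP[[|c' u'] E]|lt].
  - by right; rewrite E cats0 -cats1 kb_cons.
  - have : m <= c' by apply: Hm; apply/asboolP; exists u'; rewrite -E.
    rewrite leq_eqVlt => /predU1P[->|lt].
      by left; rewrite E -cat_rcons prefix_prefix.
    by right; rewrite E -cats1 kb_cat /= lt.
  - right; apply: kb_trans lt; rewrite -cats1; exact: kb_cons.
pose g n := iter n (fun s => rcons s (step s)) [::].
exists (fun n => step (g n)) => n.
suff -> : mkseq (fun n => step (g n)) n = g n.
  elim: n => [|n IH] /=; last exact: Hstep.
  by split; [exists u0; rewrite prefix0s|move=> v _; left; rewrite prefix0s].
by elim: n => // n IH; rewrite mkseqS IH.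
Qed.

(* Moving the root of the Kleene-Brouwer order to the bottom provides a least
   element and removes the greatest one. *)
Definition mlt (u v : seq nat) : bool := (v != [::]) && ((u == [::]) || kb u v).

Lemma mlt_kb u v : u != [::] -> v != [::] -> mlt u v = kb u v.
Proof. by rewrite /mlt => /negbTE-> ->. Qed.

Lemma kb_strict_linear : strict_linear (fun u v => kb u v).
Proof.
split; [by move=> u; rewrite kb_irr|exact: kb_trans|exact: kb_tot].
Qed.

Lemma mlt_strict_linear : strict_linear (fun u v => mlt u v).
Proof.
split.
- by move=> u; rewrite /mlt kb_irr orbF; case: eqP.
- move=> u v w /andP[nv H] /andP[nw]; rewrite (negbTE nv) /= => lt.
  by rewrite /mlt nw; case/orP: H => [->//|H]; rewrite (kb_trans H lt) orbT.
- move=> [|x u] [|y v]; rewrite /mlt /=; auto.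
  exact: (kb_tot (x :: u) (y :: v)).
Qed.

Definition kbc u v := kb (sdec u) (sdec v).
Definition mltc u v := mlt (sdec u) (sdec v).
Definition mlec (u v : nat) : bool := (u == v) || mltc u v.

Lemma strict_linear_inj (T U : Type) (h : T -> U) (lt : U -> U -> Prop) : injective h ->
  strict_linear lt -> strict_linear (fun x y => lt (h x) (h y)).
Proof.
move=> ih [i t o]; split.
- by move=> x; apply: i.
- by move=> x y z; apply: t.
- by move=> x y; case: (o (h x) (h y)) => [/ih|]; auto.
Qed.

Lemma kbc_strict_linear : strict_linear (fun u v => kbc u v).
Proof. exact: strict_linear_inj sdec_inj kb_strict_linear. Qed.
Lemma mltc_strict_linear : strict_linear (fun u v => mltc u v).
Proof. exact: strict_linear_inj sdec_inj mlt_strict_linear. Qed.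

Lemma kbc_wo_on (X : nat -> Prop) :
  (forall f, ~ forall n, exists v, X v /\ prefix (mkseq f n) (sdec v)) ->
  wo_on X (fun u v => kbc u v).
Proof.
move=> nop B [x [Xx Bx]]; apply: contrapT => nomin.
have [||f Hf] := @kb_min (fun s => X (seqcode s) /\ B (seqcode s)).
- by exists (sdec x); rewrite sdecK.
- move=> u [Xu Bu]; apply: contrapT => nomin'; apply: nomin.
  exists (seqcode u); split=> // y Xy By.
  have [E|[H|H]] := kb_tot u (sdec y).
  + by left; rewrite E sdecK.
  + by right; rewrite /kbc seqcodeK.
  + by case: nomin'; exists (sdec y); rewrite sdecK.
apply: (nop f) => n; have [[v [[Xv _] pv]] _] := Hf n.
by exists (seqcode v); rewrite seqcodeK.
Qed.

Lemma mltc_wo_on (X : nat -> Prop) :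
  (forall f, ~ forall n, exists v, X v /\ prefix (mkseq f n) (sdec v)) ->
  wo_on X (fun u v => mltc u v).
Proof.
move=> nop B [x [Xx Bx]].
case: (EM (X 0 /\ B 0)) => [[X0 B0]|n0].
  exists 0; split=> // y _ _; rewrite /mltc sdec0 /mlt /= andbT.
  by case: eqP => E; [left; apply: sdec_inj; rewrite E|right].
have nz y : X y -> B y -> sdec y != [::].
  by move=> Xy By; apply/eqP => E; apply: n0; rewrite -(sdec_inj (etrans E (esym sdec0))).
have [|y [Xy By Hy]] := kbc_wo_on nop (B := B); first by exists x.
exists y; split=> // z Xz Bz; case: (Hy z Xz Bz); [by left|right].
by rewrite /mltc mlt_kb // nz.
Qed.

Lemma fc_kb A f g : fcomp A f -> fcomp A g ->
  fcomp A (fun m x => kb (sdec (f m x)) (sdec (g m x))).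
Proof.
apply: (@fc_comp2 _ (fun u v => kb (sdec u) (sdec v))).
(* [i] is the length of the longest common prefix: [u] goes on there, while [v] ends or has a larger
   letter. *)
have E u v : kb u v = has (fun i => [&& all (fun j => (j < size v) && (nth 0 u j == nth 0 v j)) (iota 0 i)
    & (i == size v) || (i < size v) && (nth 0 u i < nth 0 v i)]) (iota 0 (size u)).
  elim: u v => //= x u IH [|y v] /=; first by [].
  rewrite IH -[1]/(1 + 0) iotaDl has_map /=.
  case: (ltngtP x y) => //= H.
    apply/esym/negbTE/hasPn => i _; rewrite /= -[1]/(1+0) iotaDl /= negb_and.
    by have /negbTE-> : x != y by rewrite neq_ltn H orbT.
  apply: eq_has => i /=; rewrite H eqxx /= eqSS ltnS -[1]/(1+0) iotaDl all_map.
  by congr (_ && _); apply: eq_all => j /=.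
apply: (@fc_ext _ (fun m z => has (fun i => [&& all (fun j => (j < size (sdec (rgt z))) &&
   (nth 0 (sdec (lft z)) j == nth 0 (sdec (rgt z)) j)) (iota 0 i)
   & (i == size (sdec (rgt z))) || (i < size (sdec (rgt z))) &&
     (nth 0 (sdec (lft z)) i < nth 0 (sdec (rgt z)) i)]) (iota 0 (size (sdec (lft z)))))).
  by move=> m x _; rewrite -E.
fcs.
Qed.
#[export] Hint Resolve fc_kb : fc.

Lemma fc_mltc A f g : fcomp A f -> fcomp A g -> fcomp A (fun m x => mltc (f m x) (g m x)).
Proof.
apply: (@fc_comp2 _ (fun u v => mltc u v)); rewrite /mltc /mlt.
apply: (@fc_ext _ (fun m z => (rgt z != 0) && ((lft z == 0) || kb (sdec (lft z)) (sdec (rgt z))))).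
  have E x : (sdec x == [::]) = (x == 0).
    by rewrite -(inj_eq sdec_inj) sdec0.
  by move=> m x _; rewrite -!E.
fcs; apply: fc_kb; fcs.
Qed.
#[export] Hint Resolve fc_mltc : fc.

Lemma fc_kbc A f g : fcomp A f -> fcomp A g -> fcomp A (fun m x => kbc (f m x) (g m x)).
Proof. exact: fc_kb. Qed.
#[export] Hint Resolve fc_kbc : fc.

(** * Self-referential choice of a tree *)

(* A letter is a triple (a, b, r): the [a] form a node of the tree [t], the [b] a
   node of the tree [npair e e], and [r] is free, so that every subtree occurs
   infinitely often to its own right. *)
Definition letter1 c := lft c.
Definition letter2 c := lft (rgt c).
Definition letter a b r := npair a (npair b r).

Lemma letter1K a b r : letter1 (letter a b r) = a. Proof. by rewrite /letter1 lftK. Qed.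
Lemma letter2K a b r : letter2 (letter a b r) = b. Proof. by rewrite /letter2 rgtK lftK. Qed.

Definition prodtree (t e : nat) (s : seq nat) : bool := ptree t (map letter1 s) && ptree (npair e e) (map letter2 s).
Definition dom_prod t e x : bool := prodtree t e (sdec x).

Lemma prodtree_prefix t e s s' : prodtree t e (s ++ s') -> prodtree t e s.
Proof. by rewrite /prodtree !map_cat => /andP[/ptree_prefix-> /ptree_prefix->]. Qed.

Lemma map_mkseq_nth (h : nat -> nat) s : map h s = mkseq (fun i => h (nth 0 s i)) (size s).
Proof.
apply: (@eq_from_nth _ 0); rewrite ?size_mkseq ?size_map // => i lti.
by rewrite nth_mkseq // (nth_map 0).
Qed.

Lemma fc_dom_prod A f g h : fcomp A f -> fcomp A g -> fcomp A h ->
  fcomp A (fun m x => dom_prod (f m x) (g m x) (h m x)).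
Proof.
apply: (@fc_comp3 _ (fun t e x => dom_prod t e x)).
apply: (@fc_ext _ (fun m z =>
  ptree (lft z) (sdec (seqcode (mkseq (fun i => lft (nth 0 (sdec (rgt (rgt z))) i)) (size (sdec (rgt (rgt z)))))))
  && ptree (npair (lft (rgt z)) (lft (rgt z))) (sdec (seqcode (mkseq (fun i => lft (rgt (nth 0 (sdec (rgt (rgt z))) i))) (size (sdec (rgt (rgt z))))))))).
  by move=> m z _; rewrite !seqcodeK /dom_prod /prodtree !map_mkseq_nth.
fcs; apply: fc_ptree; fcs.
Qed.
#[export] Hint Resolve fc_dom_prod : fc.

Definition up_prod t e x z : bool := dom_prod t e z && ((x == z) || mltc x z).

Lemma fc_up_prod A f g h k : fcomp A f -> fcomp A g -> fcomp A h -> fcomp A k ->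
  fcomp A (fun m x => up_prod (f m x) (g m x) (h m x) (k m x)).
Proof.
apply: (@fc_comp4 _ (fun t e x z => up_prod t e x z)); rewrite /up_prod; fcs.
  by apply: fc_dom_prod; fcs.
apply: fc_mltc; fcs.
Qed.
#[export] Hint Resolve fc_up_prod : fc.

Definition ptreec k l := ptree k (sdec l).

(** [comparison] with 0 for [None], other values shifted by one, and the existential witness turned
    into a function [H]: what remains is Pi^0_1 in [F] and [H]. *)
Definition final_comparison t e x k (F : nat -> nat) (H : nat -> nat -> nat) : Prop :=
  forall l, ptreec k l -> [/\ F l != 0 -> up_prod t e x (F l).-1,
    forall l', ptreec k l' -> kbc l l' -> F l' != 0 -> F l != 0 /\ mltc (F l).-1 (F l').-1 &
    forall z, up_prod t e x z -> (F l != 0) && (((F l).-1 == z) || mltc (F l).-1 z) \/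
       [/\ ptreec k (H l z), kbc (H l z) l & F (H l z) = z.+1]].

(* True when the tree [npair e e] is well founded, by comparison of well-orders,
   and of form Sigma^1_1. *)
Definition compares_all e := forall t x k, dom_prod t e x ->
  (exists f, ispath k f) \/ exists F H, final_comparison t e x k F H.

Lemma prefix_path k (h : nat -> nat) f n v :
  ptree k (map h v) -> prefix (mkseq f n) v -> ptree k (mkseq (h \o f) n).
Proof.
move=> HV /prefixP[w E]; move: HV; rewrite E map_cat => /ptree_prefix.
by rewrite /mkseq -map_comp.
Qed.

Lemma prod_wo_on t e : ~ (exists f, ispath (npair e e) f) ->
  wo_on (fun x => dom_prod t e x) (fun u v => mltc u v).
Proof.
move=> np; apply: mltc_wo_on => f Hf; apply: np; exists (letter2 \o f) => n.
by have [v [/andP[_ Hv] /(prefix_path Hv)]] := Hf n.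
Qed.

Lemma kbc_wo_on_ptree k : ~ (exists f, ispath k f) -> wo_on (fun l => ptreec k l) (fun u v => kbc u v).
Proof.
move=> np; apply: kbc_wo_on => f Hf; apply: np; exists f => n.
have [v [Hv pv]] := Hf n; rewrite -(map_id (sdec v)) in pv.
by apply: (@prefix_path k id f n (sdec v)); rewrite map_id // in pv *.
Qed.

Lemma wf_compares_all e : ~ (exists f, ispath (npair e e) f) -> compares_all e.
Proof.
move=> np t x k Dx; case: (EM (exists f, ispath k f)) => [|npk]; [by left|right].
have woX : wo_on (fun z => up_prod t e x z) (fun u v => mltc u v).
  by apply: (wo_on_sub _ (@prod_wo_on t e np)) => z /andP[].
have [F0 [c1 c2 c3]] := wo_on_compare kbc_strict_linear (kbc_wo_on_ptree npk) woX.
pose F l := if F0 l is Some y then y.+1 else 0.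
have /choice[H HH] : forall p, exists h, ptreec k p.1 -> up_prod t e x p.2 ->
    (F p.1 != 0) && (((F p.1).-1 == p.2) || mltc (F p.1).-1 p.2) \/
       [/\ ptreec k h, kbc h p.1 & F h = p.2.+1].
  move=> [l z] /=; case: (EM (ptreec k l /\ up_prod t e x z)) => [[Vl Xz]|nVX]; last first.
    by exists 0 => Vl Xz; case: nVX.
  have [[y [Ey Hy]]|[h [Vh lt Eh]]] := c3 l z Vl Xz; last by exists h => _ _; right; rewrite /F Eh.
  exists 0 => _ _; left; rewrite /F Ey /=; case: Hy => [->|->]; rewrite ?eqxx ?orbT //.
exists F, (fun l z => H (l, z)) => l Vl; split.
- by rewrite /F; case E: (F0 l) => [y|] // _; apply: c1 E.
- move=> l' Vl' lt; rewrite /F; case E: (F0 l') => [y'|] // _.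
  by have [y [-> lt']] := c2 _ _ _ Vl Vl' lt E.
- by move=> z Xz; apply: (HH (l, z)).
Qed.

(** For each triple [j] of [t], [x], [k], the function [f] codes a choice between the two
    alternatives (slot 0), a path (slot 1), [F] (slot 2) and [H] (slot 3). The number [l'] doubles
    as a guess of the value of [H]: evaluating [F] directly at a value of [f] would leave the use
    unbounded. *)
Definition compares_all_check (e m : nat) (f : nat -> nat) : bool :=
  let j := lft m in let t := lft j in let x := lft (rgt j) in let k := rgt (rgt j) in
  let l := lft (rgt m) in let z := lft (rgt (rgt m)) in let l' := rgt (rgt (rgt m)) in
  dom_prod t e x ==>
  (if f (npair 0 j) == 0
   then ptree k (sdec (seqcode (mkseq (fun n => f (npair 1 (npair j n))) l)))
   else ptree k (sdec l) ==>
     [&& (f (npair 2 (npair j l)) != 0) ==> up_prod t e x (f (npair 2 (npair j l))).-1,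
       [&& ptree k (sdec l'), kbc l l' & f (npair 2 (npair j l')) != 0] ==>
         (f (npair 2 (npair j l)) != 0) && mltc (f (npair 2 (npair j l))).-1 (f (npair 2 (npair j l'))).-1
     & up_prod t e x z ==> ((f (npair 2 (npair j l)) != 0) &&
          (((f (npair 2 (npair j l))).-1 == z) || mltc (f (npair 2 (npair j l))).-1 z))
       || ((f (npair 3 (npair j (npair l z))) == l') ==>
           [&& ptree k (sdec l'), kbc l' l & f (npair 2 (npair j l')) == z.+1])]).

Definition compares_all_use m := let j := lft m in
  let l := lft (rgt m) in let z := lft (rgt (rgt m)) in let l' := rgt (rgt (rgt m)) in
  (npair 0 j + npair 1 (npair j l) + npair 2 (npair j l) + npair 2 (npair j l') +
  npair 3 (npair j (npair l z))).+1.

Lemma compares_all_check_local e m f g : (forall i, i < compares_all_use m -> f i = g i) -> compares_all_check e m f = compares_all_check e m g.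
Proof.
move=> H; rewrite /compares_all_check !H; try by rewrite /compares_all_use; lia.
congr (_ ==> (if _ then ptree _ (sdec (seqcode _)) else _)).
apply: (@eq_from_nth _ 0); rewrite ?size_mkseq // => i lti; rewrite !nth_mkseq //.
apply: H; rewrite /compares_all_use.
have : npair 1 (npair (lft m) i) <= npair 1 (npair (lft m) (lft (rgt m))).
  by rewrite !leq_npair // ltnW.
lia.
Qed.

Lemma compares_all_index : exists e0, forall e, (exists f, ispath (npair e0 e) f) <-> compares_all e.
Proof.
have [||e0 [He0 _]] := @sigma_index compares_all_check compares_all_use _ _ compares_all_check_local.
- by rewrite /compares_all_use; fcs.
- rewrite /compares_all_check; fcs; try (by apply: fc_dom_prod; fcs); try (by apply: fc_ptree; fcs);
    try (by apply: fc_up_prod; fcs); try (by apply: fc_mltc; fcs); by apply: fc_kb; fcs.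
exists e0 => e; split=> [[f /He0 Hf] t x k Dx|HP].
  pose j := npair t (npair x k).
  have HQ l z l' := Hf (npair j (npair l (npair z l'))).
  case E: (f (npair 0 j) == 0).
    left; exists (fun n => f (npair 1 (npair j n))) => n.
    by have := HQ n 0 0; rewrite /compares_all_check /= !lrE Dx E /= seqcodeK.
  right; exists (fun l => f (npair 2 (npair j l))), (fun l z => f (npair 3 (npair j (npair l z)))).
  move=> l Vl; rewrite /ptreec in Vl *.
  split.
  - by move=> H; have := HQ l 0 0; rewrite /compares_all_check /= !lrE Dx E Vl /= H /= => /and3P[].
  - move=> l' Vl' lt H; have := HQ l 0 l'; rewrite /compares_all_check /= !lrE Dx E Vl /= => /and3P[_ + _].
    by rewrite Vl' lt H /= => /andP.
  - move=> z Xz; have := HQ l z (f (npair 3 (npair j (npair l z)))).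
    rewrite /compares_all_check /= !lrE Dx E Vl /= => /and3P[_ _]; rewrite Xz eqxx /= => /orP[->|]; first by left.
    by case/and3P=> H1 H2 /eqP H3; right.
have /choice[w Hw] : forall j, exists w : (nat * (nat -> nat)) * ((nat -> nat) * (nat -> nat -> nat)),
   dom_prod (lft j) e (lft (rgt j)) ->
   if w.1.1 == 0 then ispath (rgt (rgt j)) w.1.2 else final_comparison (lft j) e (lft (rgt j)) (rgt (rgt j)) w.2.1 w.2.2.
  move=> j; case D: (dom_prod _ _ _); last by exists ((0, id), (id, fun _ => id)).
  have [[f Hf]|[F [H HH]]] := HP _ _ (rgt (rgt j)) D.
    by exists ((0, f), (id, fun _ => id)).
  by exists ((1, id), (F, H)).
pose f n := let j := lft (rgt n) in let y := rgt (rgt n) in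
  if lft n == 0 then (w (rgt n)).1.1 else
  if lft n == 1 then (w j).1.2 y else
  if lft n == 2 then (w j).2.1 y else (w j).2.2 (lft y) (rgt y).
exists f; apply/He0 => m; rewrite /compares_all_check.
have f0 j : f (npair 0 j) = (w j).1.1 by rewrite /f !lrE.
have f1 j y : f (npair 1 (npair j y)) = (w j).1.2 y by rewrite /f !lrE.
have f2 j y : f (npair 2 (npair j y)) = (w j).2.1 y by rewrite /f !lrE.
have f3 j y z : f (npair 3 (npair j (npair y z))) = (w j).2.2 y z by rewrite /f !lrE.
rewrite !f0 !f2 !f3; move: (lft m) (lft (rgt m)) (lft (rgt (rgt m))) (rgt (rgt (rgt m))) => j l z l'.
apply/implyP => D; have := Hw j D; case: eqP => [E|_] HC.
  rewrite seqcodeK (eq_mkseq (g := (w j).1.2)) //; exact: HC.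
apply/implyP => Vl; have [H1 H2 H3] := HC _ Vl; apply/and3P; split.
- exact/implyP.
- by apply/implyP => /and3P[Vl' lt H]; apply/andP; apply: H2.
- apply/implyP => /H3[->//|[G1 G2 G3]]; apply/orP; right.
  by apply/implyP => /eqP<-; rewrite G2 G3 eqxx !andbT.
Qed.

(* For the index [e] of [compares_all] itself, the tree [npair e e] has a path if and only
   if [compares_all e] holds, and it cannot be well founded since then [compares_all e] would hold. *)
Lemma good_index : exists e, (exists f, ispath (npair e e) f) /\ compares_all e.
Proof.
have [e He] := compares_all_index; exists e.
case: (EM (exists f, ispath (npair e e) f)) => [/[dup] H /He|np]; first by [].
by have /He := wf_compares_all np.
Qed.

(** * Orders of Harrison type *)

Record oneplus_dense (T : Type) (lt : T -> T -> Prop) (b : T) : Prop := OneplusDense {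
  od_lin : strict_linear lt;
  od_min : forall x, x = b \/ lt b x;
  od_dense : forall x y, lt x y -> exists z, lt x z /\ lt z y;
  od_nomax : forall x, exists y, lt x y }.

Definition pmono (T U : Type) (ltT : T -> T -> Prop) (ltU : U -> U -> Prop) (p : list (T * U)) :=
  forall x y, List.In x p -> List.In y p -> (ltT x.1 y.1 <-> ltU x.2 y.2).

Lemma list_max (T A : Type) (lt : T -> T -> Prop) (h : A -> T) (P : A -> Prop) (p : list A) :
  strict_linear lt -> (exists x, List.In x p /\ P x) ->
  exists x, [/\ List.In x p, P x & forall y, List.In y p -> P y -> h y = h x \/ lt (h y) (h x)].
Proof.
move=> lin; elim: p => [[x []]//|a p IH] [x0 [Ix0 Px0]].
case: (EM (exists x, List.In x p /\ P x)) => [/IH[x [Ix Px Hx]]|nE]; last first.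
  have Pa : P a by case: Ix0 => [->//|Ix0]; case: nE; exists x0.
  exists a; split=> //=; first by left.
  by move=> y [->|Iy] Py; [left|case: nE; exists y].
case: (EM (P a /\ lt (h x) (h a))) => [[Pa lt1]|nPa].
  exists a; split=> //=; first by left.
  move=> y [->|Iy] Py; first by left.
  by right; case: (Hx y Iy Py) => [->//|lt2]; apply: (sl_trans lin) lt2 lt1.
exists x; split=> //=; first by right.
move=> y [<-|Iy] Py; last exact: Hx.
case: (sl_tot lin (h a) (h x)) => [|[|lt1]]; auto.
by case: nPa.
Qed.

Lemma strict_linear_rev T (lt : T -> T -> Prop) : strict_linear lt -> strict_linear (fun x y => lt y x).
Proof.
case=> i t o; split=> // [x y z H1 H2|x y]; first exact: t H2 H1.
by case: (o x y) => [|[]]; auto.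
Qed.

(** The image goes between those of the nearest paired points on both sides of [a]. The pair of
    least elements guarantees a neighbour below; if there is none above, the absence of a greatest
    element helps. *)
Lemma pmono_extend (T U : Type) (ltT : T -> T -> Prop) (ltU : U -> U -> Prop) bT bU p a :
  oneplus_dense ltT bT -> oneplus_dense ltU bU -> pmono ltT ltU p -> List.In (bT, bU) p ->
  exists b, pmono ltT ltU ((a, b) :: p).
Proof.
move=> dT dU Hp Ib.
have lT := od_lin dT; have lU := od_lin dU.
have asymT x y : ltT x y -> ltT y x -> False by move=> H /(sl_trans lT H); apply: sl_irr.
have asymU x y : ltU x y -> ltU y x -> False by move=> H /(sl_trans lU H); apply: sl_irr.
case: (EM (exists b, List.In (a, b) p)) => [[b Iab]|nIa].
  exists b => x y [<-|Ix] [<-|Iy]; try exact: Hp.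
have lba : ltT bT a.
  by case: (od_min dT a) => [E|//]; case: nIa; exists bU; rewrite E.
have [|[l l'] [Il /= ltl Hl]] := @list_max _ _ ltT fst (fun x => ltT x.1 a) p lT.
  by exists (bT, bU).
have [b [ltlb Hb]] : exists b, ltU l' b /\ forall x, List.In x p -> ltT a x.1 -> ltU b x.2.
  case: (EM (exists x, List.In x p /\ ltT a x.1)) => [ex|nex].
    have [[u u'] [Iu /= ltu Hu]] := @list_max _ _ _ fst (fun x => ltT a x.1) p (strict_linear_rev lT) ex.
    have [b [lb1 lb2]] : exists z, ltU l' z /\ ltU z u'.
      apply: (od_dense dU); apply/(Hp (l, l') (u, u')) => //; exact: (sl_trans lT) ltl ltu.
    exists b; split=> // -[x x'] Ix /= ltx.
    case: (Hu _ Ix ltx) => /= [E|lt1].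
      case: (sl_tot lU x' u') => [->//|[] lt2].
      - by move/(Hp (x, x') (u, u') Ix Iu): lt2 => /=; rewrite E => /(sl_irr lT).
      - by move/(Hp (u, u') (x, x') Iu Ix): lt2 => /=; rewrite E => /(sl_irr lT).
    apply: (sl_trans lU) lb2 _; exact/(Hp (u, u') (x, x')).
  have [b ltb] := od_nomax dU l'; exists b; split=> // x Ix ltx; case: nex; by exists x.
have Hb' x : List.In x p -> ltT x.1 a -> ltU x.2 b.
  case: x => x x' Ix /= ltx; case: (Hl _ Ix ltx) => /= [E|lt1].
    case: (sl_tot lU x' l') => [->//|[] lt2].
    - by move/(Hp (x, x') (l, l') Ix Il): lt2 => /=; rewrite E => /(sl_irr lT).
    - by move/(Hp (l, l') (x, x') Il Ix): lt2 => /=; rewrite E => /(sl_irr lT).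
  apply: (sl_trans lU) ltlb; exact/(Hp (x, x') (l, l')).
have triangle x : List.In x p -> ltT x.1 a /\ ltU x.2 b \/ ltT a x.1 /\ ltU b x.2.
  move=> Ix; case: (sl_tot lT x.1 a) => [E|[lt1|lt1]].
  - by case: nIa; exists x.2; rewrite -E -surjective_pairing.
  - by left; split=> //; apply: Hb'.
  - by right; split=> //; apply: Hb.
exists b => x y [<-|Ix] [<-|Iy] /=; last exact: Hp.
- by split=> [/(sl_irr lT)|/(sl_irr lU)].
- by case: (triangle _ Iy) => -[H1 H2]; split=> // H3;
    [case: (asymT _ _ H1 H3)|case: (asymU _ _ H2 H3)].
- by case: (triangle _ Ix) => -[H1 H2]; split=> // H3;
    [case: (asymT _ _ H1 H3)|case: (asymU _ _ H2 H3)].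
Qed.

Lemma pmono_swap (T U : Type) (ltT : T -> T -> Prop) (ltU : U -> U -> Prop) p :
  pmono ltT ltU p -> pmono ltU ltT (List.map (fun x => (x.2, x.1)) p).
Proof.
move=> H x y /List.in_map_iff[x' [<- Ix]] /List.in_map_iff[y' [<- Iy]] /=.
by rewrite (H _ _ Ix Iy).
Qed.

Lemma swapK (T U : Type) (p : list (T * U)) :
  List.map (fun x => (x.2, x.1)) (List.map (fun x => (x.2, x.1)) p) = p.
Proof. by elim: p => //= -[a b] p ->. Qed.

Theorem cantor (T U : Type) (ltT : T -> T -> Prop) (ltU : U -> U -> Prop) bT bU
    (cT : T -> nat) (cU : U -> nat) : injective cT -> injective cU ->
  oneplus_dense ltT bT -> oneplus_dense ltU bU ->
  exists f : T -> U, [/\ forall x y, ltT x y <-> ltU (f x) (f y) & forall y, exists x, f x = y].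
Proof.
move=> iT iU dT dU.
pose ok p := pmono ltT ltU p /\ List.In (bT, bU) p.
have /choice[st Hst] : forall np : nat * list (T * U), exists p', ok np.2 -> [/\ ok p',
    forall x, List.In x np.2 -> List.In x p',
    forall x, cT x = np.1 -> exists y, List.In (x, y) p' &
    forall y, cU y = np.1 -> exists x, List.In (x, y) p'].
  move=> [n p] /=; case: (EM (ok p)) => [[Hp Ip]|]; last by exists [::].
  have [p1 [[Hp1 Ip1] S1 C1]] : exists p', [/\ ok p', forall x, List.In x p -> List.In x p' &
      forall x, cT x = n -> exists y, List.In (x, y) p'].
    case: (EM (exists x, cT x = n)) => [[x Ex]|nx]; last first.
      by exists p; split=> // x Ex; case: nx; exists x.
    have [y Hy] := pmono_extend x dT dU Hp Ip.
    exists ((x, y) :: p); split=> [|z|z Ez]; [by split=> //; right|by right|].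
    by exists y; left; rewrite (iT _ _ (etrans Ex (esym Ez))).
  case: (EM (exists y, cU y = n)) => [[y Ey]|ny]; last first.
    by exists p1 => _; split=> // y Ey; case: ny; exists y.
  have [|x Hx] := pmono_extend y dU dT (pmono_swap Hp1).
    by apply/List.in_map_iff; exists (bT, bU).
  exists ((x, y) :: p1) => _; split.
  - split; last by right.
    by have := pmono_swap Hx; rewrite /= swapK.
  - by move=> z Iz; right; apply: S1.
  - by move=> z /C1[u Iu]; exists u; right.
  - by move=> z Ez; exists x; left; rewrite (iU _ _ (etrans Ey (esym Ez))).
(* Stage [n] treats the elements with code [n] on both sides. *)
pose p n := nat_rect (fun _ => list (T * U)) [:: (bT, bU)] (fun i r => st (i, r)) n.
have okp n : ok (p n).
  elim: n => [|n IH]; last by have [] := Hst (n, p n) IH.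
  split; last by left.
  move=> x y [<-|[]] [<-|[]] /=.
  by split=> [/(sl_irr (od_lin dT))|/(sl_irr (od_lin dU))].
have sub n k x : List.In x (p n) -> List.In x (p (n + k)).
  elim: k => [|k IH] Ix; first by rewrite addn0.
  by rewrite addnS; have [_ H _ _] := Hst (n + k, p (n + k)) (okp _); apply/H/IH.
have mono n n' x y : List.In x (p n) -> List.In y (p n') -> (ltT x.1 y.1 <-> ltU x.2 y.2).
  move=> Ix Iy; have [H _] := okp (n + n'); apply: H; first exact: sub.
  by rewrite addnC; apply: sub.
have /choice[f Hf] : forall x, exists y, exists n, List.In (x, y) (p n).
  move=> x; have [_ _ H _] := Hst (cT x, p (cT x)) (okp _).
  by have [y Iy] := H x erefl; exists y, (cT x).+1.
exists f; split.
  by move=> x y; have [n In] := Hf x; have [n' In'] := Hf y; apply: (mono _ _ _ _ In In').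
move=> y; have [_ _ _ H] := Hst (cU y, p (cU y)) (okp _).
have [x Ix] := H y erefl; exists x; have [n' In'] := Hf x.
have Ix' : List.In (x, y) (p (cU y).+1) by [].
case: (sl_tot (od_lin dU) (f x) y) => // -[lt|lt].
  by move/(mono _ _ _ _ In' Ix'): lt => /(sl_irr (od_lin dT)).
by move/(mono _ _ _ _ Ix' In'): lt => /(sl_irr (od_lin dT)).
Qed.

Section OnePlusQ.
Import Order.TTheory GRing.Theory Num.Theory.

Lemma onepQ_dense : oneplus_dense onepQ_lt None.
Proof.
split.
- split.
  + by case=> //= a; rewrite ltxx.
  + by case=> [a|] [b|] [c|] //=; apply: lt_trans.
  + case=> [a|] [b|] /=; auto.
    by case: (ltgtP a b) => [||->]; auto.
- by case=> [a|]; [right|left].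
- case=> [a|] [b|] //=.
    move=> lab; exists (Some ((a + b) / 2%:R)%R) => /=.
    by rewrite (midf_lt lab).1 (midf_lt lab).2.
  by move=> _; exists (Some (b - 1)%R); split=> //=; rewrite ltrBlDr ltrDl.
- by case=> [a|]; [exists (Some (a + 1)%R) => /=; rewrite ltrDl|exists (Some 0%R)].
Qed.

End OnePlusQ.

Lemma pickle_inj (T : countType) : injective (@pickle T).
Proof. exact: pcan_inj pickleK. Qed.

(** * Order isomorphisms and the uniqueness of omega_1^ck *)

Definition le_of (T : Type) (lt : T -> T -> Prop) (x y : T) := x = y \/ lt x y.
Definition lt_of (T : Type) (le : T -> T -> Prop) (x y : T) := le x y /\ x <> y.

Section OrderIso.
Variables (T U : Type).

Lemma mono_le (A : T -> Prop) (ltT : T -> T -> Prop) (ltU : U -> U -> Prop) (f : T -> U) :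
  strict_linear ltT -> strict_linear ltU -> (forall x y, A x -> A y -> ltT x y -> ltU (f x) (f y)) ->
  forall x y, A x -> A y ->
    (f x = f y -> x = y) /\ (le_of ltT x y <-> le_of ltU (f x) (f y)).
Proof.
move=> lT lU H x y Ax Ay.
have inj : f x = f y -> x = y.
  move=> E; case: (sl_tot lT x y) => [//|[/(H _ _ Ax Ay)|/(H _ _ Ay Ax)]]; rewrite E => /(sl_irr lU) [].
split=> //; split=> [[->|/(H _ _ Ax Ay)]|[/inj->|lt]]; [by left|by right|by left|].
case: (sl_tot lT x y) => [->|[|/(H _ _ Ay Ax) lt']]; [by left|by right|].
by case: (sl_irr lU (sl_trans lU lt lt')).
Qed.

Lemma oiso_sym (A : T -> Prop) leT (B : U -> Prop) leU (t0 : T) :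
  order_iso A leT B leU -> order_iso B leU A leT.
Proof.
move=> [f [f1 f2 f3 f4]].
have /choice[g Hg] : forall y, exists x, B y -> A x /\ f x = y.
  move=> y; case: (EM (B y)) => [/f3[x Hx]|nB]; first by exists x.
  by exists t0.
exists g; split.
- by move=> y /Hg[].
- by move=> x y /Hg[_ E] /Hg[_ E'] Eg; rewrite -E -E' Eg.
- move=> x Ax; exists (f x); split; first exact: f1.
  have [Agf E] := Hg _ (f1 _ Ax); exact: f2 E.
- move=> x y Bx By; have [Ax Ex] := Hg _ Bx; have [Ay Ey] := Hg _ By.
  by rewrite (f4 _ _ Ax Ay) Ex Ey.
Qed.

Lemma wo_strict_linear (le : T -> T -> Prop) : linear_on (fun=> True) le -> strict_linear (lt_of le).
Proof.
move=> [r a t o]; split.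
- by move=> x [].
- move=> x y z [lxy nxy] [lyz nyz]; split; first exact: t lxy lyz.
  by move=> E; apply: nxy; apply: a => //; rewrite E.
- move=> x y; case: (EM (x = y)) => [|nE]; first by left.
  right; case: (o x y I I) => H; [left|right]; split=> //; exact: nesym.
Qed.

Lemma le_ofE (le : T -> T -> Prop) : linear_on (fun=> True) le ->
  forall x y, le x y <-> le_of (lt_of le) x y.
Proof.
move=> [r _ _ _] x y; split=> [H|[->|[]]] //; last exact: r.
by case: (EM (x = y)) => [|nE]; [left|right].
Qed.

Lemma wo_wo_on (le : T -> T -> Prop) : well_order le -> wo_on (fun=> True) (lt_of le).
Proof.
move=> [lin H] B [x [_ Bx]]; have [|m [Bm Hm]] := H B; first by exists x.
by exists m; split=> // y _ /Hm /(le_ofE lin).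
Qed.

End OrderIso.

Lemma oiso_trans (T U S : Type) (A : T -> Prop) leT (B : U -> Prop) leU (C : S -> Prop) leS :
  order_iso A leT B leU -> order_iso B leU C leS -> order_iso A leT C leS.
Proof.
move=> [f [f1 f2 f3 f4]] [g [g1 g2 g3 g4]]; exists (g \o f); split.
- by move=> x /f1/g1.
- by move=> x y Ax Ay /g2 E; apply: f2 => //; apply: E; apply: f1.
- move=> z /g3[y [/f3[x [Ax <-]] <-]]; by exists x.
- by move=> x y Ax Ay; rewrite f4 // g4 //; apply: f1.
Qed.

Lemma copy_iso (T U : Type) (A : T -> Prop) leT (B : U -> Prop) leU :
  order_iso A leT B leU -> has_computable_copy B leU -> has_computable_copy A leT.
Proof. by move=> H [C [R [HC HR H']]]; exists C, R; split=> //; apply: oiso_trans H H'. Qed.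

Lemma mono_oiso (T U : Type) (A : T -> Prop) leT (B : U -> Prop) leU (f : T -> U) :
  linear_on (fun=> True) leT -> linear_on (fun=> True) leU ->
  (forall x, A x -> B (f x)) -> (forall y, B y -> exists x, A x /\ f x = y) ->
  (forall x y, A x -> A y -> lt_of leT x y -> lt_of leU (f x) (f y)) ->
  order_iso A leT B leU.
Proof.
move=> lT lU f1 f3 f4; have H := mono_le (wo_strict_linear lT) (wo_strict_linear lU) f4.
exists f; split=> //.
- by move=> x y Ax Ay; have [] := H _ _ Ax Ay.
- move=> x y Ax Ay; rewrite (le_ofE lT) (le_ofE lU).
  by have [] := H _ _ Ax Ay.
Qed.

(** Well-orders are comparable, and the shorter one would be a proper initial segment of the other,
    hence have a computable copy. *)
Theorem omega1ck_unique (W W' : Type) (le : W -> W -> Prop) (le' : W' -> W' -> Prop) :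
  is_omega1ck le -> is_omega1ck le' -> order_iso (fun=> True) le (fun=> True) le'.
Proof.
move=> [wo nc ini] [wo' nc' ini'].
have lin := wo.1; have lin' := wo'.1.
have ws := wo_wo_on wo; have ws' := wo_wo_on wo'.
have sl := wo_strict_linear lin; have sl' := wo_strict_linear lin'.
have [F [_ c2 c3]] := wo_on_compare sl ws ws'.
have Finj l l' y : F l = Some y -> F l' = Some y -> l = l'.
  move=> E E'; case: (sl_tot sl l l') => [//|[] lt].
    by have [z [Ez lz]] := c2 _ _ _ I I lt E'; move: lz; rewrite E in Ez; case: Ez => -> /(sl_irr sl').
  by have [z [Ez lz]] := c2 _ _ _ I I lt E; move: lz; rewrite E' in Ez; case: Ez => -> /(sl_irr sl').
case: (EM (exists l, F l = None)) => [[l El]|total].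
  have [|l0 [_ E0 H0]] := ws (fun l => F l = None); first by exists l.
  have /choice[f Hf] : forall z, exists l', lt_of le l' l0 /\ F l' = Some z.
    move=> z; have [[y []]|[l' [_ H1 H2]]] := c3 l0 z I I; [by rewrite E0|by exists l'].
  case: nc'; apply: copy_iso (ini l0); apply: (@mono_oiso _ _ _ _ _ _ f lin' lin).
  - by move=> z _; have [] := Hf z.
  - move=> l1 lt1; case E1: (F l1) => [z|].
      by exists z; split=> //; have [_ E'] := Hf z; apply: Finj E' E1.
    by case: (H0 l1 I E1) => [E|lt2]; [case: (lt1) => _; rewrite E|
      case: (sl_irr sl (sl_trans sl lt1 lt2))].
  - move=> z z' _ _ lt; have [_ E] := Hf z; have [_ E'] := Hf z'.
    case: (sl_tot sl (f z) (f z')) => [Ef|[//|lt']].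
      by move: E; rewrite Ef E' => -[Ez]; move: lt; rewrite Ez => /(sl_irr sl').
    have [y [Ey lty]] := c2 _ _ _ I I lt' E.
    by move: Ey; rewrite E' => -[Ez]; case: (sl_irr sl' (sl_trans sl' lt _)); rewrite Ez.
have /choice[f Hf] : forall l, exists y, F l = Some y.
  by move=> l; case E: (F l) => [y|]; [exists y|case: total; exists l].
have fm x y : True -> True -> lt_of le x y -> lt_of le' (f x) (f y).
  move=> _ _ lt; have [z [Ez ltz]] := c2 _ _ _ I I lt (Hf y).
  by move: Ez; rewrite Hf => -[->].
have fI l y z : F l = Some y -> lt_of le' z y -> exists l', f l' = z.
  move=> E lt; have [[y' [Ey' Hy']]|[l' [_ _ E']]] := c3 l z I I.
    move: Ey'; rewrite E => -[Eyy]; rewrite -Eyy in Hy'; case: Hy' => [Ez|lt'].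
      by move: lt; rewrite Ez => /(sl_irr sl').
    by case: (sl_irr sl' (sl_trans sl' lt lt')).
  by exists l'; move: E'; rewrite Hf => -[].
case: (EM (forall z, exists l, f l = z)) => [onto|nonto].
  apply: (@mono_oiso _ _ _ _ _ _ f lin lin') => // z _; have [l El] := onto z; by exists l.
have [|z [_ nz Hz]] := ws' (fun z => ~ exists l, f l = z).
  apply: contrapT => H; apply: nonto => z; apply: contrapT => nz; apply: H; by exists z.
case: nc; apply: copy_iso (ini' z); apply: (@mono_oiso _ _ _ _ _ _ f lin lin') => //.
- move=> l _; apply: contrapT => nlt; case: (sl_tot sl' (f l) z) => [E|[//|lt]].
    by apply: nz; exists l.
  by apply: nz; apply: fI lt.
- move=> y lt; apply: contrapT => ny; case: (Hz y I) => [[l El]|E|lt'].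
  + by apply: ny; exists l.
  + by move: lt; rewrite E => /(sl_irr sl').
  + by case: (sl_irr sl' (sl_trans sl' lt lt')).
Qed.

(** * Decomposition of an order into copies of omega_1^ck *)

Section Structure.
Variables (X : nat -> Prop) (lt : nat -> nat -> Prop).
Hypothesis lin : strict_linear lt.
Local Notation le := (le_of lt).

Definition itv_on x z : nat -> Prop := fun y => [/\ X y, le x y & le y z].
Definition wo_above c : nat -> Prop := fun z => [/\ X z, le c z & wo_on (itv_on c z) lt].
Definition wo_above_type c := {z | wo_above c z}.
Definition wo_above_le c (u v : wo_above_type c) : Prop := le (sval u) (sval v).
(** Bounding a common well-ordered interval is an equivalence relation with convex classes, by
    [wo_on_itv_sub] and [wo_on_itv_cat]; these are the least elements of classes. *)
Definition classfirst z := X z /\ forall w, X w -> lt w z -> ~ wo_on (itv_on w z) lt.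

Lemma le_trans x y z : le x y -> le y z -> le x z.
Proof.
case=> [->//|H] [<-|H']; first by right.
by right; apply: (sl_trans lin) H H'.
Qed.

Lemma lt_asym x y : lt x y -> le y x -> False.
Proof.
move=> H [E|H']; first by move: H; rewrite E => /(sl_irr lin).
exact: (sl_irr lin) (sl_trans lin H H').
Qed.

Lemma leNgt x y : ~ lt y x -> le x y.
Proof. by case: (sl_tot lin x y) => [->|[]]; [left|right|]. Qed.

Lemma wo_on_itv_sub x z x' z' : le x x' -> le z' z -> wo_on (itv_on x z) lt -> wo_on (itv_on x' z') lt.
Proof.
move=> H1 H2 H; apply: (wo_on_sub _ H) => y [Xy H3 H4]; split=> //.
  exact: le_trans H1 H3.
exact: le_trans H4 H2.
Qed.

Lemma wo_on_itv_cat x y z : le x y -> le y z ->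
  wo_on (itv_on x y) lt -> wo_on (itv_on y z) lt -> wo_on (itv_on x z) lt.
Proof.
move=> xy yz H1 H2 B [u [Iu Bu]].
case: (EM (exists u, itv_on x y u /\ B u)) => [/H1[m [[Xm mx my] Bm Hm]]|nE].
  exists m; split=> //; first by split=> //; apply: le_trans my yz.
  move=> v [Xv xv vz] Bv.
  case: (EM (le v y)) => [vy|nvy]; first by apply: Hm.
  have: le y v by apply: leNgt => H; apply: nvy; right.
  by move/(le_trans my); case; [left|right].
have yu v : itv_on x z v -> B v -> itv_on y z v.
  move=> [Xv xv vz] Bv; split=> //; apply: leNgt => H; apply: nE; exists v; split=> //.
  by split=> //; right.
have [|m [[Xm ym mz] Bm Hm]] := H2 B; first by exists u; split=> //; apply: yu.
exists m; split=> //; last by move=> v Iv' Bv; apply: Hm => //; apply: yu.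
by split=> //; apply: le_trans ym.
Qed.

Lemma sig_inj (P : nat -> Prop) : injective (@sval nat P).
Proof. by move=> [x p] [y q] /= E; subst; congr exist; apply: Prop_irrelevance. Qed.

(** If [z'] were not above [z], the interval from [c] to [c'] would be well-ordered, and [c'] would
    not be first in its class. *)
Lemma wo_above_lt c c' z z' : classfirst c' -> X c -> wo_above c z -> wo_above c' z' -> lt c c' -> lt z z'.
Proof.
move=> [Xc' cf] Xc [Xz cz wz] [Xz' cz' wz'] ltc.
case: (sl_tot lin z z') => [E|[//|H]]; exfalso; apply: (cf c Xc ltc).
  by apply: wo_on_itv_sub wz; [left|rewrite E].
by apply: wo_on_itv_sub wz; [left|apply: le_trans cz' _; right].
Qed.

Hypothesis omega : forall c, X c -> is_omega1ck (@wo_above_le c).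
Hypothesis has_first : forall x, X x -> exists z, classfirst z /\ wo_above z x.
Hypothesis comp_up : forall c, X c -> has_computable_copy (fun z => X z /\ le c z) le.
Hypothesis comp_iv : forall c c', X c -> X c' ->
  has_computable_copy (fun z => [/\ X z, le c z & lt z c']) le.
Variable b : nat.
Hypotheses (Xb : X b) (bmin : forall x, X x -> le b x).

Lemma wo_above_nocopy c : X c -> ~ has_computable_copy (wo_above c) le.
Proof.
move=> Xc H; have [_ nc _] := omega Xc; apply: nc; apply: copy_iso H.
exists sval; split=> //.
- by case.
- by move=> x y _ _; apply: sig_inj.
- by move=> y Yy; exists (exist _ y Yy).
Qed.

Lemma wo_above_self c : X c -> wo_above c c.
Proof.
move=> Xc; split=> //; first by left.
move=> B [x [[Xx cx xc] Bx]]; exists x; split=> // y [Xy cy yc] _; left.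
have E u : le c u -> le u c -> u = c.
  by case=> [->//|H] H'; case: (lt_asym H H').
by rewrite (E x) // (E y).
Qed.

(** The well-ordered part above [c] has no computable copy, so it cannot fill [P]; the class of a
    remaining point starts after [c]. With intervals and final segments for [P], this makes the
    order of classes dense and unbounded. *)
Lemma between c (P : nat -> Prop) : X c -> has_computable_copy P le ->
  (forall z, P z -> X z /\ le c z) -> (forall z, wo_above c z -> P z) ->
  exists c' x, [/\ P x, classfirst c', lt c c', le c' x & wo_above c' x].
Proof.
move=> Xc Pc PX YP.
have [x [Px nYx]] : exists x, P x /\ ~ wo_above c x.
  apply: contrapT => nE; apply: (wo_above_nocopy Xc); apply: copy_iso Pc.
  exists id; split=> // y Py; exists y; split=> //; apply: contrapT => nY; apply: nE; by exists y.
have [Xx cx] := PX _ Px; have [c' [cf Yx]] := has_first Xx; exists c', x; split=> //; last by case: Yx.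
case: (sl_tot lin c c') => [E|[//|H]]; case: nYx; first by rewrite E.
by split=> //; case: Yx => _ _; apply: wo_on_itv_sub; [right|left].
Qed.

(** The classes, ordered by their first elements, form a countable dense order with a least and no
    greatest element, that is, 1 + Q. Each class is identified with that of [b] by the uniqueness of
    omega_1^ck. *)
Theorem structure_iso : exists (W : Type) (leW : W -> W -> Prop),
  is_omega1ck leW /\ order_iso X le (fun=> True) (times_onepQ leW).
Proof.
exists (wo_above_type b), (@wo_above_le b); split; first exact: omega.
pose K := {c | classfirst c}.
have cfb : classfirst b by split=> // w Xw ltw; case: (lt_asym ltw (bmin Xw)).
pose kb : K := exist _ b cfb.
pose ltK (k k' : K) := lt (sval k) (sval k').
have dK : oneplus_dense ltK kb.
  split.
  - exact: strict_linear_inj (@sig_inj _) lin.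
  - move=> [c cf]; case: (bmin cf.1) => [E|H]; [left|by right].
    by apply: sig_inj.
  - move=> [c cf] [c' cf'] ltc; rewrite /ltK /= in ltc.
    have [||d [x [[Xx cx xc] cfd ltd dx Yx]]] := between cf.1 (comp_iv cf.1 cf'.1).
    + by move=> z [].
    (* The class of [c] stays below [c'], which is the first element of another class. *)
    + move=> z [Xz cz wz]; split=> //.
      case: (sl_tot lin z c') => [E|[//|H]]; case: cf' => Xc' cf'; case: (cf' c cf.1 ltc).
        by rewrite -E.
      by apply: wo_on_itv_sub wz; [left|right].
    + exists (exist _ d cfd); split=> //=; rewrite /ltK /=.
      by case: dx => [->//|H]; apply: (sl_trans lin) H xc.
  - move=> [c cf]; have [||d [x [_ cfd ltd _ _]]] := between cf.1 (comp_up cf.1) => //.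
      by move=> z [].
    by exists (exist _ d cfd).
have [g [gm gs]] := cantor (@sig_inj _) (@pickle_inj _) dK onepQ_dense.
have gi k k' : g k = g k' -> k = k'.
  move=> E; case: (sl_tot (od_lin dK) k k') => [//|[] /gm]; rewrite E;
  by move/(sl_irr (od_lin onepQ_dense)).
have iota (k : K) : exists i : wo_above_type (sval k) -> wo_above_type b,
    [/\ injective i, forall w, exists u, i u = w & forall u v, le (sval u) (sval v) <-> le (sval (i u)) (sval (i v))].
  have [i [_ i2 i3 i4]] := omega1ck_unique (omega (proj1 (svalP k))) (omega Xb).
  exists i; split=> [u v|w|u v]; first exact: i2.
    by have [u [_ H]] := i3 w I; exists u.
  exact: i4.
pose i k := projT1 (cid (iota k)).
have iP k := projT2 (cid (iota k)).
have /boolp.choice[f Hf] : forall z, exists wq : wo_above_type b * option rat, X z ->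
    exists (k : K) (hz : wo_above (sval k) z), wq = (i k (exist _ z hz), g k).
  move=> z; case: (EM (X z)) => [Xz|nX]; last by exists (exist _ b (wo_above_self Xb), None).
  have [c [cf Yz]] := has_first Xz; exists (i (exist _ c cf) (exist _ z Yz), g (exist _ c cf)) => _.
  by exists (exist _ c cf), Yz.
exists f; split=> //.
- move=> x y Xx Xy; have [k [hx ->]] := Hf x Xx; have [k' [hy ->]] := Hf y Xy.
  case=> E /gi Ek; subst k'; have [ii _ _] := iP k.
  by case: (ii _ _ E).
- move=> [w q] _; have [k Ek] := gs q; have [_ /(_ w)[[z hz] Ew] _] := iP k.
  exists z; have Xz : X z by case: (hz).
  split=> //; have [k' [hz' ->]] := Hf z Xz.
  have Ekk : k' = k.
    apply: sig_inj; case: (sl_tot lin (sval k') (sval k)) => [//|[] H].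
      by case/(sl_irr lin): (wo_above_lt (svalP k) (proj1 (svalP k')) hz' hz H).
    by case/(sl_irr lin): (wo_above_lt (svalP k') (proj1 (svalP k)) hz hz' H).
  subst k'; rewrite -Ek -Ew; congr (i k _, _); exact: sig_inj.
- move=> x y Xx Xy; have [k [hx ->]] := Hf x Xx; have [k' [hy ->]] := Hf y Xy.
  rewrite /times_onepQ /=.
  case: (sl_tot lin (sval k) (sval k')) => [E|[H|H]].
  + have {}E : k = k' by apply: sig_inj.
    subst k'; have [_ _ im] := iP k.
    have /= -> := im (exist _ x hx) (exist _ y hy).
    split=> [H|[/(sl_irr (od_lin onepQ_dense)) []|[]]//]; by right.
  + split=> _; last by right; exact: wo_above_lt (svalP k') (proj1 (svalP k)) hx hy H.
    by left; apply/gm.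
  + have lt' := wo_above_lt (svalP k) (proj1 (svalP k')) hy hx H.
    split=> [xy|[/gm lt''|[/gi Ek _]]].
    * by case: (lt_asym lt' xy).
    * by case: (sl_irr lin (sl_trans lin H lt'')).
    * by move: H; rewrite Ek => /(sl_irr lin).
Qed.

End Structure.

Lemma comparison_initial (T U : Type) (L : T -> Prop) ltL (X : U -> Prop) ltX F l z :
  strict_linear ltL -> strict_linear ltX -> wo_on L ltL -> comparison L ltL X ltX F -> L l -> F l = Some z ->
  wo_on (fun y => X y /\ le_of ltX y z) ltX.
Proof.
move=> lL lX wL [c1 c2 c3] Ll El B [y0 [[Xy0 yz0] By0]].
have inv y : X y -> le_of ltX y z -> exists l', L l' /\ F l' = Some y.
  move=> Xy [->|lt]; first by exists l.
  have [[y' [Ey' Hy']]|[l' [H1 _ H2]]] := c3 l y Ll Xy; last by exists l'.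
  move: Ey'; rewrite El => -[Ez]; rewrite -Ez in Hy'.
  case: Hy' => [E|lt']; first by move: lt; rewrite E => /(sl_irr lX).
  by case: (sl_irr lX (sl_trans lX lt lt')).
have [|m [Lm [y [[[Xy yz] By] Ey]] Hm]] :=
    wL (fun l => exists y, ((X y /\ le_of ltX y z) /\ B y) /\ F l = Some y).
  by have [l' [Ll' El']] := inv _ Xy0 yz0; exists l'; split=> //; exists y0.
exists y; split=> // u [Xu uz] Bu; have [l' [Ll' El']] := inv _ Xu uz.
have [|E|lt] := Hm l' Ll'; first by exists u.
  by left; move: El'; rewrite -E Ey => -[].
have [y' [Ey' lty]] := c2 _ _ _ Lm Ll' lt El'.
by right; move: Ey'; rewrite Ey => -[->].
Qed.

(* An order on a set of naturals embeds into the Kleene-Brouwer order of the tree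
   of its descending sequences: map [y] to the successive minima, in the order of
   [nat], of the elements above [y]. *)
Section Records.
Variables (C : pred nat) (R : rel nat).
Hypothesis lin : linear_on (fun x => C x) (fun x y => R x y).

Definition isrec y z : bool :=
  [&& C z, R y z & all (fun z' => C z' && R y z' ==> R z z') (iota 0 z)].
Definition recs y := [seq z <- iota 0 y.+1 | isrec y z].

Lemma isrecP y z : reflect [/\ C z, R y z & forall z', z' < z -> C z' -> R y z' -> R z z'] (isrec y z).
Proof.
apply: (iffP and3P) => -[H1 H2 H3]; split=> //.
  move=> z' lt Cz' Rz'; move/allP: H3 => /(_ z').
  by rewrite mem_iota add0n lt Cz' Rz' => /(_ isT).
by apply/allP => z'; rewrite mem_iota => /andP[_ lt]; apply/implyP => /andP[]; apply: H3.
Qed.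

Lemma isrec_leq y z : C y -> isrec y z -> z <= y.
Proof.
have [r a t o] := lin => Cy /isrecP[Cz yz H]; rewrite leqNgt; apply/negP => lt.
by move: (lt); rewrite (a z y) ?ltnn //; apply: H => //; apply: r.
Qed.

Lemma isrec_self y : C y -> isrec y y.
Proof. by have [r _ _ _] := lin => Cy; apply/isrecP; split=> //; apply: r. Qed.

Lemma recs_widen y n : C y -> y < n -> recs y = [seq z <- iota 0 n | isrec y z].
Proof.
move=> Cy lt; rewrite /recs -[in RHS](subnKC lt) iotaD filter_cat.
rewrite [X in _ = _ ++ X](_ : _ = [::]) ?cats0 //; apply/eqP; rewrite -(negbK (_ == _)) -has_filter.
apply/hasPn => z; rewrite mem_iota => Hz; apply/negP => /(isrec_leq Cy); lia.
Qed.

(** The lists agree below the least [z0] in [C] with [R y z0] but not [R y' z0]. There [recs y] has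
    the entry [z0], whereas [recs y'] ends or continues with a larger number. *)
Lemma recs_mono y y' : C y -> C y' -> R y y' -> y != y' -> kb (recs y) (recs y').
Proof.
have [r a t o] := lin => Cy Cy' Ryy ne.
have nRy : ~~ R y' y by apply/negP => H; case/eqP: ne; apply: a.
have ex : exists z, [&& C z, R y z & ~~ R y' z].
  by exists y; rewrite Cy nRy (r _ Cy).
case: (ex_minnP ex) => z0 /and3P[Cz0 yz0 nz0] Hmin.
have agree z : z < z0 -> C z -> R y z = R y' z.
  move=> lt Cz; apply/idP/idP => [H|]; last exact: t.
  by apply/negPn/negP => H'; have := Hmin z; rewrite Cz H H' leqNgt lt => /(_ isT).
have z0y' : R z0 y' by case: (o y' z0 Cy' Cz0) => // H; rewrite H in nz0.
have lez0 : z0 <= y by apply: Hmin; rewrite Cy nRy (r _ Cy).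
pose n := (y + y').+1.
rewrite (@recs_widen y n) //; last by rewrite /n; lia.
rewrite (@recs_widen y' n) //; last by rewrite /n; lia.
rewrite -[n](@subnKC z0); last by rewrite /n; lia.
rewrite iotaD !filter_cat add0n.
have -> : [seq z <- iota 0 z0 | isrec y' z] = [seq z <- iota 0 z0 | isrec y z].
  apply: eq_in_filter => z; rewrite mem_iota add0n => /andP[_ lt].
  apply/isrecP/isrecP => -[Cz Rz H]; rewrite ?agree // -?agree //; split; rewrite ?agree // -?agree //.
    by move=> z' lt' Cz' Rz'; apply: H => //; rewrite -agree // (ltn_trans lt').
  by move=> z' lt' Cz' Rz'; apply: H => //; rewrite agree // (ltn_trans lt').
rewrite kb_cat.
have -> : n - z0 = (n - z0).-1.+1 by rewrite prednK // /n; lia.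
rewrite /=; have -> : isrec y z0.
  apply/isrecP; split=> // z' lt' Cz' Rz'; rewrite agree // in Rz'.
  exact: t Cz0 Cy' Cz' z0y' Rz'.
have -> : isrec y' z0 = false by rewrite /isrec (negbTE nz0) andbF.
case E: [seq z <- iota z0.+1 _ | isrec y' z] => [//|w s] /=.
have : w \in [seq z <- iota z0.+1 (n - z0).-1 | isrec y' z] by rewrite E mem_head.
by rewrite mem_filter mem_iota => /andP[_ /andP[-> _]].
Qed.

Lemma recs_desc y m : C y -> m.+1 < size (recs y) ->
  [&& C (nth 0 (recs y) m), C (nth 0 (recs y) m.+1),
     R (nth 0 (recs y) m.+1) (nth 0 (recs y) m) & nth 0 (recs y) m.+1 != nth 0 (recs y) m].
Proof.
move=> Cy lt.
have srt : sorted ltn (recs y) by apply: sorted_filter (iota_ltn_sorted _ _); apply: ltn_trans.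
have H i : i < size (recs y) -> isrec y (nth 0 (recs y) i).
  by move=> /(mem_nth 0); rewrite mem_filter => /andP[].
have lt' : nth 0 (recs y) m < nth 0 (recs y) m.+1 by apply: (sortedP 0 srt).
have /isrecP[C1 R1 _] := H m (ltnW lt); have /isrecP[C2 R2 H2] := H m.+1 lt.
by rewrite C1 C2 H2 //= neq_ltn lt' orbT.
Qed.

Lemma recs_nil y : C y -> recs y != [::].
Proof.
move=> Cy; have : y \in recs y by rewrite mem_filter isrec_self // mem_iota add0n /= ltnSn.
by case: (recs y).
Qed.

End Records.

Lemma computable_setP (A : pred nat) : fcomp any_input (fun _ x => A x) -> computable_set A.
Proof. by move=> /fcomp_code[c Hc]; exists (gnum c) => x; exists c; split. Qed.

Lemma computable_relP (R : rel nat) : fcomp any_input (fun _ z => R (lft z) (rgt z)) -> computable_rel R.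
Proof.
move=> /fcomp_code[c Hc]; exists (gnum c) => x y; exists c; split=> //.
by have := Hc xpred0 (npair x y); rewrite !lrE.
Qed.

Lemma computable_set_fc A (C : pred nat) : computable_set C -> fcomp A (fun _ x => C x).
Proof.
move=> [e He]; have [|x|c [_ Hc]] := @phi_code xpred0 e C (fun _ => True) _ _.
- by exists 0.
- by move=> _; apply: He.
- by apply: (@code_fcomp _ _ c) => x; apply: Hc.
Qed.

Lemma computable_rel_fc A (R : rel nat) : computable_rel R -> fcomp A (fun _ z => R (lft z) (rgt z)).
Proof.
move=> [e He]; have [|x|c [_ Hc]] := @phi_code xpred0 e (fun z => R (lft z) (rgt z)) (fun _ => True) _ _.
- by exists 0.
- by move=> _; rewrite -{1}(lrK x); apply: He.
- by apply: (@code_fcomp _ _ c) => x; apply: Hc.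
Qed.

(** Longer prefixes come earlier, so the nonempty prefixes of a path descend forever. *)
Lemma not_wo_on_path (X : nat -> Prop) f n0 :
  (forall n, n0 < n -> X (seqcode (mkseq f n))) -> ~ wo_on X (fun u v => mltc u v).
Proof.
move=> H /(_ (fun z => exists n, n0 < n /\ z = seqcode (mkseq f n)))[|z [_ [n [lt ->]] Hz]].
  by exists (seqcode (mkseq f n0.+1)); split; [apply: H|exists n0.+1].
have desc : mltc (seqcode (mkseq f n.+1)) (seqcode (mkseq f n)).
  rewrite /mltc !seqcodeK mkseqS -cats1 mlt_kb ?kb_cons //.
    by case: (mkseq f n).
  by rewrite -size_eq0 size_mkseq; lia.
case: (Hz (seqcode (mkseq f n.+1))); [by apply: H; lia|by exists n.+1; split=> //; lia| |].
  by move=> E; move: desc; rewrite -E => /(sl_irr mltc_strict_linear).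
by move=> H'; case: (sl_irr mltc_strict_linear (sl_trans mltc_strict_linear desc H')).
Qed.

(** * The order type of M *)

Section HarrisonM.
Variables (e t : nat) (h g : nat -> nat).
Hypothesis HP : compares_all e.
Hypothesis hpath : ispath (npair e e) h.
Hypothesis gpath : ispath t g.

Local Notation X := (fun z => is_true (dom_prod t e z)).
Local Notation lt := (fun u v => is_true (mltc u v)).
Local Notation le := (le_of lt).
Lemma mlecP u v : reflect (le u v) (mlec u v).
Proof. by apply: (iffP predU1P). Qed.

Lemma up_prodE x z : up_prod t e x z <-> X z /\ le x z.
Proof. by rewrite /up_prod; split=> [/andP[-> /mlecP]|[-> /mlecP]]. Qed.

Lemma prodtree_path f : (forall n, letter1 (f n) = g n) -> (forall n, letter2 (f n) = h n) ->
  forall n, prodtree t e (mkseq f n).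
Proof.
move=> Ea Eb n; rewrite /prodtree /mkseq -!map_comp.
by rewrite (eq_map (g := g)) // (eq_map (f := letter2 \o f) (g := h)) //; rewrite gpath hpath.
Qed.

Lemma dom_prod0 : X 0.
Proof. by have := @prodtree_path (fun n => letter (g n) (h n) 0) _ _ 0; apply => n; rewrite ?letter1K ?letter2K. Qed.

Lemma min0 x : X x -> le 0 x.
Proof.
move=> _; case: (x =P 0) => [->|nx]; [by left|right].
rewrite /mltc sdec0 /mlt /= andbT; apply/eqP => E; apply: nx.
by apply: sdec_inj; rewrite E.
Qed.

Lemma letter_ge a b r : r <= letter a b r.
Proof. exact: leq_trans (leq_npairr b r) (leq_npairr a _). Qed.

(** A letter is at least as large as its free component, so choosing this component large in the
    first letter moves a path to the right of [x]. *)
Lemma up_not_wo_on x : X x -> ~ wo_on (fun z => up_prod t e x z) lt.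
Proof.
move=> Xx; pose R := (head 0 (sdec x)).+1.
pose f n := letter (g n) (h n) (if n is 0 then R else 0).
apply: (@not_wo_on_path _ f 0) => -[//|n] _; rewrite up_prodE; split.
  by rewrite /dom_prod seqcodeK; apply: prodtree_path => m; rewrite ?letter1K ?letter2K.
right; rewrite /mltc seqcodeK /mlt /=.
case E: (sdec x) => [//|c s] /=; apply/orP; left.
have ER : R = c.+1 by rewrite /R E.
by rewrite -ER; exact: letter_ge.
Qed.

Lemma prod_copy (A : pred nat) : fcomp any_input (fun _ z => A z) -> has_computable_copy (fun z => A z) le.
Proof.
move=> HA; exists A, mlec; split; first exact: computable_setP.
  by apply: computable_relP; rewrite /mlec; fcs; apply: fc_mltc; fcs.
exists id; split=> // [y Ay|x y _ _]; first by exists y.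
by split=> /mlecP.
Qed.

Lemma has_copy_ext (T : Type) (A B : T -> Prop) le' : (forall x, A x <-> B x) ->
  has_computable_copy A le' -> has_computable_copy B le'.
Proof.
move=> E; apply: copy_iso; exists id; split=> //; first by move=> x /E.
by move=> x /E Bx; exists x.
Qed.

Lemma prod_comp_up c : X c -> has_computable_copy (fun z => X z /\ le c z) le.
Proof.
move=> _; apply: (@has_copy_ext _ (fun z => up_prod t e c z)); first exact: up_prodE.
by apply: prod_copy; apply: fc_up_prod; fcs.
Qed.

Lemma prod_comp_iv c c' : X c -> X c' ->
  has_computable_copy (fun z => [/\ X z, le c z & lt z c']) le.
Proof.
move=> _ _; apply: (@has_copy_ext _ (fun z => up_prod t e c z && mltc z c')).
  by move=> z; split=> [/andP[/up_prodE[]]|[H1 H2 H3]] //; rewrite H3 andbT; apply/up_prodE.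
by apply: prod_copy; fcs; [apply: fc_up_prod; fcs|apply: fc_mltc; fcs].
Qed.

Lemma wo_above_wo_on c : wo_on (wo_above X lt c) lt.
Proof.
move=> B [x [[Xx cx wx] Bx]].
have [|m [[Xm cm mx] Bm Hm]] := wx B; first by exists x; split=> //; split=> //; left.
exists m; split=> //.
  by split=> //; apply: (wo_on_itv_sub mltc_strict_linear) wx => //; left.
move=> y [Xy cy _] By; case: (EM (le y x)) => [yx|nyx]; first by apply: Hm.
have: le x y by apply: (leNgt mltc_strict_linear) => H; apply: nyx; right.
by move/(le_trans mltc_strict_linear mx); case; [left|right].
Qed.

(* A computable copy [(C, R)] yields a well-founded tree whose Kleene-Brouwer order
   embeds into its own part strictly below the root. *)
Lemma prod_no_copy x : X x -> ~ has_computable_copy (wo_above X lt x) le.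
Proof.
move=> Xx [C [R [cC cR [phi [p1 p2 p3 p4]]]]].
have linC : linear_on (fun x => C x) (fun x y => R x y).
  split.
  - by move=> _ /p3[z [Yz <-]]; apply/p4 => //; left.
  - move=> _ _ /p3[z [Yz <-]] /p3[z' [Yz' <-]] /p4-/(_ Yz Yz') H /p4-/(_ Yz' Yz) H'.
    by case: H => [->//|H]; case: (lt_asym mltc_strict_linear H H').
  - move=> _ _ _ /p3[z [Yz <-]] /p3[z' [Yz' <-]] /p3[z'' [Yz'' <-]].
    move=> /p4-/(_ Yz Yz') H /p4-/(_ Yz' Yz'') H'; apply/p4 => //.
    exact: (le_trans mltc_strict_linear) H H'.
  - move=> _ _ /p3[z [Yz <-]] /p3[z' [Yz' <-]].
    case: (sl_tot mltc_strict_linear z z') => [->|[] H]; [left|left|right]; apply/p4 => //; by [left|right].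
(* A path through the tree of these checks would be a descending sequence in the copy, which is
   well-ordered. *)
pose Q (p m : nat) (f : nat -> nat) := [&& C (f m), C (f m.+1), R (f m.+1) (f m) & f m.+1 != f m].
have [|||ek [Hk1 Hk2]] := @sigma_index Q (fun m => m.+2) _ _ _.
- by fcs.
- have HC A (f : (nat -> nat) -> nat -> nat) : fcomp A f -> fcomp A (fun m x => C (f m x)).
    by apply: (@fc_comp _ _ (fun _ x => C x)); apply: computable_set_fc.
  have HR A (f f' : (nat -> nat) -> nat -> nat) : fcomp A f -> fcomp A f' ->
      fcomp A (fun m x => R (f m x) (f' m x)).
    by apply: (@fc_comp2 _ (fun x y => R x y)); apply: computable_rel_fc.
  by rewrite /Q; fcs; try (by apply: HC; fcs); apply: HR; fcs.
- by move=> p m f f' H; rewrite /Q !H //.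
pose k := npair ek 0.
have npk : ~ exists f, ispath k f.
  move=> [f /Hk1 Hf].
  have Cf m : C (f m) by have /and4P[] := Hf m.
  have [|z [Yz [m Em] Hz]] := @wo_above_wo_on x (fun z => exists m, phi z = f m).
    by have [z [Yz Ez]] := p3 _ (Cf 0); exists z; split=> //; exists 0.
  have /and4P[_ _ Rm nm] := Hf m; have [z' [Yz' Ez']] := p3 _ (Cf m.+1).
  have le' : le z' z by apply/p4 => //; rewrite Em Ez'.
  case: (Hz z' Yz') => [|E|lt']; first by exists m.+1.
    by move/eqP: nm; rewrite -Ez' -Em E.
  exact: (lt_asym mltc_strict_linear lt' le').
have woL := kbc_wo_on_ptree npk.
have [//|[F [H HFH]]] := HP k Xx.
pose F' l := if F l is y.+1 then Some y else None.
have cF : comparison (fun l => ptreec k l) (fun u v => kbc u v) (fun z => up_prod t e x z) lt F'.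
  split.
  - by move=> l y Vl; rewrite /F'; case E: (F l) => [//|y'] [<-]; have [/(_ _) H1 _ _] := HFH l Vl;
      rewrite E in H1; apply: H1.
  - move=> l l' y' Vl Vl' lt; rewrite /F'; case E': (F l') => [//|y] [Ey].
    have [_ /(_ l' Vl' lt)+ _] := HFH l Vl; rewrite E' => /(_ isT).
    by case E: (F l) => [|u] [] // _ /=; exists u; rewrite -Ey.
  - move=> l z Vl Xz; have [_ _ /(_ z Xz)] := HFH l Vl => -[/andP[nF HF]|[H1 H2 H3]].
      left; rewrite /F'; case: (F l) nF HF => // u _ /= /predU1P HF; exists u; split=> //.
    by right; exists (H l z); rewrite /F' H3.
(* If [F'] ran out, the whole final segment from [x] would be well-ordered. So the tree embeds into
   the well-ordered part. *)
have tot l : ptreec k l -> exists z, F' l = Some z.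
  move=> Vl; case E: (F' l) => [z|]; first by exists z.
  by case: (up_not_wo_on Xx); apply: (comparison_exhaust cF woL Vl E).
have FY l z : ptreec k l -> F' l = Some z -> wo_above X lt x z.
  move=> Vl E; have [c1 _ _] := cF; have /up_prodE[Xz xz] := c1 _ _ Vl E; split=> //.
  apply: wo_on_sub (comparison_initial kbc_strict_linear mltc_strict_linear woL cF Vl E) => y [Xy xy yz].
  by split=> //; apply/up_prodE.
have VD y : C y -> ptreec k (seqcode (recs C R y)).
  by move=> Cy; rewrite /ptreec seqcodeK; apply: Hk2 => m; apply: recs_desc.
(* [J] composes [F'], [phi] and [recs] into an increasing self-map of the well-ordered tree. It
   moves the root, the greatest node, strictly down, and then the least node moved down is
   contradictory. *)
have /choice[J HJ] : forall l, exists l', ptreec k l -> exists z,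
    F' l = Some z /\ l' = seqcode (recs C R (phi z)).
  move=> l; case: (EM (ptreec k l)) => [Vl|]; last by exists 0.
  by have [z Ez] := tot l Vl; exists (seqcode (recs C R (phi z))) => _; exists z.
have VJ l : ptreec k l -> ptreec k (J l).
  by move=> Vl; have [z [Ez ->]] := HJ l Vl; apply/VD/p1/(FY l).
have Jmono l l' : ptreec k l -> ptreec k l' -> kbc l l' -> kbc (J l) (J l').
  move=> Vl Vl' lt; have [z [Ez ->]] := HJ l Vl; have [z' [Ez' ->]] := HJ l' Vl'.
  have [_ c2 _] := cF; have [y [Ey ltz]] := c2 _ _ _ Vl Vl' lt Ez'.
  move: Ey; rewrite Ez => -[Ezy]; rewrite -Ezy in ltz.
  have Yz := FY _ _ Vl Ez; have Yz' := FY _ _ Vl' Ez'.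
  rewrite /kbc !seqcodeK; apply: recs_mono => //; [exact: p1|exact: p1|by apply/p4 => //; right|].
  by apply/eqP => /(p2 _ _ Yz Yz') E; move: ltz; rewrite E => /(sl_irr mltc_strict_linear).
have V0 : ptreec k 0 by rewrite /ptreec sdec0; apply: Hk2.
have J0 : kbc (J 0) 0.
  have [z [Ez ->]] := HJ 0 V0; rewrite /kbc seqcodeK sdec0.
  have := recs_nil linC (p1 _ (FY _ _ V0 Ez)); by case: (recs C R (phi z)).
have [|l [Vl lJ Hl]] := woL (fun l => kbc (J l) l); first by exists 0.
case: (Hl (J l) (VJ _ Vl) (Jmono _ _ (VJ _ Vl) Vl lJ)) => [E|lt'].
  by move: lJ; rewrite -E => /(sl_irr kbc_strict_linear).
by case: (sl_irr kbc_strict_linear (sl_trans kbc_strict_linear lt' lJ)).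
Qed.

Lemma prod_omega1ck c : X c -> is_omega1ck (@wo_above_le X lt c).
Proof.
move=> Xc; have Yc := wo_above_self mltc_strict_linear Xc; split.
- split; first split.
  + by move=> u _; left.
  + move=> u v _ _ H H'; apply: sig_inj; case: H => // H; case: (lt_asym mltc_strict_linear H H').
  + by move=> u v w _ _ _; apply: (le_trans mltc_strict_linear).
  + move=> u v _ _; case: (sl_tot mltc_strict_linear (sval u) (sval v)) => [E|[] H].
    * by left; left.
    * by left; right.
    * by right; right.
  + move=> B [[x Yx] Bx].
    have [|m [Ym [Ym' Bm] Hm]] := @wo_above_wo_on c (fun z => exists Yz : wo_above X lt c z, B (exist _ z Yz)).
      by exists x; split=> //; exists Yx.
    exists (exist _ m Ym'); split=> // -[y Yy] By.
    by case: (Hm y Yy) => [|E|H]; [exists Yy|left|right].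
- apply: contra_not (prod_no_copy Xc); apply: copy_iso.
  apply: oiso_sym (exist _ c Yc) _; exists sval; split=> //.
  + by case.
  + by move=> x y _ _; apply: sig_inj.
  + by move=> y Yy; exists (exist _ y Yy).
- move=> [w Yw]; have [Xw certified ww] := Yw; apply: copy_iso (prod_comp_iv Xc Xw).
  exists sval; split=> //.
  + move=> [v [Xv cv wv]] /= [[/= E|//] nE]; case: nE; exact: sig_inj.
  + by move=> x y _ _; apply: sig_inj.
  + move=> y [Xy cy yw]; have Yy : wo_above X lt c y.
      by split=> //; apply: (wo_on_itv_sub mltc_strict_linear) ww; [left|right].
    exists (exist _ y Yy); split=> //; split; first by right.
    by move=> E; have Ew : y = w := congr1 sval E; move: yw; rewrite Ew => /(sl_irr mltc_strict_linear).
Qed.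

(* If the well-ordered intervals ending in [x] had no least starting point, their
   starting points would converge to a path [f]. Increasing the free component of
   one letter of [f] gives a path to its right, hence an infinite descending
   sequence inside such an interval. *)
Lemma prod_has_first x : X x -> exists z, classfirst X lt z /\ wo_above X lt z x.
Proof.
move=> Xx; pose Z z := [/\ X z, le z x & wo_on (itv_on X lt z x) lt].
have Zx : Z x by have [H1 H2 H3] := wo_above_self mltc_strict_linear Xx.
case: (EM (exists z, Z z /\ forall w, Z w -> le z w)) => [[z [[Xz zx wz] Hz]]|nomin].
  exists z; split; last by [].
  split=> // w Xw wltz ww; apply: (lt_asym mltc_strict_linear wltz); apply: Hz; split=> //.
    by apply: (le_trans mltc_strict_linear) zx; right.
  by apply: (wo_on_itv_cat mltc_strict_linear _ zx ww wz); right.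
exfalso.
have nz z : Z z -> sdec z != [::].
  move=> Zz; apply/eqP => E; apply: nomin; exists z; split=> // w [Xw _ _].
  have -> : z = 0 by apply: sdec_inj.
  exact: min0.
have kbE z z' : Z z -> sdec z' != [::] -> mltc z' z = kb (sdec z') (sdec z).
  by move=> Zz nz'; rewrite /mltc mlt_kb // nz.
have [||f Hf] := @kb_min (fun s => Z (seqcode s)).
- by exists (sdec x); rewrite sdecK.
- move=> u Zu; apply: contrapT => nE; apply: nomin; exists (seqcode u); split=> // w Zw.
  apply: (leNgt mltc_strict_linear) => H; apply: nE; exists (sdec w); rewrite sdecK; split=> //.
  by move: H; rewrite /mltc mlt_kb ?nz // seqcodeK.
(* Prefixes of [f] of length at least [N] are too long to be prefixes of [x], so they lie to its
   left. *)
pose N := (size (sdec x)).+1.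
have Uf n : prodtree t e (mkseq f n).
  have [[v [[Xv _ _] /prefixP[w Ev]]] _] := Hf n.
  by move: Xv; rewrite /dom_prod seqcodeK Ev => /prodtree_prefix.
have fx n : N <= n -> kb (mkseq f n) (sdec x).
  move=> lexlec; have [_ /(_ (sdec x))] := Hf n; rewrite sdecK => /(_ Zx)[/size_prefix|//].
  by rewrite size_mkseq => H; have := leq_trans lexlec H; rewrite /N ltnn.
have Zf n : N <= n -> wo_on (itv_on X lt (seqcode (mkseq f n)) x) lt.
  move=> lexlec; have [[v [[Xv vx wv] /prefixP[w Ev]]] _] := Hf n.
  apply: (wo_on_itv_sub mltc_strict_linear) wv; last by left.
  case: w Ev => [|c w] Ev; first by left; rewrite Ev cats0.
  right; rewrite /mltc !seqcodeK mlt_kb ?Ev ?kb_cons //; first by case: (mkseq f n).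
  by rewrite -size_eq0 size_mkseq; rewrite /N in lexlec; lia.
pose f' i := if i == N then letter (letter1 (f N)) (letter2 (f N)) (f N).+1 else f i.
have Uf' n : prodtree t e (mkseq f' n).
  have E (l : nat -> nat) : l (f' N) = l (f N) -> map l (mkseq f' n) = map l (mkseq f n).
    move=> H; rewrite /mkseq -!map_comp; apply: eq_map => i /=.
    by rewrite {1}/f'; case: eqP => // ->; rewrite -H /f' eqxx.
  by have := Uf n; rewrite /prodtree -!E // /f' eqxx ?letter1K ?letter2K.
have E0 : mkseq f' N = mkseq f N.
  by apply/eq_in_map => i; rewrite mem_iota add0n /f'; case: eqP => // ->; rewrite ltnn.
have pre n : N < n -> exists s, mkseq f' n = mkseq f N ++ f' N :: s.
  move=> ltn; exists (map f' (iota N.+1 (n - N.+1))).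
  by rewrite -E0 -cat_rcons -mkseqS /mkseq -[in LHS](subnKC ltn) iotaD map_cat add0n.
apply: (@not_wo_on_path _ f' N _ (Zf N.+1 (leqnSn N))) => n ltn.
have [s Es] := pre n ltn.
have nn : mkseq f' n != [::] by rewrite Es; case: (mkseq f N).
split; first by rewrite /dom_prod seqcodeK.
  right; rewrite /mltc !seqcodeK mlt_kb //.
  rewrite Es mkseqS -cats1 kb_cat /=.
  suff -> : f N < f' N by [].
  rewrite /f' eqxx; exact: letter_ge.
right; rewrite kbE ?seqcodeK //.
by apply: kb_trans (fx N (leqnn _)); rewrite Es kb_cons.
Qed.

Theorem prod_harrison_type : exists (W : Type) (leW : W -> W -> Prop),
  is_omega1ck leW /\ order_iso X le (fun=> True) (times_onepQ leW).
Proof.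
apply: (@structure_iso X lt mltc_strict_linear prod_omega1ck prod_has_first prod_comp_up prod_comp_iv 0 dom_prod0).
exact: min0.
Qed.

End HarrisonM.

(** * The reduction *)

Section MkOrder.
Variables (D : pred nat) (le : rel nat).
Hypothesis ne : exists x, D x.

Definition mk_order : structure.
Proof.
refine (@Structure (fun s => if s is 0 then Some 2 else None) (fun _ => None) D
  (fun _ xs => if xs is [:: x; y] then le x y else false) (fun _ _ => 0) ne _).
by [].
Defined.

End MkOrder.

(** The parameter [t] is hard-wired into the program by [constc], so the index is a computable
    function of it. *)
Lemma order_index (D : nat -> pred nat) (le : rel nat) :
  fcomp any_input (fun _ z => D (lft z) (rgt z)) -> fcomp any_input (fun _ z => le (lft z) (rgt z)) ->
  exists a : nat -> nat, (forall A, fcomp A (fun _ t => a t)) /\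
    forall t (ne : exists x, D t x), lists (a t) (mk_order le ne).
Proof.
move=> HD Hle.
pose G t z := if lft z == 0 then (if rgt z == 0 then 3 else 0) else
  if lft z == 2 then nat_of_bool (D t (rgt z)) else
  if lft z == 3 then nat_of_bool (le (nth 0 (sdec (rgt (rgt z))) 0) (nth 0 (sdec (rgt (rgt z))) 1))
  else 0.
have [|c Hc] := @fcomp_code (fun z => G (lft z) (rgt z)).
  have HD' (f g : (nat -> nat) -> nat -> nat) : fcomp any_input f -> fcomp any_input g ->
    fcomp any_input (fun m x => D (f m x) (g m x)) by exact: (@fc_comp2 _ (fun x y => D x y) f g HD).
  have Hle' (f g : (nat -> nat) -> nat -> nat) : fcomp any_input f -> fcomp any_input g ->
    fcomp any_input (fun m x => le (f m x) (g m x)) by exact: (@fc_comp2 _ (fun x y => le x y) f g Hle).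
  by rewrite /G; fcs; [apply: HD'|apply: Hle']; fcs.
exists (fun t => gnum (Comp c (Pair (constc t) (Pair Left Right)))); split.
  move=> A /=; fcs; apply: fc_gnum_constc; fcs.
move=> t ne.
have E z : phi0 (gnum (Comp c (Pair (constc t) (Pair Left Right)))) z (G t z).
  exists (Comp c (Pair (constc t) (Pair Left Right))); split=> //=; exists (npair t z); split.
    by exists t, z; split=> //; [exact: (eval_constc xpred0 t z)|exact: (eval_idc xpred0 z)].
  by have := Hc xpred0 (npair t z); rewrite !lrE.
split.
- by move=> s; have := E (npair 0 s); rewrite /G !lrE /=; case: s.
- by move=> s; have := E (npair 1 s); rewrite /G !lrE /=.
- by move=> s; have := E (npair 2 s); rewrite /G !lrE /=.
- move=> [|s] xs //= [Exs] _; have := E (npair 3 (npair 0 (seqcode xs))); rewrite /G !lrE seqcodeK /=.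
  by case: xs Exs => [|x [|y [|]]].
- by [].
Qed.

Lemma harrison_isomorphic M N : harrison_type M -> harrison_type N -> isomorphic M N.
Proof.
move=> [[rM fM lM] [W [le [oW iM]]]] [[rN fN lN] [W' [le' [oW' iN]]]].
have [g [_ g2 g3 g4]] := omega1ck_unique oW oW'.
have iWW : order_iso (fun=> True) (times_onepQ le) (fun=> True) (times_onepQ le').
  exists (fun u => (g u.1, u.2)); split=> //.
  - by move=> [w q] [w' q'] _ _ [/(g2 _ _ I I)-> ->].
  - by move=> [w q] _; have [w' [_ <-]] := g3 w I; exists (w', q).
  - by move=> [w q] [w' q'] _ _; rewrite /times_onepQ /= g4.
have [F [f1 f2 f3 f4]] := oiso_trans (oiso_trans iM iWW) (oiso_sym 0 iN).
exists F; split; first by split=> s; rewrite ?rM ?rN ?fM ?fN.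
split.
- by move=> x Dx; apply: f1.
- by move=> x y Dx Dy; apply: f2.
- by move=> y /f3[x [Dx Ex]]; exists x.
- move=> s xs; rewrite rM; case: s => [|s] //= [Exs].
  case: xs Exs => [|x [|y [|]]] //= _ /and3P[Dx Dy _].
  have H := f4 x y Dx Dy.
  by apply/idP/idP => H'; apply/H.
- by move=> s xs; rewrite fM.
Qed.

(** The computable copy of 1 + Q is the set of all finite lists under [mltc]: with the root at the
    bottom, the Kleene-Brouwer order of the full tree is dense with a least and no greatest
    element. *)
Definition lexlec (a b : nat) : bool :=
  mltc (lft a) (lft b) || (lft a == lft b) && mlec (rgt a) (rgt b).

Section NM.
Variables (e t : nat) (h g : nat -> nat).
Hypothesis HP : compares_all e.
Hypothesis hpath : ispath (npair e e) h.
Hypothesis gpath : ispath t g.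

Lemma prod_nonempty : exists x, dom_prod t e x.
Proof. by exists 0; exact: dom_prod0 hpath gpath. Qed.

Lemma lex_nonempty : exists x, dom_prod t e (rgt x).
Proof. by exists 0; rewrite rgt0; exact: dom_prod0 hpath gpath. Qed.

Definition prod_order := mk_order mlec prod_nonempty.
Definition lex_order := mk_order lexlec lex_nonempty.

Lemma mlec_of u v : mlec u v <-> le_of (fun u v => mltc u v) u v.
Proof. by split=> /predU1P. Qed.

Lemma mlec_refl u : mlec u u. Proof. by rewrite /mlec eqxx. Qed.
Lemma mlec_anti u v : mlec u v -> mlec v u -> u = v.
Proof.
by move=> /mlec_of[//|H] /mlec_of H'; case: (lt_asym mltc_strict_linear H H').
Qed.
Lemma mlec_trans u v w : mlec u v -> mlec v w -> mlec u w.
Proof. move=> /mlec_of H /mlec_of H'; apply/mlec_of; exact: (le_trans mltc_strict_linear) H H'. Qed.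
Lemma mlec_tot u v : mlec u v \/ mlec v u.
Proof.
by case: (sl_tot mltc_strict_linear u v) => [->|[] H]; [left; apply: mlec_refl|left|right]; apply/mlec_of; right.
Qed.

Lemma harrison_prod_order : harrison_type prod_order.
Proof.
split; first split=> //.
  split=> /=.
  - by move=> x _; apply: mlec_refl.
  - by move=> x y _ _; apply: mlec_anti.
  - by move=> x y z _ _ _; apply: mlec_trans.
  - by move=> x y _ _; apply: mlec_tot.
have [W [leW [oW [f [f1 f2 f3 f4]]]]] := prod_harrison_type HP hpath gpath; exists W, leW; split=> //.
exists f; split=> // x y Dx Dy; rewrite -f4 //; exact: mlec_of.
Qed.

Definition lexNQ (a b : nat * option rat) : Prop :=
  mltc a.1 b.1 \/ a.1 = b.1 /\ onepQ_lt a.2 b.2.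

(** The copies of omega_1^ck inside N are indexed by this product, which is therefore again 1 +
    Q. *)
Lemma lexNQ_dense : oneplus_dense lexNQ (0, None).
Proof.
have lQ := od_lin onepQ_dense; have lM := mltc_strict_linear.
split.
- split.
  + by move=> [p q] [/(sl_irr lM)|[_ /(sl_irr lQ)]].
  + move=> [p q] [p' q'] [p'' q'']; rewrite /lexNQ /= => -[H|[-> H]] [H'|[<- H']].
    * by left; apply: (sl_trans lM) H H'.
    * by left.
    * by left.
    * by right; split=> //; apply: (sl_trans lQ) H H'.
  + move=> [p q] [p' q']; rewrite /lexNQ /=.
    case: (sl_tot lM p p') => [->|[]]; auto.
    by case: (sl_tot lQ q q') => [->|[]]; auto.
- move=> [p q]; rewrite /lexNQ /=; case: (eqVneq p 0) => [->|np].
    by case: (od_min onepQ_dense q) => [->|]; auto.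
  right; left; rewrite /mltc sdec0 /mlt /= andbT; apply: contra np => /eqP E.
  by apply/eqP/sdec_inj.
- move=> [p q] [p' q'] [/= H|[/= <- H]].
    have [r Hr] := od_nomax onepQ_dense q; exists (p, r); rewrite /lexNQ /=; auto.
  have [r [H1 H2]] := od_dense onepQ_dense H; exists (p, r); rewrite /lexNQ /=; auto.
- move=> [p q]; have [r Hr] := od_nomax onepQ_dense q; exists (p, r); rewrite /lexNQ /=; auto.
Qed.

Lemma harrison_lex_order : harrison_type lex_order.
Proof.
split; first split=> //.
  have asym p q : mltc p q -> mltc q p -> False.
    by move=> H H'; apply: (lt_asym mltc_strict_linear H); right.
  split=> /=; rewrite /structure_le /= /lexlec.
  - by move=> x _; rewrite eqxx mlec_refl orbT.
  - move=> x y _ _ /orP[H|/andP[/eqP E H]] /orP[H'|/andP[/eqP E' H']].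
    + by case: (asym _ _ H H').
    + by move: H; rewrite E' => /(sl_irr mltc_strict_linear).
    + by move: H'; rewrite E => /(sl_irr mltc_strict_linear).
    + by rewrite -(lrK x) E (mlec_anti H H') lrK.
  - move=> x y z _ _ _ /orP[H|/andP[/eqP E H]] /orP[H'|/andP[/eqP E' H']].
    + by rewrite (sl_trans mltc_strict_linear H H').
    + by rewrite -E' H.
    + by rewrite E H'.
    + by rewrite E E' eqxx (mlec_trans H H') orbT.
  - move=> x y _ _; case: (sl_tot mltc_strict_linear (lft x) (lft y)) => [->|[->|->]]; auto.
    rewrite eqxx /=; case: (mlec_tot (rgt x) (rgt y)) => ->; rewrite orbT; auto.
have [W [leW [oW [f [f1 f2 f3 f4]]]]] := prod_harrison_type HP hpath gpath; exists W, leW; split=> //.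
have [c [cm cs]] := cantor (@pickle_inj _) (@pickle_inj _) lexNQ_dense onepQ_dense.
have ci u v : c u = c v -> u = v.
  move=> E; case: (sl_tot (od_lin lexNQ_dense) u v) => [//|[] /cm]; rewrite E;
  by move/(sl_irr (od_lin onepQ_dense)).
exists (fun a => ((f (rgt a)).1, c (lft a, (f (rgt a)).2))); split=> //=.
- move=> x y Dx Dy [E1 /ci[E2 E3]]; rewrite -(lrK x) E2.
  suff -> : rgt x = rgt y by rewrite lrK.
  by apply: f2 => //; apply: injective_projections.
- move=> [w q] _; have [[p r] Ec] := cs q; have [u [Du Eu]] := f3 (w, r) I.
  by exists (npair p u); rewrite !lrE Eu Ec.
- move=> x y Dx Dy; rewrite /structure_le /= /times_onepQ /= -cm /lexNQ /=.
  have {}f4 := f4 _ _ Dx Dy; rewrite /times_onepQ in f4.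
  have E : mlec (rgt x) (rgt y) <-> le_of (fun u v => mltc u v) (rgt x) (rgt y) by exact: mlec_of.
  split.
    move=> /orP[H|/andP[/eqP-> /E/f4[H|[H1 H2]]]]; first by left; left.
      by left; right.
    by right; rewrite H1.
  case=> [[H|[H1 H2]]|[/ci[H1 H2] H3]]; apply/orP; first by left.
    by right; rewrite H1 eqxx; apply/E/f4; left.
  by right; rewrite H1 eqxx; apply/E/f4; right.
Qed.

End NM.

(** * Computing a path from a dense family *)

Lemma kb_cat_cons s c u c' u' : kb (s ++ c :: u) (s ++ c' :: u') -> c <= c'.
Proof. by rewrite kb_cat /= => /orP[/ltnW//|/andP[/eqP->]]. Qed.

Lemma kb_app u v w : kb u v -> ~~ prefix v u -> kb u (v ++ w).
Proof.
elim: u v => [|d u IH] [|c v] //=.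
by rewrite [c == d]eq_sym; case: (ltngtP d c) => //= _; apply: IH.
Qed.

(** Appending 0 to the upper node [v] gives a node below [v] but above everything left of the
    subtree of [v]. If the lower node lies in that subtree, one takes instead the child of [v] next
    to the right. *)
Lemma mltc_dense q q' : mltc q q' -> exists r, mltc q r /\ mltc r q'.
Proof.
suff H u v : mlt u v -> exists w, mlt u w /\ mlt w v.
  by move=> /H[w [H1 H2]]; exists (seqcode w); rewrite /mltc seqcodeK.
case: v => [|c v] //; rewrite /mlt /=; case: u => [|d u].
  by move=> _; exists ((c :: v) ++ [:: 0]); rewrite (kb_cons (c :: v)).
move=> H; case: (boolP (prefix (c :: v) (d :: u))) => [/prefixP[[|x w] Ew]|np].
- by move: H; rewrite Ew cats0 kb_irr.
- exists ((c :: v) ++ [:: x.+1]); split; last by rewrite (kb_cons (c :: v)).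
  by rewrite Ew kb_cat /= ltnSn.
- exists ((c :: v) ++ [:: 0]); split; last by rewrite (kb_cons (c :: v)).
  exact: (@kb_app (d :: u) (c :: v) [:: 0] H np).
Qed.

(** Describes the images, under an isomorphism from N to M, of the first elements of the copies of M
    in N. *)
Definition embeds t e (m : nat -> nat) : Prop :=
  (forall q, dom_prod t e (m q)) /\ forall q q', mltc q q' -> mltc (m q) (m q').

Definition good_pair (m : nat -> nat) n p : bool :=
  [&& mltc (lft p) (rgt p), n <= size (sdec (m (lft p))), n <= size (sdec (m (rgt p)))
    & all (fun i => nth 0 (sdec (m (lft p))) i == nth 0 (sdec (m (rgt p))) i) (iota 0 n)].

Definition refines (m : nat -> nat) n p z : bool :=
  good_pair m n.+1 z && all (fun i => nth 0 (sdec (m (lft z))) i == nth 0 (sdec (m (lft p))) i) (iota 0 n).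

Lemma all_nth_take n (u v : seq nat) : n <= size u -> n <= size v ->
  all (fun i => nth 0 u i == nth 0 v i) (iota 0 n) = (take n u == take n v).
Proof.
move=> lu lv; apply/allP/eqP => H.
  apply: (@eq_from_nth _ 0); first by rewrite !size_takel.
  move=> i; rewrite size_takel // => lti; rewrite !nth_take //; apply/eqP/H.
  by rewrite mem_iota.
move=> i; rewrite mem_iota add0n => /andP[_ lti].
by rewrite -(nth_take 0 lti u) -(nth_take 0 lti v) H.
Qed.

(* Infinitely many values of [m] lie below a fixed value extending the same node
   [s]; their letters after [s] are nondecreasing and bounded, so two agree. *)
Lemma refines_ex t e m n p : embeds t e m -> good_pair m n p -> exists z, refines m n p z.
Proof.
move=> [_ me] /and4P[]; set q0 := lft p; set q1 := rgt p.
move=> lt01 l0 l1; rewrite all_nth_take // => /eqP Et.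
set s := take n (sdec (m q0)) in Et *.
have ss : size s = n by rewrite /s size_takel.
have p0 : prefix s (sdec (m q0)) by apply/prefixP; exists (drop n (sdec (m q0))); rewrite cat_take_drop.
have p1 : prefix s (sdec (m q1)) by apply/prefixP; exists (drop n (sdec (m q1))); rewrite Et cat_take_drop.
(* Subtrees are convex for [kb], and a nonempty [s] is the greatest node of its own, so a point
   strictly between properly extends it. For empty [s] only the root, now least, has to be
   excluded. *)
have ext r : mltc q0 r -> mltc r q1 -> exists c u, sdec (m r) = s ++ c :: u.
  move=> /me H0 /me H1.
  have nr : sdec (m r) != [::] by case/andP: H0.
  have n1 : sdec (m q1) != [::] by case/andP: H1.
  have k1 : kb (sdec (m r)) (sdec (m q1)) by move: H1; rewrite /mltc mlt_kb.
  case: (eqVneq s [::]) => [->|ns].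
    by case: (sdec (m r)) nr => // c u _; exists c, u.
  have n0 : sdec (m q0) != [::] by apply: contraTneq p0 => ->; case: (s) ns.
  have k0 : kb (sdec (m q0)) (sdec (m r)) by move: H0; rewrite /mltc mlt_kb.
  have /prefixP[[|c u] Er] := kb_convex p0 p1 k0 k1; last by exists c, u.
  move: k1; rewrite cats0 in Er; have /prefixP[[|c u] E1] := p1; rewrite Er E1.
    by rewrite cats0 kb_irr.
  by move/kb_trans => /(_ _ (kb_cons s c u)); rewrite kb_irr.
(* The letter of [m rs] after [s] will bound those of all the points [r i] chosen below [rs]. *)
have [rs [lts1 lts2]] := mltc_dense lt01.
have /choice[nx Hnx] : forall r, exists r', mltc r rs -> mltc r r' /\ mltc r' rs.
  move=> r; case E: (mltc r rs); last by exists 0.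
  by have [r' Hr'] := mltc_dense E; exists r'.
pose r i := iter i nx (nx q0).
have Hr i : [/\ mltc q0 (r i), mltc (r i) rs & mltc (r i) (r i.+1)].
  elim: i => [|i [H1 H2 H3]].
    by have [H1 H2] := Hnx _ lts1; split=> //; have [] := Hnx _ H2.
  have [H4 H5] := Hnx _ H2; split=> //; first exact: (sl_trans mltc_strict_linear H1 H4).
  by have [] := Hnx _ H5.
have ri1 i : mltc (r i) q1 by have [_ H _] := Hr i; exact: (sl_trans mltc_strict_linear H lts2).
have /choice[c Hc] : forall i, exists c, exists u, sdec (m (r i)) = s ++ c :: u.
  by move=> i; have [H _ _] := Hr i; apply: ext.
have [cs [us Es]] := ext _ lts1 lts2.
have nz q : mltc q0 q -> sdec (m q) != [::] by move/me/andP => [].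
have kbr q q' : mltc q0 q -> mltc q q' -> kb (sdec (m q)) (sdec (m q')).
  move=> H /[dup] H' /me; rewrite /mltc mlt_kb //; apply: nz => //.
  exact: (sl_trans mltc_strict_linear H H').
have cle i : c i <= cs.
  have [u Eu] := Hc i; have [H1 H2 _] := Hr i.
  by have := kbr _ _ H1 H2; rewrite Eu Es => /kb_cat_cons.
have [i Ei] : exists i, c i = c i.+1.
  apply: contrapT => nE.
  have ci i : i <= c i.
    elim: i => // i IH; apply: (leq_ltn_trans IH); rewrite ltn_neqAle; apply/andP; split.
      by apply/eqP => E; apply: nE; exists i.
    have [u Eu] := Hc i; have [u' Eu'] := Hc i.+1; have [H1 _ H2] := Hr i.
    by have := kbr _ _ H1 H2; rewrite Eu Eu' => /kb_cat_cons.
  by have := leq_trans (ci cs.+1) (cle cs.+1); rewrite ltnn.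
have [u Eu] := Hc i; have [u' Eu'] := Hc i.+1; have [_ _ H] := Hr i.
have sz v w : n < size (s ++ v :: w) by rewrite size_cat ss /= addnS ltnS leq_addr.
exists (npair (r i) (r i.+1)); apply/andP; rewrite /good_pair !lrE; split; first apply/and4P; first split.
- exact: H.
- by rewrite Eu sz.
- by rewrite Eu' sz.
- rewrite all_nth_take ?Eu ?Eu' ?sz //.
  by rewrite -!cat_rcons !takel_cat ?size_rcons ?ss // Ei.
- rewrite all_nth_take // ?Eu; last by rewrite ltnW.
  by rewrite -/q0 -/s -{1}ss take_size_cat.
Qed.

(** The premise makes every [z] acceptable when there is no good pair to refine, so that the search
    halts on all arguments. *)
Definition refines_total (m : nat -> nat) (x z : nat) : bool :=
  good_pair m (lft x) (rgt x) ==> refines m (lft x) (rgt x) z.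

Definition next_pair (m : nat -> nat) (x : nat) : nat :=
  if pselect (exists z, refines_total m x z) is left ex then ex_minn ex else 0.

(** The numbers 0 and 1 code the empty list and the list with the single entry 0: two points in
    increasing order, whose images share the empty prefix. *)
Definition pair_seq (m : nat -> nat) (n : nat) : nat :=
  nat_rect (fun _ => nat) (npair 0 1) (fun i r => next_pair m (npair i r)) n.

Definition path_letter (m : nat -> nat) (n : nat) : nat := nth 0 (sdec (m (lft (pair_seq m n.+1)))) n.

Definition embeddable (m : nat -> nat) : Prop := exists t e, embeds t e m.

Lemma refines_total_ex t e m x : embeds t e m -> exists z, refines_total m x z.
Proof.
move=> H; rewrite /refines_total; case E: (good_pair m (lft x) (rgt x)); last by exists 0.
by have [z Hz] := refines_ex H E; exists z.
Qed.

Lemma next_pairP t e m x : embeds t e m -> refines_total m x (next_pair m x) /\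
  forall i, refines_total m x i -> next_pair m x <= i.
Proof.
move=> /(refines_total_ex x) ex; rewrite /next_pair; case: pselect => // ex'.
by case: ex_minnP.
Qed.

Lemma fc_path_letter : fcomp embeddable path_letter.
Proof.
have Hn : fcomp embeddable next_pair.
  apply: (@fc_mu _ refines_total).
    by rewrite /refines_total /refines /good_pair; fcs; apply: fc_mltc; fcs.
  by move=> m x [t [e H]]; apply: next_pairP H.
rewrite /path_letter /pair_seq; apply: (@fc_nth _ (fun m x => m _)); last exact: fc_id.
apply/fc_orc/fc_lft; apply: (@fc_rec _ (fun m x => npair 0 1) (fun m x i r => next_pair m (npair i r))).
- by fcs.
- by apply: (@fc_comp _ _ next_pair) => //; fcs.
- by fcs.
Qed.

(** Each pair agrees with its predecessor on the prefix found so far, so the letters read at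
    different stages form one branch of the product tree. *)
Lemma path_letter_path t e m : embeds t e m -> ispath t (fun n => letter1 (path_letter m n)).
Proof.
move=> H.
have G n : good_pair m n (pair_seq m n) /\ take n (sdec (m (lft (pair_seq m n)))) = mkseq (path_letter m) n.
  elim: n => [|n [IH E]].
    by split; [rewrite /good_pair /pair_seq /= !lrE|rewrite take0].
  have [/implyP] := next_pairP (npair n (pair_seq m n)) H.
  rewrite !lrE -/(pair_seq m n.+1) => /(_ IH)/andP[gd] + _.
  have /and4P[_ l1 _ _] := gd; have /and4P[_ l2 _ _] := IH.
  rewrite all_nth_take ?E //; last exact: ltnW.
  move=> /eqP Et; split=> //.
  by rewrite (take_nth 0) // mkseqS -/(path_letter m n) Et.
move=> n; have [_ E] := G n; have [D _] := H.
have := D (lft (pair_seq m n)); rewrite /dom_prod -(cat_take_drop n (sdec _)) => /prodtree_prefix.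
by rewrite E /prodtree /mkseq -!map_comp => /andP[].
Qed.

(** * The tree of isomorphisms between two listed structures *)

Definition certified i z v w : bool := has (fun w' => cert i z v w') (iota 0 w).

Lemma fc_certified A f g h k : fcomp A f -> fcomp A g -> fcomp A h -> fcomp A k ->
  fcomp A (fun m x => certified (f m x) (g m x) (h m x) (k m x)).
Proof.
by apply: (@fc_comp4 _ (fun f g h k => certified f g h k)); rewrite /certified; fcs; apply: fc_cert; fcs.
Qed.

Lemma certified_mono i z v w w' : w <= w' -> certified i z v w -> certified i z v w'.
Proof.
move=> le /hasP[u Hu Cu]; apply/hasP; exists u => //.
by move: Hu; rewrite !mem_iota; lia.
Qed.

Lemma certified_fun i z v v' w : phi0 i z v -> certified i z v' w -> v' = v.
Proof.
move=> [c [<- Hc]] /hasP[u _ Cu]; apply: eval_det Hc; apply/certP; by exists u.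
Qed.

Lemma phi_certified i z v : phi0 i z v -> exists w, forall w', w <= w' -> certified i z v w'.
Proof.
move=> [c [<- /certP[w Hw]]]; exists w.+1 => w' le; apply: certified_mono le _.
by apply/hasP; exists w; rewrite // mem_iota; lia.
Qed.

(* The atomic facts of both structures are only semidecidable here, so they occur
   as certified premises or under negation. *)
Definition iso_check (p m : nat) (f : nat -> nat) : bool :=
  let i := lft p in let j := rgt p in
  let x := lft m in let y := lft (rgt m) in let w := lft (rgt (rgt m)) in
  let s := lft (rgt (rgt (rgt m))) in let X := lft (rgt (rgt (rgt (rgt m)))) in
  let v := rgt (rgt (rgt (rgt (rgt m)))) in
  let FX := seqcode (mkseq (fun k => f (npair 0 (nth 0 (sdec X) k))) (size (sdec X))) in
  [&& certified i (npair 2 x) 1 w && (f (npair 0 x) == y) ==> ~~ certified j (npair 2 y) 0 w && (f (npair 1 y) == x),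
      certified j (npair 2 y) 1 w && (f (npair 1 y) == x) ==> ~~ certified i (npair 2 x) 0 w && (f (npair 0 x) == y),
      [&& certified i (npair 0 s) (size (sdec X)).+1 w,
          all (fun k => certified i (npair 2 (nth 0 (sdec X) k)) 1 w) (iota 0 (size (sdec X))),
          certified i (npair 3 (npair s X)) x w & certified j (npair 3 (npair s FX)) y w] ==> (x == y) &
      [&& certified i (npair 1 s) (size (sdec X)).+1 w,
          all (fun k => certified i (npair 2 (nth 0 (sdec X) k)) 1 w) (iota 0 (size (sdec X))),
          certified i (npair 4 (npair s X)) x w & certified j (npair 4 (npair s FX)) y w] ==> (f (npair 0 x) == y)].

(** The entries of a list are at most its code, so [npair 0 X] bounds all arguments at which [f] is
    consulted along the list [X]. *)
Definition iso_use m := let x := lft m in let y := lft (rgt m) in let X := lft (rgt (rgt (rgt (rgt m)))) in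
  (npair 0 x + npair 1 y + npair 0 X).+1.

Lemma iso_check_local p m f g : (forall i, i < iso_use m -> f i = g i) -> iso_check p m f = iso_check p m g.
Proof.
move=> H; rewrite /iso_check.
have -> : mkseq (fun k => f (npair 0 (nth 0 (sdec (lft (rgt (rgt (rgt (rgt m)))))) k)))
    (size (sdec (lft (rgt (rgt (rgt (rgt m))))))) =
  mkseq (fun k => g (npair 0 (nth 0 (sdec (lft (rgt (rgt (rgt (rgt m)))))) k)))
    (size (sdec (lft (rgt (rgt (rgt (rgt m))))))).
  apply: (@eq_from_nth _ 0); rewrite ?size_mkseq // => i lti; rewrite !nth_mkseq //.
  apply: H; rewrite /iso_use /=.
  have leX := mem_sdec_leq (mem_nth 0 lti).
  by rewrite ltnS (leq_trans (leq_npair (leqnn 0) leX)) // leq_addl.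
by rewrite !H // /iso_use /=; lia.
Qed.

Lemma iso_index : exists e1, forall i j f, ispath (npair e1 (npair i j)) f <-> forall m, iso_check (npair i j) m f.
Proof.
have [||e1 [He1 _]] := @sigma_index iso_check iso_use _ _ iso_check_local.
- by rewrite /iso_use; fcs.
- by rewrite /iso_check; fcs; apply: fc_certified; fcs.
by exists e1 => i j f; apply: He1.
Qed.

Lemma uniform_bound (P : nat -> nat -> Prop) n : (forall k w w', w <= w' -> P k w -> P k w') ->
  (forall k, k < n -> exists w, P k w) -> exists w, forall k, k < n -> P k w.
Proof.
move=> mono; elim: n => [|n IH] H; first by exists 0.
have [w Hw] := IH (fun k lt => H k (ltnW lt)); have [w' Hw'] := H n (ltnSn n).
exists (w + w') => k; rewrite ltnS leq_eqVlt => /predU1P[->|lt].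
  by apply: mono Hw'; lia.
by apply: mono (Hw _ lt); lia.
Qed.

Section Iso.
Variables (i j : nat) (M N : structure).
Hypotheses (Mi : lists i M) (Nj : lists j N).

Lemma all_domP (D : pred nat) X : reflect (forall k, k < size X -> D (nth 0 X k)) (all D X).
Proof. exact: all_nthP. Qed.

(** Slot 0 holds the isomorphism and slot 1 its inverse; a named inverse makes surjectivity a Pi^0_1
    condition. *)
Lemma check_of_iso F : is_iso M N F -> exists f, forall m, iso_check (npair i j) m f.
Proof.
move=> [[rMN fMN] [I1 I2 I3 I4 I5]].
have [Mr Mf Md Mrel Mfun] := Mi; have [Nr Nf Nd Nrel Nfun] := Nj.
have /choice[G HG] : forall y, exists x, dom N y -> dom M x /\ F x = y.
  by move=> y; case E: (dom N y); [have [x Hx] := I3 y E; exists x|exists 0].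
exists (fun n => if lft n == 0 then F (rgt n) else G (rgt n)) => m.
have dM x (b : bool) w : certified i (npair 2 x) b w -> dom M x = b.
  by move/(certified_fun (Md x)); case: b (dom M x) => [] [].
have dN x (b : bool) w : certified j (npair 2 x) b w -> dom N x = b.
  by move/(certified_fun (Nd x)); case: b (dom N x) => [] [].
rewrite /iso_check !lrE /=.
move: (lft m) (lft (rgt m)) (lft (rgt (rgt m))) (lft (rgt (rgt (rgt m))))
  (lft (rgt (rgt (rgt (rgt m))))) => x y w s X.
have -> : mkseq (fun k => if lft (npair 0 (nth 0 (sdec X) k)) == 0
       then F (rgt (npair 0 (nth 0 (sdec X) k)))
       else G (rgt (npair 0 (nth 0 (sdec X) k)))) (size (sdec X)) = map F (sdec X).
  by rewrite map_mkseq_nth; apply: eq_mkseq => k; rewrite !lrE.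
apply/and4P; split; apply/implyP.
- move=> /andP[/(@dM _ true) Dx /eqP <-].
  have DF : dom N (F x) by apply: I1.
  apply/andP; split; first by apply/negP => /(@dN _ false); rewrite DF.
  by have [D E] := HG _ DF; apply/eqP/I2.
- move=> /andP[/(@dN _ true) Dy /eqP <-]; have [D E] := HG _ Dy.
  rewrite E eqxx andbT; by apply/negP => /(@dM _ false); rewrite D.
- move=> /and4P[/(certified_fun (Mr s)) Er /allP Hd Hx Hy].
  have {}Er : rel_ar M s = Some (size (sdec X)) by case: (rel_ar M s) Er => // n [->].
  have DX : all (dom M) (sdec X).
    by apply/all_domP => k lt; apply: (@dM _ true w); apply: Hd; rewrite mem_iota.
  have := Mrel s _ Er DX; rewrite sdecK => /certified_fun/(_ Hx) ->.
  have DF : all (dom N) (map F (sdec X)) by rewrite all_map; apply: sub_all DX => u /I1.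
  have := Nrel s (map F (sdec X)); rewrite -rMN size_map => /(_ Er DF) /certified_fun/(_ Hy) ->.
  by rewrite I4.
- move=> /and4P[/(certified_fun (Mf s)) Er /allP Hd Hx Hy].
  have {}Er : fun_ar M s = Some (size (sdec X)) by case: (fun_ar M s) Er => // n [->].
  have DX : all (dom M) (sdec X).
    by apply/all_domP => k lt; apply: (@dM _ true w); apply: Hd; rewrite mem_iota.
  have := Mfun s _ Er DX; rewrite sdecK => /certified_fun/(_ Hx) ->.
  have DF : all (dom N) (map F (sdec X)) by rewrite all_map; apply: sub_all DX => u /I1.
  have := Nfun s (map F (sdec X)); rewrite -fMN size_map => /(_ Er DF) /certified_fun/(_ Hy) ->.
  by rewrite I5.
Qed.

(** The checks do not compare the languages, hence the hypothesis [same_language]. Any other failure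
    would be certified and seen at some stage. *)
Lemma iso_of_check f : same_language M N -> (forall m, iso_check (npair i j) m f) ->
  is_iso M N (fun x => f (npair 0 x)).
Proof.
move=> sl H; split=> //; have [rMN fMN] := sl.
have [Mr Mf Md Mrel Mfun] := Mi; have [Nr Nf Nd Nrel Nfun] := Nj.
have {}H x y w s X : iso_check (npair i j) (npair x (npair y (npair w (npair s (npair X 0))))) f by [].
have I1 x : dom M x -> dom N (f (npair 0 x)) /\ f (npair 1 (f (npair 0 x))) = x.
  move=> Dx; have := Md x; rewrite Dx => /phi_certified[w Hw].
  (* No stage certifies that the image is outside the domain of [N]; as that domain is decided by
     index [j], the image is inside. *)
  have Q w' : w <= w' -> ~~ certified j (npair 2 (f (npair 0 x))) 0 w' /\ f (npair 1 (f (npair 0 x))) = x.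
    move=> le; have := H x (f (npair 0 x)) w' 0 0; rewrite /iso_check /= !lrE => /and4P[+ _ _ _].
    by rewrite Hw // eqxx /= => /andP[-> /eqP].
  split; last by have [] := Q w (leqnn w).
  have := Nd (f (npair 0 x)); case: (dom N _) => // /phi_certified[w' Hw'].
  by have [/negP[]] := Q (w + w') (leq_addr _ _); apply: Hw'; rewrite leq_addl.
have I3 y : dom N y -> dom M (f (npair 1 y)) /\ f (npair 0 (f (npair 1 y))) = y.
  move=> Dy; have := Nd y; rewrite Dy => /phi_certified[w Hw].
  have Q w' : w <= w' -> ~~ certified i (npair 2 (f (npair 1 y))) 0 w' /\ f (npair 0 (f (npair 1 y))) = y.
    move=> le; have := H (f (npair 1 y)) y w' 0 0; rewrite /iso_check /= !lrE => /and4P[_ + _ _].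
    by rewrite Hw // eqxx /= => /andP[-> /eqP].
  split; last by have [] := Q w (leqnn w).
  have := Md (f (npair 1 y)); case: (dom M _) => // /phi_certified[w' Hw'].
  by have [/negP[]] := Q (w + w') (leq_addr _ _); apply: Hw'; rewrite leq_addl.
have bnd xs : all (dom M) xs -> exists w, forall w', w <= w' ->
    all (fun k => certified i (npair 2 (nth 0 xs k)) 1 w') (iota 0 (size xs)).
  move=> /all_domP Dx; have [||w Hw] := @uniform_bound (fun k w => forall w', w <= w' ->
      certified i (npair 2 (nth 0 xs k)) 1 w') (size xs).
  - by move=> k w w' le Hw u lu; apply: Hw; apply: leq_trans lu.
  - by move=> k lt; have := Md (nth 0 xs k); rewrite Dx // => /phi_certified.
  by exists w => w' le; apply/allP => k; rewrite mem_iota => /andP[_ lt]; apply: Hw.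
have DN xs : all (dom M) xs -> all (dom N) (map (fun x => f (npair 0 x)) xs).
  by move=> D; rewrite all_map; apply: sub_all D => u /I1[].
split.
- by move=> x /I1[].
- by move=> x y /I1[_ Ex] /I1[_ Ey] E; rewrite -Ex -Ey E.
- by move=> y /I3[D E]; exists (f (npair 1 y)).
- move=> s xs Er D; have [w1 H1] := bnd xs D.
  have [w2 H2] := phi_certified (Mr s); rewrite Er /= in H2.
  have [w3 H3] := phi_certified (Mrel s xs Er D).
  have := Nrel s (map (fun x => f (npair 0 x)) xs); rewrite -rMN size_map => /(_ Er (DN _ D)).
  move=> /phi_certified[w4 H4].
  (* The guessed values are taken to be the true ones, and the sum of the bounds is a stage at which
     all certificates are present. *)
  have := H (rel_int M s xs) (rel_int N s (map (fun x => f (npair 0 x)) xs)) (w1 + w2 + w3 + w4) s (seqcode xs).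
  rewrite /iso_check /= !lrE seqcodeK -(map_mkseq_nth (fun k => f (npair 0 k))) => /and4P[_ _ + _].
  rewrite H1 ?H2 ?H3 ?H4; [|lia..].
  have bool_inj : injective nat_of_bool by move=> [] [].
  by move=> /= /eqP/bool_inj.
- move=> s xs Er D; have [w1 H1] := bnd xs D.
  have [w2 H2] := phi_certified (Mf s); rewrite Er /= in H2.
  have [w3 H3] := phi_certified (Mfun s xs Er D).
  have := Nfun s (map (fun x => f (npair 0 x)) xs); rewrite -fMN size_map => /(_ Er (DN _ D)).
  move=> /phi_certified[w4 H4].
  have := H (fun_int M s xs) (fun_int N s (map (fun x => f (npair 0 x)) xs)) (w1 + w2 + w3 + w4) s (seqcode xs).
  rewrite /iso_check /= !lrE seqcodeK -(map_mkseq_nth (fun k => f (npair 0 k))) => /and4P[_ _ _].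
  rewrite H1 ?H2 ?H3 ?H4; [|lia..].
  by move=> /= /eqP.
Qed.

End Iso.

(** The index maps are total, but the indices are only claimed to list N and M when an isomorphism
    supplies a path. [r] transforms programs without touching the oracle. *)
Theorem reduction : exists (a b : nat -> nat -> nat) (r : nat -> nat),
  [/\ forall A, fcomp A (fun _ z => a (lft z) (rgt z)),
      forall A, fcomp A (fun _ z => b (lft z) (rgt z)),
      forall A, fcomp A (fun _ z => r z) &
      forall i j M N, lists i M -> lists j N -> isomorphic M N ->
      exists M' N', [/\ lists (a i j) M', lists (b i j) N', harrison_type M', harrison_type N' &
        forall D e, iso_by D e M' N' -> iso_by D (r e) M N]].
Proof.
have [e [[h hpath] HP]] := good_index.
have [e1 He1] := iso_index.
have fML (f g : (nat -> nat) -> nat -> nat) : fcomp any_input f -> fcomp any_input g ->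
    fcomp any_input (fun m x => mlec (f m x) (g m x)).
  by move=> Hf Hg; rewrite /mlec; fcs; apply: fc_mltc.
have [||aM [faM HaM]] := @order_index (fun t x => dom_prod t e x) mlec.
- by apply: fc_dom_prod; fcs.
- by apply: fML; fcs.
have [||aN [faN HaN]] := @order_index (fun t x => dom_prod t e (rgt x)) lexlec.
- by apply: fc_dom_prod; fcs.
- by rewrite /lexlec; fcs; [apply: fc_mltc; fcs|apply: fML; fcs].
have [K HK] : fcomp embeddable (fun m x => letter1 (path_letter m (npair 0 x))).
  by rewrite /letter1; fcs; apply: (@fc_comp _ _ path_letter) fc_path_letter _; fcs.
(* Maps [q] to the first element of the copy of M at [q]: the second component 0 codes the root, the
   least element of M. *)
pose cq := Pair (Pair Left Right) Zero.
have [gk [fgk Egk]] := gnum_plug K.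
(* [r] precomposes the isomorphism with [cq], 6 being the tag of [Comp], and substitutes the result
   into [K], which reads slot 0 of the computed path. *)
exists (fun i j => aN (npair e1 (npair i j))), (fun i j => aM (npair e1 (npair i j))),
  (fun c => gk (npair 6 (npair c (gnum cq)))).
split.
- by move=> A; apply: (@fc_comp _ _ (fun _ t => aN t)) => //; fcs.
- by move=> A; apply: (@fc_comp _ _ (fun _ t => aM t)) => //; fcs.
- by move=> A; apply: (@fc_comp _ _ (fun _ t => gk t)) => //; fcs.
move=> i j M N Mi Nj [F0 /[dup] [[sl _]] iF0]; set t := npair e1 (npair i j).
have [g /He1 gpath] := check_of_iso Mi Nj iF0.
exists (lex_order hpath gpath), (prod_order hpath gpath); split; try exact: HaM; try exact: HaN.
- exact: harrison_lex_order.
- exact: harrison_prod_order.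
move=> D c [F [[_ [F1 F2 F3 F4 _]] HF]].
have D0 q : dom_prod t e (rgt (npair q 0)) by rewrite rgtK; exact: (dom_prod0 hpath gpath).
pose m q := F (npair q 0).
have em : embeds t e m.
  split=> [q|q q' lt]; first exact: F1 (D0 q).
  (* The isomorphism preserves the non-strict order; its injectivity makes the inequality strict. *)
  have := F4 0 [:: npair q 0; npair q' 0] erefl.
  rewrite /= !D0 => /(_ isT); rewrite /lexlec !lrE lt /= => /mlec_of[E|//].
  have := F2 _ _ (D0 q) (D0 q') E => /npair_inj[Eq _].
  by move: lt; rewrite Eq => /(sl_irr mltc_strict_linear).
have [|cF [<- HcF]] := @phi_code D c F (fun x => dom_prod t e (rgt x)) _ HF.
  by exists (npair 0 0).
have Hm x : eval D (Comp cF cq) x (m x).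
  exists (npair x 0); split; last exact: HcF (D0 x).
  by exists x, 0; split=> //; apply: eval_idc.
have /He1 Hp := path_letter_path em.
exists (fun x => letter1 (path_letter m (npair 0 x))); split; first exact: (iso_of_check Mi Nj sl Hp).
move=> x _; exists (plug K (Comp cF cq)); split; first by rewrite Egk.
by apply: HK => //; exists t, e.
Qed.

(** The reduction changes indices only, so one oracle [D] serves both sides, with and without
    uniformity. *)
Theorem mainTheorem9 (d : degree) :
  (high_for_iso_harrison d <-> high_for_iso d) /\
  (uniformly_high_for_iso_harrison d <-> uniformly_high_for_iso d).
Proof.
have [a [b [r [fa fb fr red]]]] := reduction.
split; split.
- move=> H M N [i Mi] [j Nj] iso.
  have [M' [N' [Ma Nb hM hN back]]] := red _ _ _ _ Mi Nj iso.
  have [|| D [e [dD HD]]] := H M' N' _ _ hM hN; [by eexists; eassumption|by eexists; eassumption|].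
  by exists D, (r e); split=> //; apply: back.
- move=> H M N cM cN hM hN; apply: H => //; exact: harrison_isomorphic.
- move=> [D [f [dD [ef Hef] H]]].
  exists D, (fun i j => r (f (a i j) (b i j))); split=> //; last first.
    move=> i j M N Mi Nj iso; have [M' [N' [Ma Nb hM hN back]]] := red _ _ _ _ Mi Nj iso.
    by apply: back; apply: H.
  have ff : fcomp any_input (fun _ z => f (lft z) (rgt z)).
    have [||c [_ Hc]] := @phi_code xpred0 ef (fun z => f (lft z) (rgt z)) (fun _ => True).
    + by exists 0.
    + by move=> z _; rewrite -{1}(lrK z); apply: Hef.
    + by apply: (@code_fcomp _ _ c) => x; apply: Hc.
  have [|c Hc] := @fcomp_code (fun z => r (f (a (lft z) (rgt z)) (b (lft z) (rgt z)))).
    apply: (@fc_comp _ _ (fun _ t => r t)) => //.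
    exact: (@fc_comp2 _ f (fun _ z => a (lft z) (rgt z)) (fun _ z => b (lft z) (rgt z))).
  exists (gnum c) => x y; exists c; split=> //.
  by have := Hc xpred0 (npair x y); rewrite !lrE.
- move=> [D [f [dD cf H]]]; exists D, f; split=> // i j M N Mi Nj hM hN.
  by apply: H => //; apply: harrison_isomorphic.
Qed.
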